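(* Let $\sigma>1$ and $E=\{[\sigma^k]\}_{k\ge1}$, where $[x]$ is the integer part of $x$. Then the following properties are equivalent: (i) $\sigma$ is transcendental; (ii) $L^p_E(\mathbb{T})$ has complex umap for any even integer $p\ge2$; (iii) $E$ is a metric unconditional basic sequence (umbs) in $L^p(\mathbb{T})$ for any even integer $p\ge2$; (iv) $E$ is pseudo-independent; (v) for every $\varepsilon>0$ and $m\ge1$, there is an $l$ such that for all $k_1,\dots,k_m\ge l$ the Sidon constant of $\{[\sigma^{k_1}],\dots,[\sigma^{k_m}]\}$ is less than $1+\varepsilon$.
   Context: $\mathbb{T}=\{z\in\mathbb{C}:|z|=1\}$ with normalized Haar measure $m[\cdot]$; $e_n(z)=z^n$. $L^p_E(\mathbb{T})$ is the space of $f\in L^p(\mathbb{T})$ whose Fourier coefficients vanish off $E$. A separable Banach space $Y$ has complex umap (metric unconditional approximation property) if for every $\varepsilon>0$ there is a sequence $\{T_k\}_{k\ge1}$ of bounded finite-rank operators on $Y$ with $T_ky\to y$ for all $y\in Y$ such that, with $T_0=0$, $\|\sum_{k=1}^n\epsilon_k(T_k-T_{k-1})\|\le1+\varepsilon$ for all $n$ and all $\epsilon_k\in\mathbb{T}$. $E$ is a (complex) umbs in $X$ if for each $\varepsilon>0$ there is a finite set $F$ such that $\|\sum_{q\in G}\epsilon_qa_qe_q\|_X\le(1+\varepsilon)\|\sum_{q\in G}a_qe_q\|_X$ for all finite $G\subseteq E\setminus F$, $a_q\in\mathbb{C}$, $\epsilon_q\in\mathbb{T}$; the real version restricts to $\epsilon_q\in\{-1,1\}$.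 In (iii) umbs may be read in either sense. $E$ is pseudo-independent if for all $n\ge1$ and measurable $A_1,\dots,A_n\subseteq\mathbb{T}$, $m[e_{p_i}\in A_i:1\le i\le n]\to\prod_{i=1}^nm[A_i]$ as the distinct elements $p_1,\dots,p_n\in E$ tend to infinity. The Sidon constant of $E'\subseteq\mathbb{Z}$ is the infimum of the $C$ such that $\sum_{q\in H}|a_q|\le C\|\sum_{q\in H}a_qe_q\|_\infty$ for all finite $H\subseteq E'$ and $a_q\in\mathbb{C}$. *)

(* Defs.v *)
From HB Require Import structures.
From mathcomp Require Import all_boot all_order all_algebra.
From mathcomp Require Import finmap.
From mathcomp Require Import all_classical all_reals all_analysis.
From mathcomp Require Import measurable_realfun complex.

Set Implicit Arguments.
Unset Strict Implicit.
Unset Printing Implicit Defensive.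

Import Order.TTheory GRing.Theory Num.Theory.
Import numFieldNormedType.Exports.
Import ComplexField.Normc.

Local Open Scope classical_set_scope.
Local Open Scope ring_scope.
Local Open Scope complex_scope.

Local Notation Re := (@complex.Re _).
Local Notation Im := (@complex.Im _).
Local Notation normc := (@normc _).

Section complex_facts.
Variable R : realType.
Implicit Types z w : R[i].

Lemma normC_normc z : `|z| = (normc z)%:C.
Proof. by rewrite normc_def; case: z. Qed.

Lemma le_Re_normc z : `|Re z| <= normc z.
Proof. by rewrite -lecR -normC_normc normc_ge_Re. Qed.

Lemma le_Im_normc z : `|Im z| <= normc z.
Proof.
have := le_Re_normc (z * 'i); rewrite ReiNIm normrN normcM.
by rewrite [X in _ * X]/= expr0n/= expr1n add0r sqrtr1 mulr1.
Qed.

Lemma normc_le_ReIm z : normc z <= `|Re z| + `|Im z|.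
Proof.
case: z => a b /=; rewrite -(@ler_pXn2r _ 2) ?nnegrE ?sqrtr_ge0 ?addr_ge0//.
by rewrite sqr_sqrtr ?addr_ge0 ?sqr_ge0// sqrrD !real_normK ?num_real//
  lerD2r lerDl mulrn_wge0 ?mulr_ge0.
Qed.

Lemma continuous_complex (T : topologicalType) (f : T -> R[i]^o) :
  continuous (fun t => Re (f t) : R) -> continuous (fun t => Im (f t) : R) ->
  continuous f.
Proof.
move=> cr ci t; apply/(@cvgrPdist_lt _ R[i]^o) => -[e1 e2].
rewrite ltcE/= => /andP[/eqP -> e0].
have e20 : 0 < e1 / 2 by rewrite divr_gt0.
have /cvgrPdist_lt/(_ _ e20) H1 := cr t.
have /cvgrPdist_lt/(_ _ e20) H2 := ci t.
near=> s.
rewrite normC_normc ltcR (le_lt_trans (normc_le_ReIm _))//.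
rewrite [ltRHS]splitr.
have -> : Re (f t - f s) = Re (f t) - Re (f s) by case: (f t) => ? ?; case: (f s).
have -> : Im (f t - f s) = Im (f t) - Im (f s) by case: (f t) => ? ?; case: (f s).
by rewrite ltrD//; near: s.
Unshelve. all: by end_near.
Qed.

Lemma continuous_Re : continuous (fun z : R[i]^o => Re z : R).
Proof.
move=> z; have F : Filter (nbhs (z : R[i]^o)) by exact: nbhs_filter.
apply/(@cvgrPdist_lt _ R _ _ F) => e e0.
have eC : 0 < e%:C :> R[i] by rewrite ltcR.
apply: (@filterS _ _ F _ _ _ (@nbhsx_ballx _ R[i]^o z _ eC)) => w.
rewrite /ball/= normC_normc ltcR; apply: le_lt_trans.
by apply: le_trans (le_Re_normc _); case: {F eC} z => ? ?; case: w.
Qed.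

Lemma continuous_Im : continuous (fun z : R[i]^o => Im z : R).
Proof.
move=> z; have F : Filter (nbhs (z : R[i]^o)) by exact: nbhs_filter.
apply/(@cvgrPdist_lt _ R _ _ F) => e e0.
have eC : 0 < e%:C :> R[i] by rewrite ltcR.
apply: (@filterS _ _ F _ _ _ (@nbhsx_ballx _ R[i]^o z _ eC)) => w.
rewrite /ball/= normC_normc ltcR; apply: le_lt_trans.
by apply: le_trans (le_Im_normc _); case: {F eC} z => ? ?; case: w.
Qed.

End complex_facts.

Section circle.
Variable R : realType.

Definition unit_circle : set R[i]^o := [set z | `|z| = 1].

Definition circle : Type := set_type unit_circle.

HB.instance Definition _ := Topological.on circle.

Lemma unit_circle1 : 1 \in unit_circle.
Proof. by rewrite inE /unit_circle/= normr1. Qed.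

HB.instance Definition _ := isPointed.Build circle (SigSub unit_circle1).

HB.instance Definition _ :=
  Measurable.copy circle (g_sigma_algebraType (open : set (set circle))).

Lemma expi_subproof (t : R) :
  (cos (2 * pi * t) +i* sin (2 * pi * t)) \in unit_circle.
Proof. by rewrite inE /unit_circle/= normc_def/= cos2Dsin2 sqrtr1. Qed.

Definition circle_val (z : circle) : R[i] := \val z.

Lemma normc_circle (z : circle) : normc (circle_val z) = 1.
Proof.
by case: z => z; rewrite /circle_val/= inE /unit_circle/= normC_normc => -[].
Qed.

Definition expi (t : R) : circle := SigSub (expi_subproof t).

Lemma continuous_expi : continuous expi.
Proof.
apply: continuous_comp_initial; apply: continuous_complex => /= t.
- apply: (@continuous_comp _ _ _ (fun t : R => 2 * pi * t) cos).
    exact: mulrl_continuous.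
  exact: continuous_cos.
- apply: (@continuous_comp _ _ _ (fun t : R => 2 * pi * t) sin).
    exact: mulrl_continuous.
  exact: continuous_sin.
Qed.

Lemma measurable_expi : @measurable_fun _ _ (measurableTypeR R) circle setT expi.
Proof.
apply: (@measurability _ _ _ _ _ _ (open : set (set circle))) => // _ [U oU <-].
rewrite setTI; apply: open_measurable.
by move/continuousP : continuous_expi; exact.
Qed.

(* Normalized Haar measure as the image of the uniform probability on `[0, 1]
   under t |-> exp(2 i pi t). *)
Definition haar : probability circle R :=
  distribution (uniform_prob (@ltr01 R))
    (@mfun_Sub _ _ (measurableTypeR R) circle expi (mem_set measurable_expi)).

Lemma measurable_continuous_circle (f : circle -> R) :
  continuous f -> measurable_fun setT f.
Proof.
move=> cf.
apply: (measurability _ (RGenOpens.measurableE R)).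
move=> _ [_ [a [b ->] <-]]; rewrite setTI.
apply: sub_sigma_algebra.
by move/continuousP : cf; apply; exact: interval_open.
Qed.

End circle.

Arguments unit_circle : clear implicits.

Section fourier.
Variable R : realType.
Notation circle := (circle R).
Notation haar := (haar R).
Implicit Types (f g : circle -> R[i]).

(* The character e_n(z) = z ^ n; circle_pow is the same map with values in the
   circle. *)
Definition echar (n : int) (z : circle) : R[i] := circle_val z ^ n.

Lemma echar_unit_circle n z : (echar n z : R[i]^o) \in unit_circle R.
Proof.
have zE : `|circle_val z| = 1 by rewrite normC_normc normc_circle.
rewrite inE /unit_circle/= /echar; case: n => n.
  by rewrite -exprnP normrX zE expr1n.
by rewrite NegzE -exprnN normfV normrX zE expr1n invr1.
Qed.

Definition circle_pow (n : int) (z : circle) : circle :=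
  SigSub (echar_unit_circle n z).

Lemma normc_echar n z : normc (echar n z) = 1.
Proof. exact: (normc_circle (circle_pow n z)). Qed.

Definition cmeasurable f :=
  measurable_fun setT (Re \o f) /\ measurable_fun setT (Im \o f).

Definition cintegral f : R[i] :=
  (\int[haar]_z Re (f z))%R +i* (\int[haar]_z Im (f z))%R.

Definition fourier f (n : int) : R[i] :=
  cintegral (fun z => f z * echar (- n) z).

Definition cLnorm (p : R) f : \bar R :=
  'N[haar]_(p%:E)[(fun z => (normc (f z))%:E)].

Lemma cmeasurable_cst (c : R[i]) : cmeasurable (fun=> c).
Proof. by split; exact: measurable_cst. Qed.

Lemma cmeasurableD f g : cmeasurable f -> cmeasurable g ->
  cmeasurable (fun z => f z + g z).
Proof.
move=> [rf jf] [rg jg]; split.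
- rewrite (_ : _ \o _ = (Re \o f) \+ (Re \o g)); first exact: measurable_funD.
  by apply/funext => z /=; case: (f z) => ? ?; case: (g z).
- rewrite (_ : _ \o _ = (Im \o f) \+ (Im \o g)); first exact: measurable_funD.
  by apply/funext => z /=; case: (f z) => ? ?; case: (g z).
Qed.

Lemma cmeasurableM f g : cmeasurable f -> cmeasurable g ->
  cmeasurable (fun z => f z * g z).
Proof.
move=> [rf jf] [rg jg]; split.
- rewrite (_ : _ \o _ = ((Re \o f) \* (Re \o g)) \- ((Im \o f) \* (Im \o g))).
    by apply: measurable_funB; exact: measurable_funM.
  by apply/funext => z /=; case: (f z) => ? ?; case: (g z).
- rewrite (_ : _ \o _ = ((Re \o f) \* (Im \o g)) \+ ((Im \o f) \* (Re \o g))).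
    by apply: measurable_funD; exact: measurable_funM.
  by apply/funext => z /=; case: (f z) => ? ?; case: (g z).
Qed.

Lemma continuous_val_circle : continuous (fun z : circle => circle_val z : R[i]^o).
Proof. exact: initial_continuous. Qed.

Lemma cmeasurable_val : cmeasurable (@circle_val R).
Proof.
split; apply: measurable_continuous_circle => z.
- apply: (@continuous_comp _ _ _ (fun z : circle => circle_val z : R[i]^o)).
    exact: continuous_val_circle.
  exact: continuous_Re.
- apply: (@continuous_comp _ _ _ (fun z : circle => circle_val z : R[i]^o)).
    exact: continuous_val_circle.
  exact: continuous_Im.
Qed.

Lemma cmeasurable_conj f : cmeasurable f -> cmeasurable (fun z => (f z)^*).
Proof.
move=> [rf jf]; split.
- rewrite (_ : _ \o _ = Re \o f)//.
  by apply/funext => z /=; case: (f z).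
- rewrite (_ : _ \o _ = \- (Im \o f)); first exact: measurable_funN.
  by apply/funext => z /=; case: (f z).
Qed.

Lemma cmeasurable_echar n : cmeasurable (echar n).
Proof.
have pos (m : nat) : cmeasurable (echar m).
  elim: m => [|m ih]; first exact: cmeasurable_cst.
  rewrite (_ : echar _ = fun z => circle_val z * echar m z).
    by apply: cmeasurableM ih; exact: cmeasurable_val.
  by apply/funext => z; rewrite /echar -exprnP exprS.
case: n => [//|n]; rewrite (_ : echar _ = fun z => (echar n.+1 z)^*).
  exact: cmeasurable_conj.
apply/funext => z; rewrite {1}/echar NegzE -exprnN.
by rewrite -[_ ^+ _]/(echar n.+1 z) invc_norm normC_normc normc_echar
  expr1n invr1 mul1r.
Qed.

Lemma measurable_normc f : cmeasurable f -> measurable_fun setT (normc \o f).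
Proof.
move=> [rf jf].
rewrite (_ : _ \o _ = Num.sqrt \o (fun z => (Re (f z)) ^+ 2 + (Im (f z)) ^+ 2)).
  apply: measurableT_comp.
    by apply: continuous_measurable_fun; exact: sqrt_continuous.
  by apply: measurable_funD; exact: measurable_funX.
by apply/funext => z /=; case: (f z).
Qed.

End fourier.

Section Lp_pred.
Variables (R : realType) (p : R) (E : set int).
Hypothesis p1 : 1 <= p.
Notation circle := (circle R).
Notation haar := (haar R).
Notation N := (@cLnorm R p).
Implicit Types (f g : circle -> R[i]).

Let p1E : (1 <= p%:E)%E. Proof. by rewrite lee_fin. Qed.

(* The proof argument is only there so that the closure properties, which need
   1 <= p, can be inferred from the predicate. *)
Definition LpE_pred (_ : 1 <= p) : {pred circle -> R[i]} :=
  mem [set f | [/\ cmeasurable f, (N f < +oo)%E &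
                   forall n, ~ E n -> fourier f n = 0]].

Lemma LpE_predP f : reflect [/\ cmeasurable f, (N f < +oo)%E &
    forall n, ~ E n -> fourier f n = 0] (f \in LpE_pred p1).
Proof. by apply: (iffP idP); rewrite inE. Qed.

Lemma Lfun_normc f : cmeasurable f -> (N f < +oo)%E ->
  normc \o f \in Lfun haar p%:E.
Proof.
move=> mf Nf; apply/andP; split; rewrite inE//=.
exact: measurable_normc.
Qed.

Lemma cLnorm_ge0 f : (0 <= N f)%E. Proof. exact: Lnorm_ge0. Qed.

Lemma cLnormD f g : cmeasurable f -> cmeasurable g ->
  (N (fun z => f z + g z)%R <= N f + N g)%E.
Proof.
move=> mf mg.
have mnf := measurable_normc mf; have mng := measurable_normc mg.
apply: le_trans (eminkowski haar mnf mng p1E).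
rewrite /cLnorm unlock gt0_ler_poweR ?in_itv/= ?leey ?andbT ?integral_ge0//.
  by rewrite invr_ge0 (le_trans _ p1).
have n0 (z : R[i]) : 0 <= normc z by case: z => ? ?; exact: sqrtr_ge0.
have mp (h : circle -> R) : measurable_fun setT h ->
    measurable_fun setT (fun z => `|(h z)%:E| `^ p)%E.
  move=> mh; apply/measurable_EFinP.
  apply: (@measurableT_comp _ _ _ _ _ _ (@powR R ^~ p)) => //.
  exact: measurableT_comp.
apply: ge0_le_integral => //=.
- exact: (mp _ (measurable_normc (cmeasurableD mf mg))).
- exact: (mp _ (measurable_funD mnf mng)).
- move=> z _; rewrite lee_fin ge0_ler_powR ?nnegrE ?normr_ge0//.
    by rewrite (le_trans _ p1).
  by rewrite !ger0_norm ?addr_ge0// le_normcD.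
Qed.

Lemma cLnormZ (a : R[i]) f : cmeasurable f -> (N f < +oo)%E ->
  (N (fun z => a * f z)%R = (normc a)%:E * N f)%E.
Proof.
move=> mf Nf.
have := @LnormZ _ _ _ haar _ p1E (Lfun_Sub p1E (Lfun_normc mf Nf)) (normc a).
rewrite ger0_norm; last by case: a => ? ?; exact: sqrtr_ge0.
rewrite Lfun_valP => <-; apply: eq_Lnorm => z /=.
by rewrite normcM.
Qed.

Lemma integrable_LpE f n : cmeasurable f -> (N f < +oo)%E ->
  haar.-integrable setT (fun z => (Re (f z * echar n z))%:E) /\
  haar.-integrable setT (fun z => (Im (f z * echar n z))%:E).
Proof.
move=> mf Nf.
have [mr mi] := cmeasurableM mf (cmeasurable_echar R n).
have /Lfun1_integrable inf : normc \o f \in Lfun haar 1.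
  apply: (@Lfun_subset _ _ _ haar 1%E p%:E (lexx _) p1E _ p1E _
    (Lfun_normc mf Nf)).
  exact: fin_num_measure.
have normcMe z : normc (f z * echar n z) = normc (f z).
  by rewrite normcM normc_echar mulr1.
split; apply: le_integrable inf => //; do ?exact/measurable_EFinP.
- move=> z _ /=; rewrite lee_fin -normcMe.
  by rewrite (le_trans (le_Re_normc _))// ler_norm.
- move=> z _ /=; rewrite lee_fin -normcMe.
  by rewrite (le_trans (le_Im_normc _))// ler_norm.
Qed.

Lemma fourierD f g n : cmeasurable f -> (N f < +oo)%E ->
  cmeasurable g -> (N g < +oo)%E ->
  fourier (fun z => f z + g z) n = fourier f n + fourier g n.
Proof.
move=> mf Nf mg Ng.
have [rf jf] := integrable_LpE (- n) mf Nf.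
have [rg jg] := integrable_LpE (- n) mg Ng.
rewrite /fourier /cintegral.
rewrite [RHS]/GRing.add/= -RintegralD// -RintegralD//; congr Complex.
  by apply: eq_Rintegral => z _ ; rewrite /= mulrDl; case: (f z * _); case: (g z * _).
by apply: eq_Rintegral => z _ ; rewrite /= mulrDl; case: (f z * _); case: (g z * _).
Qed.

Lemma fourierZ (a : R[i]) f n : cmeasurable f -> (N f < +oo)%E ->
  fourier (fun z => a * f z) n = a * fourier f n.
Proof.
move=> mf Nf.
have [rf jf] := integrable_LpE (- n) mf Nf.
case: a => a b.
rewrite /fourier /cintegral.
rewrite [RHS]/GRing.mul/=.
rewrite -!RintegralZl//.
have iZ (c : R) (h : circle -> R) : haar.-integrable setT (EFin \o h) ->
    haar.-integrable setT (fun z => (c * h z)%:E).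
  by move=> ih; under eq_fun do rewrite EFinM; exact: integrableZl.
rewrite -RintegralB//; [|exact: iZ|exact: iZ].
rewrite -RintegralD//; [|exact: iZ|exact: iZ].
by congr Complex; apply: eq_Rintegral => z _; rewrite -mulrA; case: (f z * _).
Qed.

Lemma LpE_submod_closed :
  submod_closed (LpE_pred p1 : {pred circle -> R[i]^o}).
Proof.
have p0 : p != 0 by rewrite gt_eqF// (lt_le_trans _ p1).
have N0 : N (fun=> 0) = 0%E.
  by rewrite -(Lnorm0 haar (_ : p%:E != 0%E)) ?eqe//; apply: eq_Lnorm => z;
    rewrite [normc _]normc0.
split.
  apply/LpE_predP; split => [||n _].
  - exact: cmeasurable_cst.
  - by rewrite N0.
  - rewrite /fourier /cintegral.
    under eq_Rintegral do rewrite mul0r; rewrite [X in X +i* _]Rintegral_cst//=.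
    under eq_Rintegral do rewrite mul0r; rewrite [X in _ +i* X]Rintegral_cst//=.
    by rewrite mul0r.
move=> a /= f g /LpE_predP[mf Nf f0] /LpE_predP[mg Ng g0].
have maf : cmeasurable (fun z => a * f z).
  by apply: cmeasurableM mf; exact: cmeasurable_cst.
have Naf : (N (fun z => a * f z)%R < +oo)%E.
  by rewrite cLnormZ// lte_mul_pinfty// lee_fin; case: (a) => ? ?; exact: sqrtr_ge0.
apply/LpE_predP; split => [||n En].
- exact: cmeasurableD.
- by apply: le_lt_trans (cLnormD maf mg) _; rewrite lte_add_pinfty.
- rewrite -[LHS]/(fourier (fun z => a * f z + g z) n).
  by rewrite fourierD// fourierZ// f0// g0// mulr0 addr0.
Qed.

HB.instance Definition _ :=
  GRing.isSubmodClosed.Build _ (circle -> R[i]^o) (LpE_pred p1)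
    LpE_submod_closed.

Record LpE_fun : Type := LpEFun {
  LpE_val :> circle -> R[i]^o;
  _ : LpE_val \in LpE_pred p1 }.

HB.instance Definition _ := [isSub for LpE_val].
HB.instance Definition _ := [Choice of LpE_fun by <:].
HB.instance Definition _ := [SubChoice_isSubLmodule of LpE_fun by <:].

Implicit Types u v : LpE_fun.

Lemma LpE_funP u : [/\ cmeasurable u, (N u < +oo)%E &
  forall n, ~ E n -> fourier u n = 0].
Proof. by apply/LpE_predP; exact: valP. Qed.

Definition ae_null : {pred LpE_fun} :=
  mem [set u : LpE_fun | \forall z \ae haar, u z = 0].

Lemma ae_null_zmod_closed : zmod_closed ae_null.
Proof.
split; first by rewrite inE; apply/nearW.
move=> u v; rewrite !inE => u0 v0.
apply: filterS2 u0 v0 => z /= uz vz.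
by transitivity (u z - v z) => //; rewrite uz vz subrr.
Qed.

HB.instance Definition _ := GRing.isZmodClosed.Build LpE_fun ae_null
  ae_null_zmod_closed.

(* L^p_E: p-integrable functions with spectrum in E, modulo a.e. equality. *)
Definition LpE : Type := Quotient.quot ae_null.

HB.instance Definition _ := ZmodQuotient.on LpE.

Local Notation "\pi u" := (\pi_LpE u)%qT (at level 10).

Lemma LpE_eqP u v : reflect (\forall z \ae haar, u z = v z)
  (\pi u == \pi v :> LpE).
Proof.
rewrite -Quotient.idealrBE; apply: (iffP idP); rewrite inE => H.
- by apply: filterS H => z uv; apply/eqP; rewrite -subr_eq0; apply/eqP.
- apply: filterS H => z uv; transitivity (u z - v z) => //.
  by rewrite uv subrr.
Qed.

Lemma repr_ae u : \forall z \ae haar, repr (\pi u) z = u z.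
Proof. by apply/LpE_eqP; rewrite reprK. Qed.

Definition scaleLpE (a : R[i]) (x : LpE) : LpE := \pi (a *: repr x).

Lemma pi_scaleLpE a u : scaleLpE a (\pi u) = \pi (a *: u).
Proof.
apply/eqP/LpE_eqP; apply: filterS (repr_ae u) => z e.
by rewrite -[LHS]/(a * repr (\pi u) z) e.
Qed.

Lemma pi_LpED u v : \pi u + \pi v = \pi (u + v).
Proof. by rewrite !piE. Qed.

Lemma scaleLpEA a b x : scaleLpE a (scaleLpE b x) = scaleLpE (a * b) x.
Proof. by rewrite -[x]reprK (pi_scaleLpE b) !pi_scaleLpE scalerA. Qed.

Lemma scale1LpE : left_id 1 scaleLpE.
Proof. by move=> x; rewrite -[x]reprK pi_scaleLpE scale1r. Qed.

Lemma scaleLpEDr : right_distributive scaleLpE +%R.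
Proof.
move=> a x y; rewrite -[x]reprK -[y]reprK pi_LpED !pi_scaleLpE pi_LpED.
by rewrite scalerDr.
Qed.

Lemma scaleLpEDl x : {morph scaleLpE^~ x : a b / a + b}.
Proof.
by move=> a b; rewrite -[x]reprK !pi_scaleLpE pi_LpED scalerDl.
Qed.

HB.instance Definition _ := GRing.Zmodule_isLmodule.Build R[i] LpE
  scaleLpEA scale1LpE scaleLpEDr scaleLpEDl.

(* Does not depend on the representative, see normLpE_pi. *)
Definition normLpE (x : LpE) : R[i] := (fine (N (repr x)))%:C.

Lemma cLnorm_fin_num u : N u \is a fin_num.
Proof.
by have [_ Nu _] := LpE_funP u; rewrite ge0_fin_numE// cLnorm_ge0.
Qed.

Lemma ae_cLnorm u v : (\forall z \ae haar, u z = v z) -> N u = N v.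
Proof.
have [mu _ _] := LpE_funP u; have [mv _ _] := LpE_funP v.
move=> uv; rewrite /cLnorm unlock; congr poweR.
apply: ae_eq_integral => //.
- apply/measurable_EFinP.
  apply: (@measurableT_comp _ _ _ _ _ _ (@powR R ^~ p)) => //.
  exact: measurableT_comp (measurable_normc mu).
- apply/measurable_EFinP.
  apply: (@measurableT_comp _ _ _ _ _ _ (@powR R ^~ p)) => //.
  exact: measurableT_comp (measurable_normc mv).
- by apply: filterS uv => z uvz _; rewrite uvz.
Qed.

Lemma normLpE_pi u : normLpE (\pi u) = (fine (N u))%:C.
Proof. by rewrite /normLpE (ae_cLnorm (repr_ae u)). Qed.

Lemma ler_normLpED x y : normLpE (x + y) <= normLpE x + normLpE y.
Proof.
rewrite -[x]reprK -[y]reprK pi_LpED !normLpE_pi.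
have [mx _ _] := LpE_funP (repr x); have [my _ _] := LpE_funP (repr y).
rewrite -rmorphD lecR -lee_fin EFinD !fineK ?cLnorm_fin_num//.
exact: cLnormD.
Qed.

Lemma normLpEZ a x : normLpE (a *: x) = `|a| * normLpE x.
Proof.
rewrite [normLpE (a *: x)]normLpE_pi /normLpE.
have [mx Nx _] := LpE_funP (repr x).
rewrite normC_normc -rmorphM; congr (_%:C).
by rewrite -[X in X * _]/(fine (normc a)%:E) -fineM ?cLnorm_fin_num//
  -cLnormZ.
Qed.

Lemma normLpE_eq0 x : normLpE x = 0 -> x = 0.
Proof.
rewrite -[x]reprK normLpE_pi => -[/eqP].
have [mx _ _] := LpE_funP (repr x).
rewrite -eqe fineK ?cLnorm_fin_num// => /eqP Nx0.
have : (fun z => (normc (repr x z))%:E) = \0%E %[ae haar].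
  apply: Lnorm_eq0_eq0 Nx0; last by rewrite lte_fin (lt_le_trans _ p1).
  by apply/measurable_EFinP; exact: measurable_normc.
move=> H; rewrite -[RHS]reprK; apply/eqP/LpE_eqP.
have : \forall z \ae haar, repr (\pi (0 : LpE_fun)) z = (0 : LpE_fun) z.
  exact: repr_ae.
rewrite (_ : \pi 0 = 0); last by rewrite !piE.
apply: filterS2 H => z /(_ I) [] /eq0_normc -> ->.
by [].
Qed.

HB.instance Definition _ := Lmodule_isNormed.Build R[i] LpE
  ler_normLpED normLpEZ normLpE_eq0.

End Lp_pred.

Section umap.
Variables (R : realType) (Y : normedModType R[i]).

Definition opnorm_le (f : Y -> Y) (M : R) : Prop :=
  forall y, `|f y| <= M%:C * `|y|.

Definition bounded_op (f : Y -> Y) : Prop := exists M : R, opnorm_le f M.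

Definition finite_rank (f : Y -> Y) : Prop :=
  exists (r : nat) (b : 'I_r -> Y), forall y, exists c : 'I_r -> R[i],
    f y = \sum_i c i *: b i.

(* The convention T_0 = 0 is a requirement on T; separability of Y is not
   assumed, being a consequence of the existence of T. *)
Definition complex_umap : Prop :=
  forall eps : R, 0 < eps -> exists T : nat -> {linear Y -> Y},
    [/\ forall y, T 0%N y = 0,
        forall k, bounded_op (T k) /\ finite_rank (T k),
        forall y, T k y @[k --> \oo] --> y
      & forall (n : nat) (s : nat -> R[i]), (forall k, `|s k| = 1) ->
          opnorm_le
            (fun y => \sum_(1 <= k < n.+1) s k *: (T k y - T k.-1 y))
            (1 + eps)].

End umap.

Section trigonometric_polynomials.
Variable R : realType.

Definition trigpoly (G : {fset int}) (a : int -> R[i]) (z : circle R) : R[i] :=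
  \sum_(q <- G) a q * echar q z.

Definition umbs (S : set R[i]) (N : (circle R -> R[i]) -> \bar R)
    (E : set int) : Prop :=
  forall eps : R, 0 < eps -> exists F : {fset int},
    forall (G : {fset int}) (a s : int -> R[i]),
      [set` G] `<=` E `\` [set` F] -> (forall q, q \in G -> S (s q)) ->
      (N (trigpoly G (fun q => s q * a q)%R) <=
         (1 + eps)%:E * N (trigpoly G a))%E.

Definition complex_umbs := umbs [set c | `|c| = 1].

Definition real_umbs := umbs [set c | c = 1 \/ c = -1].

Definition supnorm (f : circle R -> R[i]) : \bar R :=
  ereal_sup [set (normc (f z))%:E | z in [set: circle R]].

Definition sidon_constant (E : set int) : \bar R :=
  ereal_inf [set C%:E | C in [set C : R |
    forall (H : {fset int}) (a : int -> R[i]), [set` H] `<=` E ->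
      ((\sum_(q <- H) normc (a q))%:E <= C%:E * supnorm (trigpoly H a))%E]].

Definition pseudo_independent (E : set int) : Prop :=
  forall (n : nat) (A : 'I_n -> set (circle R)), (0 < n)%N ->
    (forall i, measurable (A i)) ->
    forall eps : R, 0 < eps -> exists M : nat,
      forall p : 'I_n -> int, injective p -> (forall i, E (p i)) ->
        (forall i, (M <= `|p i|)%N) ->
        `| fine (haar R [set z | forall i, A i (circle_pow (p i) z)])
           - \prod_(i < n) fine (haar R (A i)) | < eps.

Definition floor_powers (sigma : R) : set int :=
  [set Num.floor (sigma ^+ k) | k in [set k | (1 <= k)%N]].

End trigonometric_polynomials.

Arguments cLnorm : clear implicits.
Arguments sidon_constant : clear implicits.
Arguments pseudo_independent : clear implicits.

(* Main.v *)
Require Import Defs.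
From HB Require Import structures.
From mathcomp Require Import all_boot all_order all_algebra.
From mathcomp Require Import finmap.
From mathcomp Require Import all_classical all_reals all_analysis.
From mathcomp Require Import measurable_realfun complex.
From mathcomp Require Import zify ring lra.

Set Implicit Arguments.
Unset Strict Implicit.
Unset Printing Implicit Defensive.
Import Order.TTheory GRing.Theory Num.Theory.
Import numFieldNormedType.Exports.
Import ComplexField.Normc.

Local Open Scope classical_set_scope.
Local Open Scope ring_scope.
Local Open Scope complex_scope.

Local Notation Re := (@complex.Re _).
Local Notation Im := (@complex.Im _).
Local Notation normc := (@normc _).
Local Notation "x ^*" := (conjc x) : ring_scope.

(* A nontrivial integer combination of bounded length of the [sigma^k] is far from 0 when sigma is
   transcendental and only large k occur.  When sigma is algebraic, an integer polynomial P with
   P(sigma) = 0, P(1) <> 0 and an odd coefficient yields, by pigeonhole, a combination with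
   coefficients P_i that takes one and the same value at infinitely many k, hence additive
   relations linking far apart blocks.

   For p = 2n the p-th power of the norm of a trigonometric polynomial is a sum over the solutions
   of q_1 + ... + q_n = q'_1 + ... + q'_n.  Without relations, changing the signs of high
   frequencies does not change the norm, and the high part has p-norm comparable with its 2-norm;
   the operators of (ii) then average N truncations taken at very lacunary places.  With a relation,
   averaging the norms over all unimodular coefficients shows that some sign change is felt. Under
   (ii) a finite rank T_k fixes a low block up to a small error and nearly kills the high ones, so
   a low and a high block can be multiplied by independent unimodular constants at almost no cost.

   Pseudo-independence comes from Weyl's criterion, and gives (v) since the characters then take
   values close to any prescribed ones simultaneously. *)

(** * Integer combinations of floors of powers *)

(** The two conditions on P answer two kinds of sign change. An odd coefficient P_i lets a single
    -1, at one frequency of one block, change the sign of one side of the relation only; this serves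
    real signs and Sidon constants. Finite rank operators merely separate a low block from a high
    one, so under (ii) one constant theta multiplies a whole block; the relation then feels
    theta^(P(1)), and P(1) <> 0 makes theta^(P(1)) = -1 solvable. The exponent p is twice the sum of
    the |P_i|, which is the number of terms on each side of the relation. As the blocks recede to
    infinity, every contradiction needs a bound depending on P alone: moments that differ by at
    least 1, or a sup norm that misses its maximum by a fixed amount. Both (ii) and (iii) with real
    signs are shown to imply (i), from which the next property of the cycle is derived. In (i) =>
    (ii), truncation is a contraction only on functions without frequencies in some gap, which
    forces the averaging; and the convergence of partial sums is itself drawn from Bessel's
    inequality, the comparison with the 2-norm and weak lower semicontinuity. *)

Section lengths.
Implicit Types P Q : {poly int}.

Definition plength P : nat := (\sum_(i < size P) absz (P`_i)%R)%N.

Lemma plength_wide n P : (size P <= n)%N -> plength P = (\sum_(i < n) absz (P`_i)%R)%N.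
Proof.
move=> sP; rewrite /plength (big_ord_widen n (fun i => absz (P`_i)%R) sP).
rewrite big_mkcond/=; apply: eq_bigr => i _.
by case: ltnP => // /(nth_default 0) ->.
Qed.

Lemma plengthD P Q : (plength (P + Q) <= plength P + plength Q)%N.
Proof.
pose n := maxn (size P) (size Q).
rewrite !(@plength_wide n) ?leq_maxl ?leq_maxr ?size_polyD// -big_split/=.
by apply: leq_sum => i _; rewrite coefD; move: (P`_i) (Q`_i) => a b; lia.
Qed.

Lemma plengthN P : plength (- P) = plength P.
Proof. by rewrite /plength size_polyN; apply: eq_bigr => i _; rewrite coefN abszN. Qed.

Lemma plength_gt0 P : P != 0 -> (0 < plength P)%N.
Proof.
move=> P0; have s0 : (0 < size P)%N by rewrite size_poly_gt0.
rewrite /plength; case: (size P) (lead_coefE P) s0 => // n lE _.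
by rewrite big_ord_recr/= addn_gt0 absz_gt0 [P`_n](esym lE) lead_coef_eq0 P0 orbT.
Qed.

Lemma plength_take_drop n P :
  plength P = (plength (take_poly n P) + plength ('X^n * drop_poly n P))%N.
Proof.
rewrite (@plength_wide (n + size P)) ?leq_addl//.
rewrite (@plength_wide (n + size P)); last first.
  by apply: leq_trans (size_take_poly _ _) _; rewrite leq_addr.
rewrite (@plength_wide (n + size P) ('X^n * _)); last first.
  rewrite (leq_trans (size_polyMleq _ _))// size_polyXn addSn/= leq_add2l.
  by rewrite size_drop_poly leq_subr.
rewrite -big_split/=; apply: eq_bigr => i _.
rewrite coef_take_poly coefXnM coef_drop_poly; case: ltnP => in'; rewrite ?addn0//.
by rewrite subnK.
Qed.

End lengths.

Section transcendental.
Variables (R : realType) (sigma : R).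
Hypothesis sigma_gt1 : 1 < sigma.
Implicit Types P Q : {poly int}.

Let sigma_gt0 : 0 < sigma. Proof. exact: lt_trans sigma_gt1. Qed.
Let sigma_ge1 : 1 <= sigma. Proof. exact: ltW. Qed.
Let sigma_ge0 : 0 <= sigma. Proof. exact: ltW. Qed.
Let le_sigmaX m n : (sigma ^+ m <= sigma ^+ n) = (m <= n)%N.
Proof. exact: ler_eXn2l. Qed.

Definition peval P : R := \sum_(i < size P) (P`_i)%:~R * sigma ^+ i.

Lemma pevalE P : peval P = (map_poly intr P).[sigma].
Proof.
rewrite (@horner_coef_wide _ (size P)).
  by apply: eq_bigr => i _; rewrite coef_map.
by rewrite map_polyE (leq_trans (size_Poly _)) ?size_map.
Qed.

Lemma pow_unbounded (M : R) : exists n, M <= sigma ^+ n.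
Proof.
have d0 : 0 < sigma - 1 by rewrite subr_gt0.
exists (Num.bound `|M / (sigma - 1)|).
have := archi_boundP (normr_ge0 (M / (sigma - 1))).
move: (Num.bound _) => n /(le_lt_trans (ler_norm _)) Mn.
rewrite ltr_pdivrMr// in Mn; apply: le_trans (ltW Mn) _.
elim: n {Mn} => [|k ih]; first by rewrite mul0r expr0.
rewrite exprS; have s1 : 1 <= sigma ^+ k by exact: exprn_ege1.
rewrite -natr1; nra.
Qed.

Lemma peval_le n P : (size P <= n.+1)%N -> `|peval P| <= (plength P)%:R * sigma ^+ n.
Proof.
move=> sP; apply: le_trans (ler_norm_sum _ _ _) _.
rewrite /plength natr_sum mulr_suml; apply: ler_sum => i _.
rewrite normrM -intr_norm natr_absz ler_wpM2l ?normr_ge0 ?ler0z//.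
rewrite ger0_norm ?exprn_ge0// le_sigmaX.
by have := ltn_ord i; lia.
Qed.

Lemma finite_pos_lbound (T : finType) (p : pred T) (f : T -> R) :
  (forall t, p t -> 0 < f t) -> exists2 m : R, 0 < m & forall t, p t -> m <= f t.
Proof.
move=> f0; exists (\big[Order.min/1]_(t | p t) f t).
  by elim/big_ind : _ => //= x y x0 y0; rewrite lt_min x0.
by move=> t pt; rewrite (bigD1 t)//= ge_min lexx.
Qed.

Hypothesis sigma_trans : forall P, P != 0 -> peval P != 0.

(** Only finitely many integer polynomials have bounded size and length, and transcendence keeps
    each of their values away from 0. *)
Lemma peval_lbound_small N D : exists2 m : R, 0 < m &
  forall P, P != 0 -> (size P <= D)%N -> (plength P <= N)%N -> m <= `|peval P|.
Proof.
pose T := {ffun 'I_D -> 'I_(N.*2.+1)}.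
pose pol (t : T) : {poly int} := \poly_(i < D) oapp (fun i => (t i : int) - N%:Z) 0 (insub i).
have [m m0 H] := @finite_pos_lbound T (fun t => pol t != 0)
  (fun t => `|peval (pol t)|) (fun t tP => (etrans (normr_gt0 _) (sigma_trans tP))).
exists m => // P P0 sP PN.
have coefle i : (absz (P`_i)%R <= N)%N.
  apply: leq_trans PN; have [iP|iP] := ltnP i (size P); last by rewrite nth_default.
  by rewrite /plength (bigD1 (Ordinal iP))//= leq_addr.
pose t : T := [ffun i : 'I_D => inord (absz (P`_i + N%:Z))].
have tE : pol t = P.
  apply/polyP => i; rewrite coef_poly; case: ltnP => [iD|Di]; last first.
    by rewrite nth_default// (leq_trans sP).
  by rewrite insubT/= ffunE inordK; have := coefle i; move: (P`_i) => x; lia.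
by have := H t; rewrite tE; exact.
Qed.

(** Induction on the length. Cut off the top D + 1 coefficients. If nothing remains below, P is a
    power of X times one of finitely many polynomials. Otherwise the top part is strictly shorter,
    the induction hypothesis bounds it from below, and the rest has too small a degree to cancel
    it. *)
Lemma peval_lbound N : exists2 c : R, 0 < c &
  forall P, P != 0 -> (plength P <= N)%N -> c * sigma ^+ (size P).-1 <= `|peval P|.
Proof.
elim: N => [|N [c c0 ih]].
  by exists 1 => // P /plength_gt0 P0; rewrite leqn0 => /eqP P0'; rewrite P0' in P0.
(* With sigma^D >= 2 (N + 1) / c, the part below the cut is at most half of the lower bound for the
   top part. *)
have [D cD] := pow_unbounded (2 * N.+1%:R / c).
have [m m0 small] := peval_lbound_small N.+1 D.+1.
have sD0 : 0 < sigma ^+ D by rewrite exprn_gt0.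
exists (Num.min (c / 2) (m / sigma ^+ D)); first by rewrite lt_min !divr_gt0.
move=> P P0 PN.
have sP0 : (0 < size P)%N by rewrite size_poly_gt0.
(* Truncated subtraction: when P has at most D + 1 coefficients, j = 0 and the low part is 0, which
   is the first case. *)
pose j := (size P - D.+1)%N.
have [jD jP jS] : [/\ (size P <= j + D.+1)%N, (j < size P)%N &
    (0 < j)%N -> size P = (j.-1 + D + 2)%N].
  by rewrite /j; move: (size P) sP0 => k k0; clear -k0; split; lia.
have PE : P = take_poly j P + 'X^j * drop_poly j P by rewrite mulrC poly_take_drop.
have d0 : drop_poly j P != 0 by rewrite -size_poly_gt0 size_drop_poly subn_gt0.
have evD Q1 Q2 : peval (Q1 + Q2) = peval Q1 + peval Q2.
  by rewrite !pevalE rmorphD hornerD.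
have evX Q : peval ('X^j * Q) = sigma ^+ j * peval Q.
  by rewrite !pevalE rmorphM/= map_polyXn hornerM hornerXn.
have [t0|t0] := eqVneq (take_poly j P) 0.
  have pl : (plength (drop_poly j P) <= N.+1)%N.
    apply: leq_trans PN.
    rewrite (@plength_wide (size P)) ?size_drop_poly ?leq_subr// (@plength_wide (j + size P)) ?leq_addl//.
    by rewrite big_split_ord/= (leq_trans _ (leq_addl _ _))// leq_sum// => i _; rewrite coef_drop_poly addnC.
  have /(_ d0) := @small (drop_poly j P); rewrite size_drop_poly => /(_ _ pl) H.
  rewrite [in leRHS]PE t0 add0r evX normrM ger0_norm ?exprn_ge0//.
  have {}H : m <= `|peval (drop_poly j P)| by apply: H; rewrite leq_subLR.
  apply: (@le_trans _ _ (m / sigma ^+ D * sigma ^+ (size P).-1)).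
    by rewrite ler_wpM2r ?exprn_ge0 ?ge_min ?lexx ?orbT.
  apply: le_trans (ler_wpM2l (exprn_ge0 _ sigma_ge0) H).
  rewrite mulrC mulrA ler_pdivrMr// mulrAC ler_wpM2r ?(ltW m0)// -exprD le_sigmaX -ltnS prednK// -addnS//.
have sxd : size ('X^j * drop_poly j P) = size P.
  by rewrite mulrC size_mulXn// size_drop_poly subnKC// ltnW.
have pl : (plength ('X^j * drop_poly j P) <= N)%N.
  by rewrite -ltnS (leq_trans _ PN)// (plength_take_drop j P) -[leqLHS]add1n leq_add2r plength_gt0.
have x0 : 'X^j * drop_poly j P != 0 by rewrite -size_poly_gt0 sxd.
have j0 : (0 < j)%N by rewrite lt0n; apply: contra_neq t0 => ->; rewrite take_poly0l.
have := ih _ x0 pl; rewrite sxd => H1.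
have H2 : `|peval (take_poly j P)| <= N.+1%:R * sigma ^+ j.-1.
  apply: le_trans (@peval_le j.-1 _ _) _; first by rewrite prednK// size_take_poly.
  rewrite ler_wpM2r ?exprn_ge0// ler_nat (leq_trans _ PN)// [leqRHS](plength_take_drop j) leq_addr//.
have sE : sigma ^+ (size P).-1 = sigma ^+ j.-1 * sigma ^+ D * sigma.
  by rewrite -exprD -exprSr jS// addn2.
have x1 : 0 < sigma ^+ j.-1 by rewrite exprn_gt0.
have H3 : N.+1%:R * sigma ^+ j.-1 <= c / 2 * sigma ^+ (size P).-1.
  rewrite ler_pdivrMr// in cD.
  pose w := sigma ^+ D * c / 2 * sigma ^+ j.-1.
  have w0 : 0 <= w by rewrite !mulr_ge0 ?invr_ge0 ?exprn_ge0 ?(ltW c0).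
  rewrite sE [leRHS](_ : _ = w * sigma); last by rewrite /w; field.
  rewrite (le_trans _ (ler_peMr w0 sigma_ge1))// ler_wpM2r ?(ltW x1)//.
  by rewrite ler_pdivlMr// mulrC.
apply: (@le_trans _ _ (c / 2 * sigma ^+ (size P).-1)).
  by rewrite ler_wpM2r ?exprn_ge0 ?ge_min ?lexx.
rewrite [in leRHS]PE evD addrC.
have := lerB_normD (peval ('X^j * drop_poly j P)) (peval (take_poly j P)).
lra.
Qed.

(** Each floor is within 1 of its power, so passing to floors moves the sum by at most the length,
    whereas [peval_lbound] makes |P(sigma)| grow with the degree, which is at least L here. *)
Lemma floor_comb_lbound N (C : R) : exists L, forall P,
  P != 0 -> (plength P <= N)%N -> (forall i, (i < L)%N -> P`_i = 0) ->
  C < `|\sum_(i < size P) P`_i * Num.floor (sigma ^+ i)|%:~R.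
Proof.
have [c c0 H] := peval_lbound N.
have [L HL] := pow_unbounded ((C + N%:R + 1) / c).
exists L => P P0 PN Plow.
have LP : (L <= (size P).-1)%N.
  rewrite leqNgt; apply/negP => /Plow/eqP; rewrite -lead_coefE lead_coef_eq0.
  exact/negP.
rewrite ler_pdivrMr// in HL.
have H1 : C + N%:R + 1 <= `|peval P|.
  apply: le_trans HL (le_trans _ (H _ P0 PN)).
  by rewrite mulrC ler_wpM2l ?le_sigmaX// ltW.
suff H2 : `|peval P - (\sum_(i < size P) P`_i * Num.floor (sigma ^+ i))%:~R| <= N%:R.
  have := lerB_dist (peval P) (\sum_(i < size P) P`_i * Num.floor (sigma ^+ i))%:~R.
  rewrite intr_norm; lra.
rewrite rmorph_sum -sumrB; apply: le_trans (ler_norm_sum _ _ _) _.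
apply: (@le_trans _ _ (plength P)%:R); last by rewrite ler_nat.
rewrite /plength natr_sum; apply: ler_sum => i _.
rewrite rmorphM/= -mulrBr normrM -intr_norm natr_absz ler_piMr ?ler0z//.
rewrite ger0_norm ?subr_ge0 ?floor_le_tmp//.
by have := floorD1_gt (sigma ^+ i); rewrite intrD; lra.
Qed.

Local Notation fl k := (Num.floor (sigma ^+ k)).

Lemma pcombE (phi : nat -> int) n P : (size P <= n)%N ->
  \sum_(i < size P) P`_i * phi i = \sum_(i < n) P`_i * phi i.
Proof.
move=> sP; rewrite (big_ord_widen n (fun i => P`_i * phi i) sP).
rewrite big_mkcond/=; apply: eq_bigr => i _.
by case: ltnP => // /(nth_default 0) ->; rewrite mul0r.
Qed.

Lemma pcombD (phi : nat -> int) P Q :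
  \sum_(i < size (P + Q)) (P + Q)`_i * phi i =
  \sum_(i < size P) P`_i * phi i + \sum_(i < size Q) Q`_i * phi i.
Proof.
rewrite !(@pcombE _ (maxn (size P) (size Q))) ?leq_maxl ?leq_maxr ?size_polyD//.
by rewrite -big_split/=; apply: eq_bigr => i _; rewrite coefD mulrDl.
Qed.

Lemma pcomb_sumXn (phi : nat -> int) (I : Type) (r : seq I) (p : pred I)
    (z : I -> int) (k : I -> nat) :
  let P := \sum_(j <- r | p j) z j *: 'X^(k j) in
  \sum_(i < size P) P`_i * phi i = \sum_(j <- r | p j) z j * phi (k j).
Proof.
move=> P; rewrite {}/P; elim: r => [|j r ih]; first by rewrite !big_nil size_poly0 big_ord0.
rewrite !big_cons; case: ifP => // _; rewrite pcombD ih; congr (_ + _).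
rewrite (@pcombE _ (k j).+1); last by rewrite (leq_trans (size_scale_leq _ _))// size_polyXn.
rewrite (bigD1 (Ordinal (ltnSn (k j))))//= big1 => [|i ij].
  by rewrite coefZ coefXn eqxx mulr1 addr0.
rewrite coefZ coefXn; case: eqP => [e|_]; last by rewrite mulr0 mul0r.
by case/eqP: ij; apply: val_inj.
Qed.

Lemma plength_sumZXn (I : finType) (p : pred I) (z : I -> int) (k : I -> nat) B :
  (forall j, p j -> (absz (z j) <= B)%N) ->
  (plength (\sum_(j | p j) z j *: 'X^(k j)) <= #|I| * B)%N.
Proof.
move=> zB; rewrite cardT enumT -[Finite.enum I]/(index_enum I).
elim: (index_enum I) => [|j r ih].
  by rewrite big_nil /plength size_poly0 big_ord0.
rewrite big_cons/= mulSn; case: ifP => pj; last exact: leq_trans ih (leq_addl _ _).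
apply: leq_trans (plengthD _ _) (leq_add _ ih); apply: leq_trans (zB _ pj).
have [->|z0] := eqVneq (z j) 0; first by rewrite scale0r /plength size_poly0 big_ord0.
rewrite /plength size_scale// size_polyXn big_ord_recr/= big1 => [|i _].
  by rewrite coefZ coefXn eqxx mulr1.
by rewrite coefZ coefXn ltn_eqF ?mulr0.
Qed.

Lemma floor_independent m B : exists L, forall (k : 'I_m -> nat) (z : 'I_m -> int),
  injective k -> (forall i, (L <= k i)%N) -> (forall i, (absz (z i) <= B)%N) ->
  \sum_i z i * fl (k i) = 0 -> forall i, z i = 0.
Proof.
have [L HL] := floor_comb_lbound (m * B) 0.
exists L => k z kinj kL zB z0 i.
pose P := \sum_(j < m) z j *: 'X^(k j).
have P0 : P = 0.
  apply/eqP/negPn/negP => P0; have := HL _ P0.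
  rewrite (pcomb_sumXn (fun i => fl i)) z0 normr0 ltxx => H.
  suff: false by [].
  apply: H => [|n nL]; first by rewrite -[m in (_ <= m * _)%N]card_ord plength_sumZXn.
  rewrite coef_sum big1// => j _; rewrite coefZ coefXn.
  by case: eqP => [e|]; rewrite ?mulr0//; move: nL; rewrite e ltnNge kL.
have : P`_(k i) = 0 by rewrite P0 coef0.
rewrite coef_sum (bigD1 i)//= big1 => [|j ji].
  by rewrite coefZ coefXn eqxx mulr1 addr0.
by rewrite coefZ coefXn (inj_eq kinj) eq_sym (negbTE ji) mulr0.
Qed.

Let fl_ge0 k : 0 <= fl k. Proof. by rewrite floor_ge0 exprn_ge0. Qed.
Let le_fl j k : (j <= k)%N -> fl j <= fl k.
Proof. by move=> jk; rewrite le_floor// le_sigmaX. Qed.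

(** The indices below l contribute at most n fl(l) to either side. If the high parts differed as
    polynomials, [floor_comb_lbound] with C = n fl(l) would make their difference larger than that.
    Indices in the gap from l to L are excluded: they are neither bounded by l nor far enough to be
    independent. *)
Lemma floor_resonance n l : exists2 L, (l <= L)%N & forall x y : 'I_n -> nat,
  (forall j, (x j < l)%N || (L <= x j)%N) -> (forall j, (y j < l)%N || (L <= y j)%N) ->
  \sum_j fl (x j) = \sum_j fl (y j) ->
  forall k, (L <= k)%N -> #|[pred j | x j == k]| = #|[pred j | y j == k]|.
Proof.
have [L0 HL0] := floor_comb_lbound (n + n) (n%:Z * fl l)%:~R.
exists (maxn l L0); first exact: leq_maxl.
set L := maxn l L0 => x y xl yl xy k Lk.
pose S (x : 'I_n -> nat) : {poly int} := \sum_(j | (L <= x j)%N) 1 *: 'X^(x j).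
have coefS z : (S z)`_k = #|[pred j | z j == k]|%:R.
  rewrite coef_sum -sum1_card natr_sum big_mkcond [RHS]big_mkcond/=.
  apply: eq_bigr => j _; rewrite inE coefZ coefXn mul1r eq_sym.
  by case: eqP => [->|]; [rewrite Lk|case: ifP].
have lowS z i : (i < L)%N -> (S z)`_i = 0.
  move=> iL; rewrite coef_sum big1// => j Lj; rewrite coefZ coefXn mul1r.
  by case: eqP => // e; move: iL; rewrite e ltnNge Lj.
have combS z : (forall j, (z j < l)%N || (L <= z j)%N) -> exists2 c : int,
    \sum_(i < size (S z)) (S z)`_i * fl i = \sum_j fl (z j) - c &
    0 <= c <= n%:Z * fl l.
  move=> zl; exists (\sum_(j | ~~ (L <= z j)%N) fl (z j)).
    rewrite (pcomb_sumXn (fun i => fl i)) [X in X - _](bigID (fun j => L <= z j)%N)/= addrK.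
    by apply: eq_bigr => j _; rewrite mul1r.
  rewrite sumr_ge0//=; apply: (@le_trans _ _ (\sum_(j < n) fl l)).
    rewrite big_mkcond/=; apply: ler_sum => j _; case: ifP => // Lz.
    by rewrite le_fl//; move: (zl j); rewrite (negbTE Lz) orbF => /ltnW.
  by rewrite sumr_const card_ord -mulr_natl natz.
have [P0|P0] := eqVneq (S x - S y) 0.
  have : (S x - S y)`_k = 0 by rewrite P0 coef0.
  by rewrite coefB !coefS => /eqP; rewrite subr_eq0 eqr_nat => /eqP.
have [c1 e1 /andP[c10 c1n]] := combS _ xl; have [c2 e2 /andP[c20 c2n]] := combS _ yl.
have := HL0 _ P0; rewrite ltr_int => H.
suff: (n%:Z * fl l < `|c2 - c1|) by rewrite ltNge ler_norml; lia.
have -> : c2 - c1 = \sum_(i < size (S x - S y)) (S x - S y)`_i * fl i.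
  have := pcombD (fun i => fl i) (S x - S y) (S y); rewrite subrK e1 e2 xy; lia.
apply: H => [|i iL0].
  apply: leq_trans (plengthD _ _) _; rewrite plengthN.
  by rewrite leq_add// /S -[n in (_ <= n)%N]card_ord -[leqRHS]muln1 plength_sumZXn.
have iL : (i < L)%N by rewrite (leq_trans iL0)// leq_maxr.
by rewrite coefB !lowS ?subr0.
Qed.

End transcendental.

(** * The algebraic case: integer combinations with recurrent values *)

Section algebraic.
Variables (R : realType) (sigma : R).
Hypothesis sigma_gt1 : 1 < sigma.
Local Notation fl k := (Num.floor (sigma ^+ k)).

(** As soon as sigma^j >= 1 / (sigma - 1), the next power is larger by at least 1 and the floors
    increase strictly; for smaller exponents they may coincide. *)
Lemma floor_powers_inj : exists K, forall j k, (K <= j)%N -> (K <= k)%N ->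
  fl j = fl k -> j = k.
Proof.
have s0 : 0 < sigma - 1 by rewrite subr_gt0.
have [K HK] := pow_unbounded sigma_gt1 (sigma - 1)^-1.
have lt_fl j k : (K <= j)%N -> (j < k)%N -> fl j < fl k.
  move=> Kj jk; rewrite -lezD1 floor_ge_int_tmp intrD.
  have h1 : 1 + sigma ^+ j <= sigma ^+ j.+1.
    have : (sigma - 1)^-1 <= sigma ^+ j by rewrite (le_trans HK)// ler_eXn2l.
    by rewrite -div1r ler_pdivrMr// mulrBr mulr1 -exprSr; lra.
  have h2 : sigma ^+ j.+1 <= sigma ^+ k by rewrite ler_eXn2l.
  have := floor_le_tmp (sigma ^+ j); lra.
exists K => j k Kj Kk e; case: (ltngtP j k) => // h.
  by have := lt_fl _ _ Kj h; rewrite e ltxx.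
by have := lt_fl _ _ Kk h; rewrite e ltxx.
Qed.

(** Dividing by X - 1 as often as possible keeps the root sigma, which is not 1, and gives P(1) <>
    0; each division lowers the size. The primitive part has an odd coefficient, since 2 does not
    divide its content. *)
Lemma algebraic_int_poly : algebraicOver (ratr : rat -> R) sigma ->
  exists P : {poly int}, [/\ peval sigma P = 0, P.[1] != 0 & exists i, odd (absz P`_i)].
Proof.
move=> [p p0 rp].
have [q] : exists2 q : {poly int}, q != 0 & peval sigma q = 0.
  have [q [a a0 pE]] := rat_poly_scale p; exists q.
    by apply: contra_neq p0 => q0; rewrite pE q0 rmorph0 scaler0.
  move: rp; rewrite pE map_polyZ /root hornerZ -map_poly_comp.
  rewrite (eq_map_poly (fun x => ratr_int R x)) mulf_eq0 fmorphV invr_eq0.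
  by rewrite /= ratr_int intr_eq0 (negbTE a0)/= pevalE => /eqP.
elim: {q}(size q) {-2}q (leqnn (size q)) => [|n ih] q sq q0 qs.
  by move: sq; rewrite leqn0 size_poly_eq0 (negbTE q0).
pose P := zprimitive q.
have PE : q = zcontents q *: P by exact: zpolyEprim.
have Ps : peval sigma P = 0.
  move: qs; rewrite PE !pevalE -mul_polyC rmorphM/= map_polyC hornerM hornerC => /eqP.
  by rewrite mulf_eq0 intr_eq0 zcontents_eq0 (negbTE q0)/= => /eqP.
have P0 : P != 0 by rewrite zprimitive_eq0.
have [P1|P1] := eqVneq P.[1] 0; last first.
  exists P; split => //; apply: contrapT => Podd.
  have : (2 %| zcontents P)%Z.
    rewrite dvdz_contents; apply/polyOverP => i; apply/negPn/negP => h.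
    by apply: Podd; exists i; rewrite -[odd _]negbK -dvdn2.
  by rewrite zcontents_primitive q0.
have /factor_theorem[Q QE] : root P 1 by apply/eqP.
apply: (ih Q).
- rewrite -ltnS (leq_trans _ sq)//.
  have -> : size q = size P by rewrite PE size_scale// zcontents_eq0.
  have Q0 : Q != 0 by apply: contra_neq P0 => Q0; rewrite QE Q0 mul0r.
  by rewrite QE size_Mmonic ?monicXsubC// size_XsubC addn2.
- by apply: contra_neq P0 => Q0; rewrite QE Q0 mul0r.
- move: Ps; rewrite QE !pevalE rmorphM/= rmorphB/= map_polyX map_polyC/= hornerM hornerXsubC.
  by move/eqP; rewrite mulf_eq0 subr_eq0 (gt_eqF sigma_gt1) orbF => /eqP.
Qed.

(** Since P(sigma) = 0, the same combination of the true powers vanishes at every shift k. Only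
    fractional parts remain, so the integers S k stay in [-N, N] and one of them recurs for
    arbitrarily large k. *)
Lemma floor_comb_recurrent (P : {poly int}) : peval sigma P = 0 ->
  exists c, forall L, exists2 k, (L <= k)%N & \sum_(i < size P) P`_i * fl (k + i) = c.
Proof.
move=> Ps; set N := plength P; apply: contrapT => H.
pose S k := \sum_(i < size P) P`_i * fl (k + i).
have SN k : (absz (S k) <= N)%N.
  rewrite -(ler_nat R) natr_absz intr_norm.
  have -> : (S k)%:~R = \sum_(i < size P) (P`_i)%:~R * ((fl (k + i))%:~R - sigma ^+ (k + i)) :> R.
    under [RHS]eq_bigr do rewrite mulrBr; rewrite sumrB rmorph_sum/=.
    under [X in _ - X]eq_bigr do rewrite exprD mulrCA.
    rewrite -mulr_sumr -/(peval sigma P) Ps mulr0 subr0.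
    by apply: eq_bigr => i _; rewrite rmorphM.
  apply: le_trans (ler_norm_sum _ _ _) _; rewrite /N /plength natr_sum; apply: ler_sum => i _.
  rewrite normrM -intr_norm natr_absz ler_piMr ?ler0z// ler_norml.
  have := floor_le_tmp (sigma ^+ (k + i)); have := floorD1_gt (sigma ^+ (k + i)).
  by rewrite intrD; lra.
have {H} H c : exists L, forall k, (L <= k)%N -> S k <> c.
  apply: contrapT => H'; apply: H; exists c => L; apply: contrapT => H2; apply: H'.
  by exists L => k Lk Sc; apply: H2; exists k.
have [L HL] := choice H.
(* From M on, no integer of [-N, N] would be a value of S any more. *)
pose M := (\max_(i < N.*2.+1) L (i%:Z - N%:Z)%R)%N.
have SE : S M = (inord (absz (S M + N%:Z)) : 'I_(N.*2.+1))%:Z - N%:Z.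
  rewrite inordK; have := SN M; move: (S M) => x; lia.
by apply: (HL (S M) M) => //; rewrite {1}SE /M (leq_bigmax (inord _)).
Qed.

End algebraic.

(** * Trigonometric polynomials and their moments *)

Section complex_more.
Variable R : realType.
Implicit Types x y : R[i].

Lemma normc_ge0 x : 0 <= normc x.
Proof. by case: x => a b; exact: sqrtr_ge0. Qed.

Lemma normcX x n : normc (x ^+ n) = normc x ^+ n.
Proof. by elim: n => [|n ih]; rewrite ?normc1// !exprS normcM ih. Qed.

Lemma normc_conj x : normc x^* = normc x.
Proof. by case: x => a b /=; rewrite sqrrN. Qed.

Lemma mulC_conj x : x * x^* = (normc x ^+ 2)%:C.
Proof.
case: x => a b; apply/eqP; rewrite eq_complex/= sqr_sqrtr ?addr_ge0 ?sqr_ge0//.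
by rewrite mulrN opprK -!expr2 eqxx mulrN mulrC addNr eqxx.
Qed.

Lemma ReD x y : Re (x + y) = Re x + Re y. Proof. by case: x; case: y. Qed.
Lemma ImD x y : Im (x + y) = Im x + Im y. Proof. by case: x; case: y. Qed.

Lemma normc_sum (I : Type) (r : seq I) (P : pred I) (F : I -> R[i]) :
  normc (\sum_(i <- r | P i) F i) <= \sum_(i <- r | P i) normc (F i).
Proof.
elim/big_ind2 : _ => [|x a y b xa yb|//]; first by rewrite normc0.
by rewrite (le_trans (le_normcD _ _))// lerD.
Qed.

Lemma normc_prod (I : Type) (r : seq I) (P : pred I) (F : I -> R[i]) :
  normc (\prod_(i <- r | P i) F i) = \prod_(i <- r | P i) normc (F i).
Proof. by elim/big_ind2 : _ => [|x a y b <- <-|//]; rewrite ?normc1 ?normcM. Qed.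

End complex_more.

Section echar_algebra.
Variable R : realType.
Notation circle := (circle R).
Implicit Types z : circle.

Lemma circle_val_neq0 z : circle_val z != 0.
Proof.
apply/eqP => z0; have := normc_circle z; rewrite z0 normc0 => /esym/eqP.
by rewrite oner_eq0.
Qed.

Lemma echar0 z : echar 0 z = 1. Proof. by []. Qed.

Lemma echarD m n z : echar (m + n) z = echar m z * echar n z.
Proof. by rewrite /echar expfzDr// circle_val_neq0. Qed.

Lemma echar_conj n z : (echar n z)^* = echar (- n) z.
Proof.
have e0 : echar n z != 0 by rewrite expfz_neq0// circle_val_neq0.
apply: (mulfI e0); rewrite -echarD subrr mulC_conj normc_echar expr1n.
by rewrite echar0.
Qed.

Lemma echar_sum (I : Type) (r : seq I) (P : pred I) (k : I -> int) z :
  echar (\sum_(i <- r | P i) k i) z = \prod_(i <- r | P i) echar (k i) z.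
Proof.
apply: (big_ind2 (fun a b => echar a z = b)) => // m a n b <- <-.
exact: echarD.
Qed.

Lemma echar_pow m n z : echar m (circle_pow n z) = echar (n * m) z.
Proof. by rewrite /echar /circle_val/= exprz_exp. Qed.

End echar_algebra.

Section complex_integral.
Variable R : realType.
Notation circle := (circle R).
Notation haar := (haar R).
Implicit Types f g : circle -> R[i].

Lemma bounded_integrable (nu : probability circle R) (f : circle -> R) (M : R) :
  measurable_fun setT f -> (forall z, `|f z| <= M) ->
  nu.-integrable setT (EFin \o f).
Proof.
move=> mf fM.
have icst : nu.-integrable setT (EFin \o cst M).
  by apply: finite_measure_integrable_cst.
apply: le_integrable icst => //; first exact/measurable_EFinP.
by move=> z _ /=; rewrite lee_fin (le_trans (fM z))// ler_norm.
Qed.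

Lemma cmeasurableB f g : cmeasurable f -> cmeasurable g -> cmeasurable (fun z => f z - g z).
Proof.
move=> mf mg; under eq_fun do rewrite -mulN1r.
by apply: cmeasurableD => //; apply: cmeasurableM => //; exact: cmeasurable_cst.
Qed.

Definition cintegrable f :=
  cmeasurable f /\ haar.-integrable setT (EFin \o (normc \o f)).

Lemma cintegrable_bounded f (M : R) : cmeasurable f ->
  (forall z, normc (f z) <= M) -> cintegrable f.
Proof.
move=> mf fM; split => //; apply: (@bounded_integrable haar _ M).
  exact: measurable_normc.
by move=> z /=; rewrite ger0_norm ?normc_ge0.
Qed.

Lemma cintegrable_ReIm f : cintegrable f ->
  haar.-integrable setT (EFin \o (Re \o f)) /\
  haar.-integrable setT (EFin \o (Im \o f)).
Proof.
move=> [[mr mi] fi]; split; apply: le_integrable fi => //; do ?exact/measurable_EFinP.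
- by move=> z _ /=; rewrite lee_fin (le_trans (le_Re_normc _))// ler_norm.
- by move=> z _ /=; rewrite lee_fin (le_trans (le_Im_normc _))// ler_norm.
Qed.

Lemma cintegrableD f g : cintegrable f -> cintegrable g ->
  cintegrable (fun z => f z + g z).
Proof.
move=> [mf fi] [mg gi]; have mfg := cmeasurableD mf mg; split => //.
have := integrableD measurableT fi gi; apply: le_integrable => //.
  by apply/measurable_EFinP; exact: measurable_normc.
move=> z _ /=; rewrite lee_fin !ger0_norm ?addr_ge0 ?normc_ge0//.
exact: le_normcD.
Qed.

Lemma cintegrableM f g (M : R) : cintegrable f -> cmeasurable g ->
  (forall z, normc (g z) <= M) -> cintegrable (fun z => f z * g z).
Proof.
move=> [mf fi] mg gM; have mfg := cmeasurableM mf mg; split => //.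
have := integrableZl measurableT M fi; apply: le_integrable => //.
  by apply/measurable_EFinP; exact: measurable_normc.
move=> z _ /=; rewrite lee_fin !ger0_norm ?mulr_ge0 ?normc_ge0//.
  by rewrite normcM mulrC ler_wpM2r ?normc_ge0.
exact: le_trans (normc_ge0 _) (gM z).
Qed.

Lemma cintegrableZ (a : R[i]) f : cintegrable f -> cintegrable (fun z => a * f z).
Proof.
move=> fi; rewrite (_ : (fun z => _) = (fun z => f z * a)).
  by apply: (@cintegrableM _ _ (normc a)) => //; exact: cmeasurable_cst.
by apply/funext => z; rewrite mulrC.
Qed.

Lemma cintegrable_cst (a : R[i]) : cintegrable (fun=> a).
Proof. by apply: (@cintegrable_bounded _ (normc a)) => //; exact: cmeasurable_cst. Qed.

Lemma cintegrable_sum (I : Type) (r : seq I) (F : I -> circle -> R[i]) :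
  (forall i, cintegrable (F i)) -> cintegrable (fun z => \sum_(i <- r) F i z).
Proof.
move=> Fi; elim: r => [|i r ih].
  by under eq_fun do rewrite big_nil; exact: cintegrable_cst.
by under eq_fun do rewrite big_cons; exact: cintegrableD.
Qed.

Lemma cintegralD f g : cintegrable f -> cintegrable g ->
  cintegral (fun z => f z + g z) = cintegral f + cintegral g.
Proof.
move=> /cintegrable_ReIm[fr fj] /cintegrable_ReIm[gr gj].
rewrite /cintegral [RHS]/GRing.add/= -RintegralD// -RintegralD//.
by congr Complex; apply: eq_Rintegral => z _; rewrite ?ReD ?ImD.
Qed.

Lemma cintegralZ (a : R[i]) f : cintegrable f ->
  cintegral (fun z => a * f z) = a * cintegral f.
Proof.
move=> fi; have [fr fj] := cintegrable_ReIm fi.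
case: a => a b; rewrite /cintegral [RHS]/GRing.mul/= -!RintegralZl//.
have iZ (c : R) (h : circle -> R) : haar.-integrable setT (EFin \o h) ->
    haar.-integrable setT (EFin \o (fun z => c * h z)).
  move=> ih; rewrite (_ : _ \o _ = fun z => (c%:E * (h z)%:E)%E)//.
  exact: integrableZl.
rewrite -RintegralB//; [|exact: iZ|exact: iZ].
rewrite -RintegralD//; [|exact: iZ|exact: iZ].
by congr Complex; apply: eq_Rintegral => z _; case: (f z).
Qed.

Lemma cintegral_cst (a : R[i]) : cintegral (fun=> a : R[i]) = a.
Proof.
rewrite /cintegral !Rintegral_cst//.
have h1 : fine (haar setT) = 1 by rewrite (probability_setT haar).
by case: a => a b; rewrite h1 !mulr1.
Qed.

Lemma cintegral_sum (I : Type) (r : seq I) (F : I -> circle -> R[i]) :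
  (forall i, cintegrable (F i)) ->
  cintegral (fun z => \sum_(i <- r) F i z) = \sum_(i <- r) cintegral (F i).
Proof.
move=> Fi; elim: r => [|i r ih].
  by under eq_fun do rewrite big_nil; rewrite big_nil cintegral_cst.
under eq_fun do rewrite big_cons; rewrite big_cons cintegralD ?ih//.
exact: cintegrable_sum.
Qed.

Lemma cintegral_real (f : circle -> R) :
  cintegral (fun z => (f z)%:C) = (\int[haar]_z f z)%:C.
Proof. by rewrite /cintegral; congr Complex; rewrite Rintegral_cst// mul0r. Qed.

Lemma le_normc_cintegral f : cintegrable f ->
  normc (cintegral f) <= \int[haar]_z normc (f z).
Proof.
move=> fi; set w := cintegral f.
have [w0|w0] := eqVneq (normc w) 0; first by rewrite w0 Rintegral_ge0// => z _; exact: normc_ge0.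
have wp : 0 < normc w by rewrite lt_neqAle eq_sym w0 normc_ge0.
(* The unimodular c turns the integral onto the positive real axis, and Re (c f) <= |f|
   concludes. *)
pose c : R[i] := w^* * (normc w)%:C^-1.
have cn : normc c = 1.
  rewrite /c normcM normc_conj (_ : (normc w)%:C^-1 = ((normc w)^-1)%:C).
    by rewrite [normc (_%:C)]/= expr0n/= addr0 sqrtr_sqr ger0_norm ?invr_ge0 ?normc_ge0// divff.
  by rewrite rmorphV// unitfE.
have -> : normc w = \int[haar]_z Re (c * f z).
  have -> : \int[haar]_z Re (c * f z) = Re (cintegral (fun z => c * f z)) by [].
  rewrite cintegralZ// -/w /c mulrAC mulrC [w^* * _]mulrC mulC_conj -rmorphV ?unitfE//.
  by rewrite -rmorphM/= expr2 mulKf.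
have [cr _] := cintegrable_ReIm (cintegrableZ c fi).
apply: le_Rintegral => //; first by case: fi.
by move=> z _; rewrite (le_trans (ler_norm _))// (le_trans (le_Re_normc _))// normcM cn mul1r.
Qed.

Lemma integral_haar (f : circle -> R) :
  measurable_fun setT f -> (forall z, 0 <= f z) ->
  (\int[haar]_z (f z)%:E = \int[@lebesgue_measure R]_(t in `[0%R, 1%R]) (f (expi t))%:E)%E.
Proof.
move=> mf f0.
rewrite ge0_integral_pushforward//=; last 2 first.
- exact/measurable_EFinP.
- by move=> z _; rewrite lee_fin.
rewrite preimage_setT integral_uniform//=; last 2 first.
- by apply/measurable_EFinP; apply: measurableT_comp => //; exact: measurable_expi.
- by move=> t; rewrite lee_fin.
- by rewrite subr0 invr1 mul1e.
- exact: measurable_expi.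
Qed.


Lemma expiD (s t : R) : circle_val (expi (s + t)) = circle_val (expi s) * circle_val (expi t).
Proof.
rewrite /circle_val/= mulrDr cosD sinD [RHS]/GRing.mul/=.
by congr Complex; rewrite addrC [cos _ * _]mulrC// mulrC.
Qed.

Lemma echar_expi (n : int) (t : R) : echar n (expi t) = circle_val (expi (n%:~R * t)).
Proof.
have pos (m : nat) : echar m (expi t) = circle_val (expi (m%:R * t)).
  elim: m => [|m ih]; first by rewrite mul0r /circle_val/= mulr0 cos0 sin0.
  by rewrite -addn1 PoszD echarD ih natrD mulrDl expiD mul1r.
case: n => n; first exact: pos.
rewrite NegzE -echar_conj pos mulrNz mulNr /circle_val/= mulrN cosN sinN.
by [].
Qed.

Lemma cintegral_echar (n : int) : cintegral (echar n) = (n == 0)%:R :> R[i].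
Proof.
have [->|n0] := eqVneq n 0; first exact: cintegral_cst.
have nR0 : 2 * pi * n%:~R != 0 :> R by rewrite !mulf_neq0 ?intr_eq0// gt_eqF// pi_gt0.
(* [integral_haar] is stated for nonnegative integrands; hence 1 + f is integrated, with
   antiderivative t + F t, and the periodicity F 1 = F 0 leaves exactly 1. *)
have shift (f : circle -> R) (F : R -> R) :
    measurable_fun setT f -> (forall z, `|f z| <= 1) ->
    (forall t : R, is_derive t (1 : R) F (f (expi t))) -> continuous (fun t => f (expi t)) ->
    F 1 = F 0 -> \int[haar]_z f z = 0.
  move=> mf f1 dF cF F10.
  have h1 : fine (haar setT) = 1 by rewrite (probability_setT haar).
  have icst : haar.-integrable setT (EFin \o cst (1 : R)).
    exact: finite_measure_integrable_cst.
  have fi := bounded_integrable haar mf f1.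
  suff : \int[haar]_z (1 + f z) = 1.
    rewrite RintegralD//= Rintegral_cst// h1 mul1r => /eqP.
    by rewrite -subr_eq0 addrC addKr => /eqP.
  rewrite /Rintegral integral_haar//; last 2 first.
  - exact: measurable_funD.
  - by move=> z; have := f1 z; rewrite ler_norml; lra.
  pose G t := t + F t.
  have dG (t : R) : is_derive t (1 : R) G (1 + f (expi t)).
    exact: is_deriveD.
  have cG : continuous G.
    move=> t; apply: differentiable_continuous; apply/derivable1_diffP.
    exact: (@ex_derive _ _ _ _ _ _ _ (dG t)).
  rewrite (@continuous_FTC2 _ _ G 0 1)//=.
  - by rewrite /G F10; ring.
  - apply: continuous_subspaceT => t; apply: continuousD; first exact: cvg_cst.
    exact: cF.
  - split.
    + by move=> t _; exact: (@ex_derive _ _ _ _ _ _ _ (dG t)).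
    + by apply: cvg_at_right_filter; exact: cG.
    + by apply: cvg_at_left_filter; exact: cG.
  - by move=> t _; rewrite derive1E; exact: (@derive_val _ _ _ _ _ _ _ (dG t)).
have [mr mi] := cmeasurable_echar R n.
have n1 z : normc (echar n z : R[i]) <= 1 by rewrite normc_echar.
have e1 : circle_val (expi (1 : R)) = 1.
  by rewrite /circle_val/= mulr1 mulr_natl cos2pi sin2pi.
have e0 : circle_val (expi (0 : R)) = 1.
  by rewrite /circle_val/= mulr0 cos0 sin0.
have /(congr1 (fun z => (Re z, Im z)))[per1 per2] :
    circle_val (expi (n%:~R * 1 : R)) = circle_val (expi (n%:~R * 0)).
  by rewrite -!echar_expi /echar e1 e0.
have reE t : Re (echar n (expi t) : R[i]) = cos (2 * pi * (n%:~R * t)) by rewrite echar_expi.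
have imE t : Im (echar n (expi t) : R[i]) = sin (2 * pi * (n%:~R * t)) by rewrite echar_expi.
have dl (t : R) : is_derive t (1 : R) (fun t : R => 2 * pi * (n%:~R * t)) (2 * pi * n%:~R).
  rewrite (_ : (fun t : R => _) = (fun t => (2 * pi * n%:~R) *: t)); last first.
    by apply/funext => u; rewrite /GRing.scale/= mulrA.
  by apply: is_derive_eq; rewrite /GRing.scale/= mulr1.
have cl t : {for t, continuous (fun t : R => 2 * pi * (n%:~R * t))}.
  apply: differentiable_continuous; apply/derivable1_diffP.
  exact: (@ex_derive _ _ _ _ _ _ _ (dl t)).
rewrite /cintegral; congr Complex.
  apply: (shift _ (fun t => (2 * pi * n%:~R)^-1 * sin (2 * pi * (n%:~R * t)))) => //.
  - by move=> z; rewrite (le_trans (le_Re_normc _)).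
  - move=> t; rewrite reE.
    apply: is_derive_eq (is_deriveZ _ (is_derive1_comp (is_derive_sin _) (dl t))) _.
    by rewrite /GRing.scale/= mulrCA mulVf// mulr1.
  - move=> t; under eq_fun do rewrite reE.
    exact: (continuous_comp (cl t) (@continuous_cos _ _)).
  - by rewrite per2.
apply: (shift _ (fun t => - (2 * pi * n%:~R)^-1 * cos (2 * pi * (n%:~R * t)))) => //.
- by move=> z; rewrite (le_trans (le_Im_normc _)).
- move=> t; rewrite imE.
  apply: is_derive_eq (is_deriveZ _ (is_derive1_comp (is_derive_cos _) (dl t))) _.
  by rewrite /GRing.scale/= !mulNr mulrN opprK mulrCA mulVf// mulr1.
- move=> t; under eq_fun do rewrite imE.
  exact: (continuous_comp (cl t) (@continuous_sin _ _)).
- by rewrite per1.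
Qed.

End complex_integral.

Section exponential_polynomials.
Variable R : realType.
Notation circle := (circle R).
Notation haar := (haar R).

(** In contrast to [trigpoly], frequencies may repeat and the index type is arbitrary: conjugates,
    products and powers keep this form without any collecting of terms. *)
Definition epoly (I : finType) (p : I -> int) (a : I -> R[i]) (z : circle) : R[i] :=
  \sum_i a i * echar (p i) z.

Lemma trigpolyE (G : {fset int}) (a : int -> R[i]) :
  trigpoly G a = epoly (val : G -> int) (a \o val).
Proof. by apply/funext => z; rewrite /trigpoly /epoly big_seq_fsetE. Qed.

Section one_polynomial.
Variables (I : finType) (p : I -> int) (a : I -> R[i]).

Lemma normc_epoly_le z : normc (epoly p a z) <= \sum_i normc (a i).
Proof.
apply: le_trans (normc_sum _ _ _) _; apply: ler_sum => i _.
by rewrite normcM normc_echar mulr1.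
Qed.

Lemma cmeasurable_epoly : cmeasurable (epoly p a).
Proof.
rewrite /epoly; elim: (index_enum I) => [|i r ih].
  by under eq_fun do rewrite big_nil; exact: cmeasurable_cst.
under eq_fun do rewrite big_cons; apply: cmeasurableD => //.
by apply: cmeasurableM; [exact: cmeasurable_cst|exact: cmeasurable_echar].
Qed.

Lemma cintegral_epoly : cintegral (epoly p a) = \sum_(i | p i == 0) a i.
Proof.
have eint i : cintegrable (fun z : circle => echar (p i) z).
  apply: (@cintegrable_bounded _ _ 1); first exact: cmeasurable_echar.
  by move=> z; rewrite normc_echar.
rewrite /epoly cintegral_sum => [|i]; last exact: cintegrableZ.
rewrite [RHS]big_mkcond; apply: eq_bigr => i _.
by rewrite cintegralZ// cintegral_echar; case: eqP; rewrite ?mulr1 ?mulr0.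
Qed.

Lemma epoly_conj z : (epoly p a z)^* = epoly (fun i => - p i) (fun i => (a i)^*) z.
Proof.
rewrite /epoly rmorph_sum; apply: eq_bigr => i _.
by rewrite rmorphM/= -echar_conj.
Qed.

Lemma epolyX n z : epoly p a z ^+ n =
  epoly (fun u : {ffun 'I_n -> I} => \sum_j p (u j)) (fun u => \prod_j a (u j)) z.
Proof.
rewrite /epoly -[n in LHS]card_ord -prodr_const bigA_distr_bigA/=.
by apply: eq_bigr => u _; rewrite big_split/= echar_sum.
Qed.

End one_polynomial.

Lemma epolyM (I J : finType) (p : I -> int) (q : J -> int) a b z :
  epoly p a z * epoly q b z =
  epoly (fun k : I * J => p k.1 + q k.2) (fun k => a k.1 * b k.2) z.
Proof.
rewrite /epoly big_distrlr pair_bigA/=; apply: eq_bigr => k _.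
by rewrite echarD mulrACA.
Qed.

Lemma epoly_pow (I : finType) (p : I -> int) a n z :
  epoly p a (circle_pow n z) = epoly (fun i => n * p i) a z.
Proof. by apply: eq_bigr => i _; rewrite echar_pow. Qed.

(** Here n is half the exponent: the number of factors on each side once |f|^(2n) is expanded as f^n
    times its conjugate. *)
Definition moment n (f : circle -> R[i]) : R := \int[haar]_z (normc (f z)) ^+ (n + n).

Lemma normc_epoly_sqr (I : finType) (p : I -> int) a z :
  (normc (epoly p a z) ^+ 2)%:C =
  epoly (fun k : I * I => p k.1 - p k.2) (fun k => a k.1 * (a k.2)^*) z.
Proof. by rewrite -mulC_conj epoly_conj epolyM. Qed.

Lemma moment_epoly (I : finType) (p : I -> int) a n :
  (moment n (epoly p a))%:C = \sum_(w : {ffun 'I_n -> I} * {ffun 'I_n -> I}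
      | \sum_j p (w.1 j) == \sum_j p (w.2 j))
    (\prod_j a (w.1 j)) * (\prod_j a (w.2 j))^*.
Proof.
rewrite /moment -cintegral_real.
under eq_fun do
  rewrite addnn -muln2 exprM -normcX epolyX normc_epoly_sqr.
by rewrite cintegral_epoly; apply: eq_bigl => w; rewrite subr_eq0.
Qed.

(** In the expansion of [moment_epoly] the pair (u, v) acquires the factor prod s(u) times the
    conjugate of prod s(v), which is 1 when the two products agree. Pairs that meet a zero
    coefficient contribute 0 on both sides, so polynomials with gaps are covered. *)
Lemma moment_isometry (I : finType) (p : I -> int) (a s : I -> R[i]) n :
  (forall i, normc (s i) = 1) ->
  (forall u v : {ffun 'I_n -> I}, \sum_j p (u j) = \sum_j p (v j) ->
     (forall j, a (u j) != 0) -> (forall j, a (v j) != 0) ->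
     \prod_j s (u j) = \prod_j s (v j)) ->
  moment n (epoly p (fun i => s i * a i)) = moment n (epoly p a).
Proof.
move=> s1 sP; apply: complexI; rewrite !moment_epoly; apply: eq_bigr => w /eqP /sP e.
rewrite !big_split/=.
have [/existsP[j /eqP a0]|] := boolP [exists j, a (w.1 j) == 0].
  have a0' : \prod_j a (w.1 j) = 0 by rewrite (bigD1 j)//= a0 mul0r.
  by rewrite a0' !(mul0r, mulr0).
have [/existsP[j /eqP a0] _|] := boolP [exists j, a (w.2 j) == 0].
  have a0' : \prod_j a (w.2 j) = 0 by rewrite (bigD1 j)//= a0 mul0r.
  by rewrite a0' mulr0 rmorph0 !mulr0.
rewrite !negb_exists => /forallP a2 /forallP a1.
rewrite (e a1 a2) rmorphM/= mulrACA mulC_conj normc_prod.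
by under eq_bigr do rewrite s1; rewrite prodr_const expr1n expr1n mul1r.
Qed.

Lemma moment_ge0 n f : 0 <= moment n f.
Proof. by apply: Rintegral_ge0 => z _; rewrite exprn_ge0// normc_ge0. Qed.

Lemma moment1_epoly (I : finType) (p : I -> int) a : injective p ->
  moment 1 (epoly p a) = \sum_i normc (a i) ^+ 2.
Proof.
move=> pinj; apply: complexI; rewrite /moment -cintegral_real rmorph_sum/=.
under eq_fun do rewrite normc_epoly_sqr.
rewrite cintegral_epoly/=.
rewrite -(pair_big_dep xpredT (fun i j => p i - p j == 0) (fun i j => a i * (a j)^*))/=.
apply: eq_bigr => i _; rewrite -mulC_conj (big_pred1 i)// => j.
by rewrite subr_eq0 (inj_eq pinj) eq_sym.
Qed.

End exponential_polynomials.

Section Lp_norm.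
Variables (R : realType) (n : nat).
Hypothesis n_gt0 : (0 < n)%N.
Notation circle := (circle R).
Notation haar := (haar R).
Let p : nat := (n + n)%N.
Let p_gt0 : (0 < p%:R :> R). Proof. by rewrite ltr0n addn_gt0 n_gt0. Qed.
Implicit Types f g : circle -> R[i].

Lemma cLnorm_moment f : cmeasurable f -> (cLnorm R p%:R f < +oo)%E ->
  fine (cLnorm R p%:R f) ^+ p = moment n f.
Proof.
move=> mf Nf.
have N0 := cLnorm_ge0 p%:R f.
have Nfin : cLnorm R p%:R f \is a fin_num by rewrite ge0_fin_numE.
apply/eqP; rewrite -eqe.
rewrite /moment /Rintegral.
have := poweR_Lnorm haar (fun z => (normc (f z))%:E) (lt0r_neq0 p_gt0).
rewrite -[X in (X `^ _)%E]/(cLnorm R p%:R f) -[X in (X `^ _)%E](fineK Nfin).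
rewrite poweR_EFin powR_mulrn ?fine_ge0// => e.
rewrite (_ : \int[haar]_z _ = \int[haar]_z `|(normc (f z))%:E| `^ p%:R)%E; first by rewrite -e.
apply: eq_integral => z _; rewrite poweR_EFin.
by rewrite /= ger0_norm ?normc_ge0// powR_mulrn ?normc_ge0.
Qed.

Lemma cLnorm_bounded_fin f (M : R) : cmeasurable f -> (forall z, normc (f z) <= M) ->
  (cLnorm R p%:R f < +oo)%E.
Proof.
move=> mf fM; have M0 : 0 <= M by exact: le_trans (normc_ge0 _) (fM point).
rewrite /cLnorm unlock poweR_lty//.
apply: (@le_lt_trans _ _ (\int[haar]_z (M `^ p%:R)%:E)%E).
  apply: ge0_le_integral => //=.
  - apply/measurable_EFinP; apply: (@measurableT_comp _ _ _ _ _ _ (@powR R ^~ p%:R)) => //.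
    exact: measurableT_comp (measurable_normc mf).
  - by move=> z _; rewrite lee_fin ge0_ler_powR ?nnegrE ?normr_ge0// ger0_norm ?normc_ge0.
rewrite integral_cst// lte_mul_pinfty ?lee_fin ?powR_ge0//.
by rewrite -ge0_fin_numE//; exact: fin_num_measure.
Qed.

End Lp_norm.

Section counting.
Variables (I : finType) (n : nat).
Implicit Types u v : {ffun 'I_n -> I}.

Definition mult u (i : I) : nat := #|[pred j | u j == i]|.

Lemma prod_mult (A : comNzRingType) (F : I -> A) u :
  \prod_j F (u j) = \prod_i F i ^+ mult u i.
Proof.
rewrite (partition_big u xpredT)//=; apply: eq_bigr => i _.
by rewrite -prodr_const; apply: eq_big => [j|j /eqP <-].
Qed.

Lemma sum_mult (F : I -> int) u : \sum_j F (u j) = \sum_i F i *+ mult u i.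
Proof.
rewrite (partition_big u xpredT)//=; apply: eq_bigr => i _.
by rewrite -sumr_const; apply: eq_big => [j|j /eqP <-].
Qed.

Lemma mult_le u i : (mult u i <= n)%N.
Proof. by rewrite -[leqRHS]card_ord max_card. Qed.

(** List every i as often as m i prescribes. Exponent vectors thus become the tuples over which
    moments expand. *)
Lemma exists_mult (m : I -> nat) : (\sum_i m i)%N = n -> exists u, mult u =1 m.
Proof.
move=> mn; pose s := flatten [seq nseq (m i) i | i <- enum I].
have ss : size s == n.
  rewrite size_flatten /shape -map_comp sumnE big_map -mn big_enum/=.
  by apply/eqP; apply: eq_bigr => i _; rewrite size_nseq.
exists [ffun j => tnth (Tuple ss) j] => i.
rewrite /mult (eq_card (B := [pred j | tnth (Tuple ss) j == i])); last by move=> j; rewrite !inE ffunE.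
rewrite cardE /enum_mem size_filter -enumT.
rewrite (_ : count _ _ = count (preim (tnth (Tuple ss)) (pred1 i)) (enum 'I_n)); last exact: eq_count.
rewrite -count_map map_tnth_enum/= /s count_flatten -map_comp sumnE big_map.
rewrite big_enum/= (bigD1 i)//= big1 => [|j ji].
  by rewrite count_nseq/= eqxx mul1n addn0.
by rewrite count_nseq/= (negbTE ji).
Qed.

End counting.

(** * Detecting a relation by averaging over roots of unity *)

Section flip.
Variable R : realType.

Lemma cos2pi_eq1 (t : R) : `|t| < 1 -> cos (2 * pi * t) = 1 -> t = 0.
Proof.
wlog t0 : t / 0 <= t => [H|].
  have [/H//|t0] := leP 0 t; rewrite -normrN -cosN => h1 h2.
  by apply/oppr_inj; rewrite oppr0; apply: H => //; rewrite ?oppr_ge0 ?(ltW t0)// mulrN.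
rewrite ger0_norm// => t1 c1; apply/eqP/negPn/negP => tn0.
have tp : 0 < t by rewrite lt_neqAle eq_sym tn0.
have : 0 < sin (pi * t).
  apply: sin_gt0_pi; rewrite mulr_gt0 ?pi_gt0//=.
  by rewrite -[ltRHS]mulr1 ltr_pM2l ?pi_gt0.
have : cos (2 * pi * t) = 1 - sin (pi * t) ^+ 2 *+ 2.
  by rewrite -mulrA mulr_natl cos_mulr2n cos2sin2; ring.
by rewrite c1 => /eqP; rewrite eq_sym subr_eq addrC -subr_eq subrr eq_sym mulrn_eq0/= sqrf_eq0 => /eqP ->; rewrite ltxx.
Qed.

Lemma sum_unity_root (M : nat) (d : int) : (0 < M)%N -> (absz d < M)%N ->
  \sum_(k < M) echar (d * k%:Z) (expi (M%:R^-1 : R)) = if d == 0 then M%:R else 0.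
Proof.
move=> M0 dM; have MR : M%:R != 0 :> R by rewrite pnatr_eq0 -lt0n.
case: eqP => [->|/eqP d0].
  by under eq_bigr do rewrite mul0r echar0; rewrite sumr_const card_ord.
set x := echar d (expi (M%:R^-1 : R)).
have xk (k : nat) : echar (d * k%:Z) (expi (M%:R^-1 : R)) = x ^+ k.
  by rewrite /x /echar exprnP exprz_exp.
under eq_bigr do rewrite xk.
have xM : x ^+ M = 1.
  rewrite -xk echar_expi intrM mulfK// -[_%:~R]mulr1 -echar_expi /echar.
  have -> : circle_val (expi (1 : R)) = 1.
    by rewrite /circle_val/= mulr1 mulr_natl cos2pi sin2pi.
  by rewrite exp1rz.
have x1 : x - 1 != 0.
  apply: contra_neq d0 => /eqP; rewrite subr_eq0 /x echar_expi => /eqP/(congr1 Re)/= c1.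
  have := @cos2pi_eq1 (d%:~R * M%:R^-1) _ c1; rewrite normrM normfV normr_nat.
  rewrite ltr_pdivrMr ?ltr0n// mul1r -intr_norm -natr_absz ltr_nat => /(_ dM)/eqP.
  by rewrite mulf_eq0 invr_eq0 (negbTE MR) orbF intr_eq0 => /eqP.
by apply: (mulfI x1); rewrite -subrX1 xM subrr mulr0.
Qed.

Lemma intB_mulr (x y : nat) (k c : int) : (x%:Z - y%:Z - k) * c = c *+ x - c *+ y - k * c.
Proof. by rewrite -(mulr_natl c x) -(mulr_natl c y) (natz x) (natz y) !mulrBl. Qed.

(** Let the coefficients range over all M-th roots of unity and average the difference of the two
    moments against the character chi. Only the solutions w whose exponents differ by m - m'
    survive; the signs s multiply each of these terms by -1, so each contributes -2. Tuples with
    multiplicities m and m' form such a solution, so the differences cannot all be below 1 in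
    modulus. The bound does not depend on the frequencies. *)
Lemma moment_flip (I : finType) (p : I -> int) (m m' : I -> nat) n (s : I -> R[i]) :
  (\sum_i m i)%N = n -> (\sum_i m' i)%N = n ->
  \sum_i p i *+ m i = \sum_i p i *+ m' i ->
  (forall i, normc (s i) = 1) -> \prod_i s i ^+ m i = - \prod_i s i ^+ m' i ->
  exists2 a : I -> R[i], (forall i, normc (a i) = 1) &
    1 <= `|moment n (epoly p (fun i => s i * a i)) - moment n (epoly p a)|.
Proof.
(* The exponents d defined below are at most 2n in absolute value, hence less than M, so they vanish
   as soon as they vanish modulo M. *)
move=> mn m'n mp s1 sm; pose M := (n * 4).+1.
pose e := expi (M%:R^-1 : R).
pose T := {ffun I -> 'I_M}.
pose a (t : T) i := echar (t i)%:Z e.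
pose D t := moment n (epoly p (fun i => s i * a t i)) - moment n (epoly p (a t)).
apply: contrapT => H.
have {}H t : `|D t| < 1.
  rewrite ltNge; apply/negP => h; apply: H; exists (a t) => // i.
  exact: normc_echar.
pose chi (t : T) := echar (- \sum_i ((m i)%:Z - (m' i)%:Z) * (t i)%:Z) e.
pose W := ({ffun 'I_n -> I} * {ffun 'I_n -> I})%type.
pose res (w : W) := \sum_j p (w.1 j) == \sum_j p (w.2 j).
pose S (w : W) := \prod_j s (w.1 j) * (\prod_j s (w.2 j))^*.
pose d (w : W) i : int := (mult w.1 i)%:Z - (mult w.2 i)%:Z - ((m i)%:Z - (m' i)%:Z).
have Dchi t : (D t)%:C * chi t =
    \sum_(w | res w) (S w - 1) * \prod_i echar (d w i * (t i)%:Z) e.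
  rewrite /D rmorphB/= !moment_epoly -sumrB mulr_suml; apply: eq_bigr => w _.
  have -> : \prod_i echar (d w i * (t i)%:Z) e =
      \prod_j a t (w.1 j) * (\prod_j a t (w.2 j))^* * chi t.
    rewrite -!echar_sum echar_conj /chi -!echarD; congr echar.
    rewrite !(sum_mult (fun i => (t i)%:Z)) -!sumrN -!big_split/=; apply: eq_bigr => i _.
    exact: intB_mulr.
  by rewrite !big_split/= rmorphM/= /S; ring.
pose K := #|[pred w : W | res w & [forall i, d w i == 0]]|.
have dM w i : (absz (d w i) < M)%N.
  have := mult_le w.1 i; have := mult_le w.2 i.
  have : (m i <= n)%N by rewrite -mn (bigD1 i)//= leq_addr.
  have : (m' i <= n)%N by rewrite -m'n (bigD1 i)//= leq_addr.
  rewrite /d /M; move: (mult _ _) (mult _ _) (m i) (m' i) => x y k l; lia.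
have Sd w : [forall i, d w i == 0] -> S w = - 1.
  move=> /forallP dw; rewrite /S !prod_mult.
  set A := \prod_i s i ^+ mult w.1 i; set B := \prod_i s i ^+ mult w.2 i.
  have unit k : normc (\prod_i s i ^+ k i) = 1.
    by rewrite normc_prod big1// => i _; rewrite normcX s1 expr1n.
  have m'0 : \prod_i s i ^+ m' i != 0.
    by apply/eqP => h; have := unit m'; rewrite h normc0 => /eqP; rewrite eq_sym oner_eq0.
  have -> : A = - B.
    apply: (mulIf m'0); rewrite mulNr -mulrN -sm -!big_split/=; apply: eq_bigr => i _.
    rewrite -!exprD; congr (_ ^+ _); have := dw i; rewrite /d.
    by move: (mult _ _) (mult _ _) (m i) (m' i) => x y k l; lia.
  by rewrite mulNr mulC_conj unit expr1n.
have sumDchi : \sum_t (D t)%:C * chi t = - ((2 * K * #|T|)%:R)%:C.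
  under eq_bigr do rewrite Dchi.
  rewrite exchange_big/=.
  under eq_bigr => w _.
    rewrite -mulr_sumr.
    rewrite -(bigA_distr_bigA (fun i (k : 'I_M) => echar (d w i * k%:Z) e)).
    under eq_bigr do rewrite sum_unity_root//.
    over.
  rewrite (bigID (fun w => [forall i, d w i == 0]))/= [X in _ + X]big1 ?addr0; last first.
    move=> w /andP[_ /forallPn[i di]].
    by rewrite (bigD1 i)//= (negbTE di) mul0r mulr0.
  under eq_bigr => w /andP[_ dw].
    rewrite Sd// (eq_bigr (fun=> M%:R)); last by move=> i _; rewrite (forallP dw).
    rewrite prodr_const -natrX.
    over.
  rewrite sumr_const card_ffun card_ord -/K rmorph_nat.
  by rewrite -mulr_natr !natrM; ring.
have K0 : (0 < K)%N.
  have [u um] := exists_mult mn; have [v vm] := exists_mult m'n.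
  apply/card_gt0P; exists (u, v); rewrite inE/= /res/= !sum_mult; apply/andP; split.
    by apply/eqP; under eq_bigr do rewrite um; under [RHS]eq_bigr do rewrite vm.
  by apply/forallP => i; rewrite /d/= um vm subrr.
have : (2 * K * #|T|)%:R <= #|T|%:R :> R.
  apply: (@le_trans _ _ (normc (\sum_t (D t)%:C * chi t))).
    rewrite sumDchi normcN [normc _]/= expr0n/= addr0 sqrtr_sqr ger0_norm//.
  apply: le_trans (normc_sum _ _ _) _.
  rewrite -sumr_const; apply: ler_sum => t _.
  by rewrite normcM normc_echar mulr1 [normc _]/= expr0n/= addr0 sqrtr_sqr ltW.
have T0 : (0 < #|T|)%N by rewrite card_ffun card_ord expn_gt0.
by rewrite ler_nat -[leqRHS]mul1n leq_pmul2r// leqNgt (leq_pmulr _ K0).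
Qed.

End flip.

(** * Approximation of sets by trigonometric polynomials *)

Section elementary.
Variable R : realType.
Implicit Types x u : R.

Lemma bernoulli u n : -1 <= u -> 1 + n%:R * u <= (1 + u) ^+ n.
Proof.
move=> u1; elim: n => [|n ih]; first by rewrite mul0r addr0 expr0.
rewrite exprS; apply: le_trans (ler_wpM2l _ ih); last by lra.
have := sqr_ge0 u; have : (0 : R) <= n%:R by [].
rewrite -natr1 expr2; nra.
Qed.

Lemma natmulXn_le u n : 0 <= u -> u < 1 -> n%:R * u ^+ n <= (1 - u)^-1.
Proof.
move=> u0 u1; rewrite -div1r ler_pdivlMr ?subr_gt0// mulrC.
have e : 1 = u ^+ n + (1 - u) * \sum_(i < n) u ^+ i.
  by rewrite -opprB mulNr -subrX1 opprB addrC subrK.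
rewrite [leRHS]e -[leLHS]add0r lerD ?exprn_ge0// ler_wpM2l ?subr_ge0 ?(ltW u1)//.
rewrite mulr_natl -[n in _ *+ n]card_ord -sumr_const; apply: ler_sum => i _.
by rewrite ler_wiXn2l ?(ltW u1)// ltnW.
Qed.

(** By Bernoulli's inequality everything is governed by n (k x)^n, which tends to 0 when k x < 1 and
    is at least n otherwise; the factor n in the exponent settles the boundary k x = 1. This is a
    variant of the device in the Brosowski-Deutsch proof of the Stone-Weierstrass theorem. *)
Lemma cvg_threshold x k : 0 <= x -> x <= 1 -> (1 < k)%N ->
  (1 - x ^+ n) ^+ (n * k ^ n)%N @[n --> \oo] --> (((x < k%:R^-1)%R)%:R : R).
Proof.
move=> x0 x1 k1; have k0 : (0 : R) < k%:R by rewrite ltr0n ltnW.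
have xn n : 0 <= x ^+ n by rewrite exprn_ge0.
have xn1 n : x ^+ n <= 1 by rewrite exprn_ile1.
have p0 n : 0 <= (1 - x ^+ n) ^+ (n * k ^ n)%N by rewrite exprn_ge0// subr_ge0.
have p1 n : (1 - x ^+ n) ^+ (n * k ^ n)%N <= 1.
  by rewrite exprn_ile1 ?subr_ge0// gerBl.
have [xk|kx] := ltP x k%:R^-1.
  pose y := k%:R * x.
  have y0 : 0 <= y by rewrite mulr_ge0// ltW.
  have y1 : y < 1 by rewrite /y mulrC -ltr_pdivlMr// div1r.
  (* In y^n = s^n s^n, one factor absorbs n by [natmulXn_le] and the other tends to 0. *)
  pose s := Num.sqrt y.
  have s0 : 0 <= s by exact: sqrtr_ge0.
  have s1 : s < 1 by rewrite -sqrtr1 ltr_sqrt.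
  apply: (@squeeze_cvgr _ _ _ _ (fun n => 1 - (1 - s)^-1 * s ^+ n) (fun=> 1)).
  - apply: nearW => n; rewrite p1 andbT.
    have h : -1 <= - x ^+ n by rewrite lerN2.
    apply: le_trans (bernoulli _ h); rewrite mulrN lerD2l lerN2.
    rewrite natrM natrX -mulrA -exprMn -/y -[y]sqr_sqrtr// -/s -exprM mulnC exprM expr2.
    by rewrite mulrA ler_wpM2r ?exprn_ge0// natmulXn_le.
  - rewrite -[X in _ --> X]subr0; apply: cvgB; first exact: cvg_cst.
    rewrite -(mulr0 (1 - s)^-1); apply: cvgM; first exact: cvg_cst.
    by apply: cvg_expr; rewrite ger0_norm.
  - exact: cvg_cst.
apply: (@squeeze_cvgr _ _ _ _ (fun=> 0) (fun n => n.+1%:R^-1)).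
- apply: nearW => n; rewrite p0/=.
  set N := (n * k ^ n)%N.
  have h : n.+1%:R <= (1 + x ^+ n) ^+ N.
    have x1' : -1 <= x ^+ n by rewrite (le_trans _ (xn n))// lerN10.
    apply: le_trans (bernoulli N x1'); rewrite -natr1 addrC lerD2l /N natrM natrX -mulrA -exprMn.
    by rewrite ler_peMr// exprn_ege1// mulrC -ler_pdivrMr// div1r.
  rewrite -div1r ler_pdivlMr//; apply: le_trans (ler_wpM2l (p0 n) h) _.
  by rewrite -exprMn -subr_sqr expr1n exprn_ile1 ?subr_ge0 ?gerBl ?exprn_ile1// exprn_ge0.
- exact: cvg_cst.
- exact: cvg_harmonic.
Qed.

End elementary.

Section density.
Variable R : realType.
Notation circle := (circle R).
Implicit Types (P Q : circle -> R) (A B : set circle) (nu mu : probability circle R).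

Definition real_epoly P := exists (I : finType) (p : I -> int) (a : I -> R[i]),
  forall z, (P z)%:C = epoly p a z.

Lemma real_epoly_cst (c : R) : real_epoly (fun=> c).
Proof.
exists unit, (fun=> 0), (fun=> c%:C) => z.
by rewrite /epoly (big_pred1 tt) ?echar0 ?mulr1//; case.
Qed.

Lemma real_epolyD P Q : real_epoly P -> real_epoly Q -> real_epoly (fun z => P z + Q z).
Proof.
move=> [I [p [a Pe]]] [J [q [b Qe]]].
exists (I + J)%type, (fun k => match k with inl i => p i | inr j => q j end),
  (fun k => match k with inl i => a i | inr j => b j end) => z.
by rewrite rmorphD/= Pe Qe /epoly big_sumType.
Qed.

Lemma real_epolyM P Q : real_epoly P -> real_epoly Q -> real_epoly (fun z => P z * Q z).
Proof.
move=> [I [p [a Pe]]] [J [q [b Qe]]].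
by eexists; eexists; eexists => z; rewrite rmorphM/= Pe Qe epolyM.
Qed.

Lemma real_epolyN P : real_epoly P -> real_epoly (fun z => - P z).
Proof.
move=> Pe; rewrite (_ : (fun z => _) = (fun z => (-1) * P z)).
  by apply: real_epolyM => //; exact: real_epoly_cst.
by apply/funext => z; rewrite mulN1r.
Qed.

Lemma real_epolyX P n : real_epoly P -> real_epoly (fun z => P z ^+ n).
Proof.
move=> Pe; elim: n => [|n ih]; first exact: real_epoly_cst.
by under eq_fun do rewrite exprS; exact: real_epolyM.
Qed.

Lemma real_epoly_dist (c : R[i]) : real_epoly (fun z => normc (circle_val z - c) ^+ 2).
Proof.
pose a (b : bool) : R[i] := if b then 1 else - c.
exists (bool * bool)%type, (fun k : bool * bool => (k.1 : nat)%:Z - (k.2 : nat)%:Z), (fun k => a k.1 * (a k.2)^*).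
move=> z; rewrite -(normc_epoly_sqr (fun b : bool => (b : nat)%:Z) a) /epoly big_bool/= mul1r.
by rewrite expr1 expr0 mulr1.
Qed.

Lemma real_epoly_measurable P : real_epoly P -> measurable_fun setT P.
Proof.
move=> [I [p [a Pe]]]; have [mr _] := cmeasurable_epoly p a.
by rewrite (_ : P = Re \o epoly p a)//; apply/funext => z /=; rewrite -Pe.
Qed.

Lemma Rintegral_bounded_cvg nu (f_ : nat -> circle -> R) (f : circle -> R) (eps : R) :
  (forall n, measurable_fun setT (f_ n)) -> measurable_fun setT f ->
  (forall n z, `|f_ n z| <= 1) -> (forall z, f_ n z @[n --> \oo] --> f z) -> 0 < eps ->
  \forall n \near \oo, \int[nu]_z `|f_ n z - f z| < eps.
Proof.
move=> mf_ mf f1 ff e0.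
have i1 : nu.-integrable setT (EFin \o cst (1 : R)) by exact: finite_measure_integrable_cst.
have [] := @dominated_convergence _ _ _ nu setT measurableT (fun n z => (f_ n z)%:E)
  (fun z => (f z)%:E) (EFin \o cst 1) _ _ _ i1 _.
- by move=> n; exact/measurable_EFinP.
- exact/measurable_EFinP.
- by apply/nearW => z _; apply: cvg_EFin; [exact: nearW|exact: ff].
- by apply/nearW => z n _ /=; rewrite lee_fin.
move=> _ + _ => /fine_cvgP[_] /cvgr_lt /(_ eps e0).
by apply: filterS => n /=.
Qed.

(** A single polynomial has to serve both measures: equality of their integrals of polynomials then
    transfers to sets. *)
Definition approximable mu nu A := measurable A /\ forall eps : R, 0 < eps ->
  exists P, [/\ real_epoly P, forall z, 0 <= P z <= 1,
    \int[mu]_z `|P z - \1_A z| < eps & \int[nu]_z `|P z - \1_A z| < eps].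

Lemma Rintegral_tri nu (f g h : circle -> R) :
  measurable_fun setT f -> measurable_fun setT g -> measurable_fun setT h ->
  (forall z, `|f z| <= 1) -> (forall z, `|g z| <= 1) -> (forall z, `|h z| <= 1) ->
  (forall z, `|h z| <= `|f z| + `|g z|) ->
  \int[nu]_z `|h z| <= \int[nu]_z `|f z| + \int[nu]_z `|g z|.
Proof.
move=> mf mg mh f1 g1 h1 fgh.
have integ (k : circle -> R) : measurable_fun setT k -> (forall z, `|k z| <= 1) ->
    nu.-integrable setT (EFin \o (fun z => `|k z|)).
  move=> mk k1; apply: (@bounded_integrable _ nu _ 1); first exact: measurableT_comp.
  by move=> z; rewrite normr_id.
rewrite -RintegralD//; [|exact: integ|exact: integ].
apply: le_Rintegral => //; first exact: integ.
by have := integrableD measurableT (integ f mf f1) (integ g mg g1).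
Qed.

Section two_measures.
Variables mu nu : probability circle R.
Local Notation apx := (approximable mu nu).

Let bnd (x : R) A z : 0 <= x <= 1 -> `|x - \1_A z| <= 1.
Proof. by rewrite indicE ler_norml; case: (_ \in _) => /=; lra. Qed.

Let mind A : measurable A -> measurable_fun setT (\1_A : circle -> R).
Proof. by move=> mA; exact: measurable_indic. Qed.

Lemma approximable_cvg A (A_ : nat -> set circle) : measurable A ->
  (forall n, apx (A_ n)) -> (forall z, (\1_(A_ n) z : R) @[n --> \oo] --> (\1_A z : R)) -> apx A.
Proof.
move=> mA apA cA; split => // eps e0; have e20 : 0 < eps / 2 by rewrite divr_gt0.
have i1 n z : `|\1_(A_ n) z : R| <= 1 by rewrite indicE; case: (_ \in _); rewrite ?normr1 ?normr0.
have mA_ n : measurable_fun setT (\1_(A_ n) : circle -> R) by apply: mind; case: (apA n).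
have H1 := Rintegral_bounded_cvg mu mA_ (mind mA) i1 cA e20.
have H2 := Rintegral_bounded_cvg nu mA_ (mind mA) i1 cA e20.
have [n /= [n1 n2]] : exists n, \int[mu]_z `|\1_(A_ n) z - \1_A z| < eps / 2 /\
    \int[nu]_z `|\1_(A_ n) z - \1_A z| < eps / 2.
  by have [n [? ?]] := filter_ex (filterI H1 H2); exists n.
have [_ /(_ _ e20)[P [Pe P01 P1 P2]]] := apA n.
have P1' z : `|P z - \1_(A_ n) z| <= 1 by exact: bnd.
have iA z : `|\1_(A_ n) z - \1_A z : R| <= 1 by apply: bnd; rewrite indicE; case: (_ \in _); rewrite ?ler01 lexx.
have mP : measurable_fun setT (fun z => P z - \1_(A_ n) z).
  by apply: measurable_funB => //; exact: real_epoly_measurable.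
have mAA : measurable_fun setT (fun z => \1_(A_ n) z - \1_A z : R).
  by apply: measurable_funB => //; exact: mind.
have mPA : measurable_fun setT (fun z => P z - \1_A z).
  by apply: measurable_funB; [exact: real_epoly_measurable|exact: mind].
have tri z : `|P z - \1_A z| <= `|P z - \1_(A_ n) z| + `|\1_(A_ n) z - \1_A z|.
  by rewrite (le_trans _ (ler_normD _ _))// addrA subrK.
have H la := Rintegral_tri la mP mAA mPA P1' iA (fun z => bnd A z (P01 z)) tri.
by exists P; split => //; rewrite (le_lt_trans (H _))// [ltRHS]splitr ltrD.
Qed.

Lemma approximableC A : apx A -> apx (~` A).
Proof.
move=> [mA apA]; split; first exact: measurableC.
move=> eps /apA[P [Pe P01 P1 P2]]; exists (fun z => 1 - P z).
have E z : `|1 - P z - \1_(~` A) z| = `|P z - \1_A z|.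
  by rewrite !indicE in_setC; case: (_ \in _) => /=; rewrite -normrN; congr (`| _ |); ring.
split.
- by apply: real_epolyD (real_epolyN Pe); exact: real_epoly_cst.
- by move=> z; have := P01 z; lra.
- by under eq_Rintegral do rewrite E.
- by under eq_Rintegral do rewrite E.
Qed.

Lemma approximableI A B : apx A -> apx B -> apx (A `&` B).
Proof.
move=> [mA apA] [mB apB]; split; first exact: measurableI.
move=> eps e0; have e20 : 0 < eps / 2 by rewrite divr_gt0.
have [P [Pe P01 P1 P2]] := apA _ e20; have [Q [Qe Q01 Q1 Q2]] := apB _ e20.
have mA' : measurable_fun setT (fun z => P z - \1_A z).
  by apply: measurable_funB; [exact: real_epoly_measurable|exact: mind].
have mB' : measurable_fun setT (fun z => Q z - \1_B z).
  by apply: measurable_funB; [exact: real_epoly_measurable|exact: mind].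
have PQ01 z : 0 <= P z * Q z <= 1.
  have /andP[p0 p1] := P01 z; have /andP[q0 q1] := Q01 z.
  by rewrite mulr_ge0//= mulr_ile1.
have mI' : measurable_fun setT (fun z => P z * Q z - \1_(A `&` B) z).
  apply: measurable_funB; first by apply: real_epoly_measurable; exact: real_epolyM.
  by apply: mind; exact: measurableI.
have tri z : `|P z * Q z - \1_(A `&` B) z| <= `|P z - \1_A z| + `|Q z - \1_B z|.
  have -> : P z * Q z - \1_(A `&` B) z = (P z - \1_A z) * Q z + \1_A z * (Q z - \1_B z).
    by rewrite !indicE in_setI -mulnb natrM; ring.
  rewrite (le_trans (ler_normD _ _))// !normrM lerD//.
    by rewrite ler_piMr// ler_norml; have := Q01 z; lra.
  by rewrite ler_piMl// indicE; case: (_ \in _); rewrite ?normr1 ?normr0.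
have H la := Rintegral_tri la mA' mB' mI' (fun z => bnd A z (P01 z)) (fun z => bnd B z (Q01 z))
  (fun z => bnd (A `&` B) z (PQ01 z)) tri.
exists (fun z => P z * Q z); split => //; first exact: real_epolyM.
- by rewrite (le_lt_trans (H _))// [ltRHS]splitr ltrD.
- by rewrite (le_lt_trans (H _))// [ltRHS]splitr ltrD.
Qed.

Lemma approximable0 : apx set0.
Proof.
rewrite -setCT; apply: approximableC; split => // eps e0.
exists (fun=> 1); have E z : `|1 - \1_[set: circle] z| = 0 :> R.
  by rewrite indicE in_setT subrr normr0.
split; first exact: real_epoly_cst.
- by move=> z; rewrite ler01 lexx.
- by under eq_Rintegral do rewrite E; rewrite Rintegral_cst// mul0r.
- by under eq_Rintegral do rewrite E; rewrite Rintegral_cst// mul0r.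
Qed.

Lemma approximable_bigcup (A_ : nat -> set circle) :
  (forall n, apx (A_ n)) -> apx (\bigcup_n A_ n).
Proof.
move=> apA; pose U n := \big[setU/set0]_(i < n) A_ i.
have apU n : apx (U n).
  rewrite /U; elim: n => [|n ih]; first by rewrite big_ord0; exact: approximable0.
  rewrite big_ord_recr/= -[X in apx X]setCK setCU; apply: approximableC.
  by apply: approximableI; exact: approximableC.
apply: approximable_cvg apU _ => [|z].
  by apply: bigcup_measurable => k _; case: (apA k).
have [[k _ Akz]|nUz] := pselect ((\bigcup_n A_ n) z).
  apply: (@cvg_near_cst _ _ _ _ _ _) => //.
  near=> n; rewrite !indicE !mem_set//; first by exists k.
  by rewrite /U -bigcup_mkord; exists k => //=; near: n; exact: nbhs_infty_gt.
rewrite indicE memNset//; apply: cvg_near_cst; apply: nearW => n.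
rewrite indicE memNset// => Uz; apply: nUz.
by move: Uz; rewrite /U -bigcup_mkord => -[k _ Akz]; exists k.
Unshelve. all: by end_near.
Qed.

(** The function |z - c|^2 is itself a trigonometric polynomial. Scaled to x with values in [0, 1]
    in such a way that the disk is x < 1 / k, it enters [cvg_threshold], and dominated convergence
    gives the approximation in mean. *)
Lemma approximable_disk (c : R[i]) (rho : R) : 0 < rho ->
  apx [set z | normc (circle_val z - c) < rho].
Proof.
move=> rho0; pose k := (Num.bound `|((1 + normc c) / rho) ^+ 2|).+2.
pose x (z : circle) := k%:R^-1 * (rho^-1) ^+ 2 * normc (circle_val z - c) ^+ 2.
have k0 : (0 : R) < k%:R by [].
have ex : real_epoly x by apply: real_epolyM (real_epoly_dist c); exact: real_epoly_cst.
have x0 z : 0 <= x z by rewrite !mulr_ge0 ?invr_ge0 ?exprn_ge0 ?invr_ge0 ?normc_ge0// ltW.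
have x1 z : x z <= 1.
  rewrite /x -mulrA -exprMn mulrC ler_pdivrMr// mul1r.
  have h : ((1 + normc c) / rho) ^+ 2 <= k%:R.
    rewrite (le_trans (ler_norm _))// ltW// (lt_le_trans (archi_boundP _))// ler_nat.
    by rewrite /k ltnW.
  apply: le_trans h; rewrite ler_sqr ?nnegrE ?mulr_ge0 ?invr_ge0 ?addr_ge0 ?normc_ge0 ?(ltW rho0)//.
  rewrite mulrC ler_wpM2r ?invr_ge0 ?(ltW rho0)//.
  by rewrite (le_trans (le_normcD _ _))// normcN normc_circle.
have xk z : (x z < k%:R^-1) = (normc (circle_val z - c) < rho).
  rewrite /x -mulrA -exprMn gtr_pMr ?invr_gt0// expr_lt1// ?mulr_ge0 ?invr_ge0 ?normc_ge0 ?(ltW rho0)//.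
  by rewrite mulrC ltr_pdivrMr// mul1r.
pose P n z := (1 - x z ^+ n) ^+ (n * k ^ n)%N.
have eP n : real_epoly (P n).
  apply: real_epolyX; apply: real_epolyD; first exact: real_epoly_cst.
  by apply: real_epolyN; exact: real_epolyX.
have P01 n z : 0 <= P n z <= 1.
  have xn1 : x z ^+ n <= 1 by rewrite exprn_ile1.
  by rewrite exprn_ge0 ?subr_ge0//= exprn_ile1 ?subr_ge0// gerBl exprn_ge0.
set D := [set z | _].
have mD : measurable D.
  rewrite (_ : D = setT `&` x @^-1` `]-oo, k%:R^-1[%classic).
    exact: (real_epoly_measurable ex).
  by rewrite setTI; apply/seteqP; split => z /=; rewrite in_itv/= xk.
split => // eps e0.
have Pb n z : `|P n z| <= 1 by rewrite ler_norml; have := P01 n z; lra.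
have cP z : P n z @[n --> \oo] --> (\1_D z : R).
  have -> : \1_D z = (x z < k%:R^-1)%R%:R :> R.
    rewrite xk indicE; case: ltP => h; first by rewrite mem_set.
    by rewrite memNset//= /D/= ltNge h.
  exact: cvg_threshold.
have mP n := real_epoly_measurable (eP n).
have H1 := Rintegral_bounded_cvg mu mP (mind mD) Pb cP e0.
have H2 := Rintegral_bounded_cvg nu mP (mind mD) Pb cP e0.
by have [n [? ?]] := filter_ex (filterI H1 H2); exists (P n); split.
Qed.

(** Approximable sets form a sigma-algebra, and an open set is the union of the countably many disks
    with rational centre and radius 1 / (m + 1) that it contains. *)
Lemma approximable_measurable A : measurable A -> apx A.
Proof.
suff openapx : open `<=` apx.
  apply: (@smallest_sub _ (sigma_algebra setT) open apx) => //.
  split.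
  - by apply: openapx; exact: open0.
  - by move=> B; rewrite setTD; exact: approximableC.
  - by move=> B; exact: approximable_bigcup.
move=> U oU; have [V oV VU] := oU.
pose ctr (d : rat * rat * nat) : R[i] := ratr d.1.1 +i* ratr d.1.2.
pose disk (d : rat * rat * nat) := [set z : circle | normc (circle_val z - ctr d) < d.2.+1%:R^-1].
pose B n := if (choice.unpickle n : option (rat * rat * nat)) is Some d then if `[< disk d `<=` U >] then disk d else set0 else set0.
have aB n : apx (B n).
  have a0 := approximable0.
  rewrite /B; case: (choice.unpickle n) => // d; case: ifP => // _.
  by apply: approximable_disk; rewrite invr_gt0.
rewrite (_ : U = \bigcup_n B n); first exact: approximable_bigcup.
apply/seteqP; split => [z Uz|z [n _]]; last first.
  by rewrite /B; case: (choice.unpickle n) => // d; case: asboolP => // dU; exact: dU.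
have : nbhs (circle_val z : R[i]^o) V by apply: open_nbhs_nbhs; split => //; move: Uz; rewrite -VU.
move=> /(@nbhs_ballP _ R[i]^o)[[e1 e2] /=]; rewrite ltcE/= => /andP[/eqP -> e0] eV.
have {}eV (w : circle) : normc (circle_val w - circle_val z) < e1 -> U w.
  move=> h; rewrite -VU; apply: eV; rewrite /ball/= normC_normc ltcR.
  by rewrite -normcN opprB.
have [m me] : exists m, m.+1%:R^-1 < e1 / 2 :> R.
  have e20 : 0 < e1 / 2 by rewrite divr_gt0.
  exists (Num.bound (e1 / 2)^-1); rewrite invf_plt// ?posrE//.
  by rewrite (lt_le_trans (archi_boundP _)) ?invr_ge0 ?(ltW e20)// ler_nat.
have approx (t : R) : exists q : rat, `|t - ratr q| < m.+1%:R^-1 / 2.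
  have h : t - m.+1%:R^-1 / 2 < t + m.+1%:R^-1 / 2 by rewrite ltrD2l gtrN// divr_gt0.
  have [q] := rat_in_itvoo h; rewrite in_itv/= => /andP[q1 q2]; exists q.
  by rewrite ltr_distlC q1 q2.
have [q1 q1z] := approx (Re (circle_val z)); have [q2 q2z] := approx (Im (circle_val z)).
pose d := (q1, q2, m).
have dz : disk d z.
  rewrite /disk/= (le_lt_trans (normc_le_ReIm _))// [ltRHS]splitr.
  by move: q1z q2z; rewrite /ctr/=; case: (circle_val z) => a b /= h1 h2; rewrite ltrD.
suff dU : disk d `<=` U.
  have Bd : B (choice.pickle d) = disk d by rewrite /B choice.pickleK asboolT.
  by apply: (bigcup_sup (i := choice.pickle d)); [exact: I|rewrite Bd; exact: dz].
move=> w /= wd; apply: eV.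
have -> : circle_val w - circle_val z = (circle_val w - ctr d) - (circle_val z - ctr d) by ring.
rewrite (le_lt_trans (le_normcD _ _))// normcN (lt_trans (ltrD wd dz))//= [ltRHS]splitr.
by rewrite ltrD.
Qed.

Lemma eq_probability : (forall P, real_epoly P -> \int[mu]_z P z = \int[nu]_z P z) ->
  forall A, measurable A -> mu A = nu A.
Proof.
move=> H A mA; have [_ apA] := approximable_measurable mA.
have finm (la : probability circle R) : la A \is a fin_num by exact: fin_num_measure.
rewrite -(fineK (finm mu)) -(fineK (finm nu)); congr EFin; apply/eqP; rewrite -subr_eq0 -normr_le0.
apply/ler_addgt0Pr => eps e0; rewrite add0r.
have e20 : 0 < eps / 2 by rewrite divr_gt0.
have [P [Pe P01 P1 P2]] := apA _ e20.
have mP := real_epoly_measurable Pe; have mi := mind mA.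
have iP (la : probability circle R) : la.-integrable setT (EFin \o P).
  by apply: (@bounded_integrable _ la _ 1) => // z; rewrite ler_norml; have := P01 z; lra.
have iA (la : probability circle R) : la.-integrable setT (EFin \o (\1_A : circle -> R)).
  by apply: (@bounded_integrable _ la _ 1) => // z; rewrite indicE; case: (_ \in _); rewrite ?normr1 ?normr0.
have E (la : probability circle R) : `|\int[la]_z P z - fine (la A)| <= \int[la]_z `|P z - \1_A z|.
  have -> : fine (la A) = \int[la]_z \1_A z by rewrite /Rintegral integral_indic// setIT.
  rewrite -(RintegralB measurableT (iP la) (iA la)); apply: le_normr_Rintegral => //.
  by have := integrableB measurableT (iP la) (iA la).
have := E mu; have := E nu; rewrite (H P Pe) => h1 h2.
rewrite -(subrKA (\int[nu]_z P z)) (le_trans (ler_normD _ _))// [leRHS]splitr lerD//.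
  by rewrite distrC ltW// (le_lt_trans h2).
by rewrite ltW// (le_lt_trans h1).
Qed.

End two_measures.
End density.

(** * Independence of characters *)

Section haar_invariance.
Variable R : realType.
Notation circle := (circle R).
Notation haar := (haar R).

Lemma continuous_echar n : continuous (echar n : circle -> R[i]^o).
Proof.
have pos (m : nat) : continuous (echar m : circle -> R[i]^o).
  elim: m => [|m ih] z; first by rewrite (_ : echar _ = fun=> 1)//; exact: cst_continuous.
  rewrite (_ : echar _ = fun z => circle_val z * echar m z); last first.
    by apply/funext => w; rewrite /echar -exprnP exprS.
  exact: (@cvgM R[i] circle _ _ (@circle_val R) (echar m) _ _ (@continuous_val_circle R z) (ih z)).
case: n => [//|n]; rewrite NegzE.
apply: continuous_complex => z.
  rewrite (_ : (fun _ => _) = fun t => Re (echar n.+1 t)).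
    apply: (@continuous_comp _ _ _ (echar n.+1 : circle -> R[i]^o)); first exact: pos.
    exact: continuous_Re.
  by apply/funext => t; rewrite -echar_conj; case: (echar _ t).
rewrite (_ : (fun _ => _) = fun t => - Im (echar n.+1 t)).
  apply: continuousN; apply: (@continuous_comp _ _ _ (echar n.+1 : circle -> R[i]^o)); first exact: pos.
  exact: continuous_Im.
by apply/funext => t; rewrite -echar_conj; case: (echar _ t).
Qed.

Lemma measurable_circle_map (f : circle -> circle) :
  continuous (fun z => circle_val (f z) : R[i]^o) -> measurable_fun setT f.
Proof.
move=> cf; apply: (measurability (open : set (set circle))) => // _ [_ [V oV <-] <-].
rewrite setTI; apply: sub_sigma_algebra.
by move/continuousP : cf => /(_ V oV).
Qed.

Lemma Rintegral_haar_cst (c : R) : \int[haar]_z c = c.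
Proof.
have h1 : fine (haar setT) = 1 by rewrite (probability_setT haar).
by rewrite Rintegral_cst// h1 mulr1.
Qed.

Lemma fine_haar_itv (A : set circle) : measurable A -> 0 <= fine (haar A) <= 1.
Proof.
move=> mA; rewrite fine_ge0// andTb -[leRHS]/(fine 1%E).
by apply: fine_le; [exact: fin_num_measure|by []|exact: probability_le1].
Qed.

Lemma Rintegral_real_epoly (I : finType) (p : I -> int) (a : I -> R[i]) (P : circle -> R) :
  (forall z, (P z)%:C = epoly p a z) -> (\int[haar]_z P z)%:C = \sum_(i | p i == 0) a i.
Proof.
by move=> Pe; rewrite -cintegral_real -cintegral_epoly; congr cintegral; apply/funext.
Qed.

(** The image of [haar] under f is compared with [haar] on trigonometric polynomials, where only the
    terms of frequency 0 count, and [eq_probability] extends the equality to all measurable sets. *)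
Lemma haar_invariant (f : circle -> circle) : measurable_fun setT f ->
  (forall P, real_epoly P -> real_epoly (P \o f) /\ \int[haar]_z P (f z) = \int[haar]_z P z) ->
  forall A, measurable A -> haar (f @^-1` A) = haar A.
Proof.
move=> mf fP A mA.
pose nu := distribution haar (@mfun_Sub _ _ circle circle f (mem_set mf)).
suff /(_ A mA) : forall A, measurable A -> nu A = haar A by [].
apply: eq_probability => P Pe; have [Pfe <-] := fP P Pe.
rewrite /Rintegral; congr fine; rewrite integral_distribution//.
  by apply/measurable_EFinP; exact: real_epoly_measurable.
have [I [p [a Pfa]]] := Pfe.
apply: (@bounded_integrable _ haar _ (\sum_i normc (a i))).
  exact: (real_epoly_measurable Pfe).
move=> z; have -> : `|P (f z)| = normc ((P (f z))%:C) by rewrite /= expr0n/= addr0 sqrtr_sqr.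
by rewrite [_%:C]Pfa normc_epoly_le.
Qed.

Lemma measurable_circle_pow n : measurable_fun setT (circle_pow n : circle -> circle).
Proof. by apply: measurable_circle_map; exact: continuous_echar. Qed.

Lemma haar_pow n A : n != 0 -> measurable A -> haar (circle_pow n @^-1` A) = haar A.
Proof.
move=> n0; apply: haar_invariant; first exact: measurable_circle_pow.
move=> P [I [p [a Pe]]].
have Pne z : (P (circle_pow n z))%:C = epoly (fun i => n * p i) a z by rewrite Pe epoly_pow.
split; first by exists I, (fun i => n * p i), a.
apply: complexI; rewrite (Rintegral_real_epoly Pe) (Rintegral_real_epoly Pne).
by apply: eq_bigl => i; rewrite mulf_eq0 (negbTE n0).
Qed.

Lemma circle_mul_subproof (w z : circle) : (circle_val w * circle_val z : R[i]^o) \in unit_circle R.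
Proof. by rewrite inE /unit_circle/= normC_normc normcM !normc_circle mulr1. Qed.

Definition circle_mul (w z : circle) : circle := SigSub (circle_mul_subproof w z).

Lemma echar_mul n w z : echar n (circle_mul w z) = echar n w * echar n z.
Proof. by rewrite /echar [circle_val (circle_mul _ _)]/= exprzMl ?unitfE ?circle_val_neq0. Qed.

Lemma haar_mul w A : measurable A -> haar (circle_mul w @^-1` A) = haar A.
Proof.
apply: haar_invariant.
  apply: measurable_circle_map => z.
  exact: (@cvgM R[i] circle _ _ (cst (circle_val w)) (@circle_val R) _ _ (cvg_cst _) (@continuous_val_circle R z)).
move=> P [I [p [a Pe]]].
have Pwe z : (P (circle_mul w z))%:C = epoly p (fun i => a i * echar (p i) w) z.
  by rewrite Pe; apply: eq_bigr => i _; rewrite echar_mul mulrA.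
split; first by exists I, p, (fun i => a i * echar (p i) w).
apply: complexI; rewrite (Rintegral_real_epoly Pe) (Rintegral_real_epoly Pwe).
by apply: eq_bigr => i /eqP ->; rewrite echar0 mulr1.
Qed.

Definition disk (c : R[i]) (rho : R) := [set z : circle | normc (circle_val z - c) < rho].

Lemma measurable_disk c rho : measurable (disk c rho).
Proof.
have [r0|r0] := ltP 0 rho; first by have [] := approximable_disk haar haar c r0.
rewrite (_ : disk c rho = set0)//; apply/seteqP; split => z //=.
by rewrite /disk/= ltNge (le_trans r0)// normc_ge0.
Qed.

(** By continuity at 0, some interval [0, r] is mapped into the disk by [expi], and it already has
    positive length. *)
Lemma disk1_pos rho : 0 < rho -> 0 < fine (haar (disk 1 rho)).
Proof.
move=> rho0.
have e0 : circle_val (expi (0 : R)) = 1 by rewrite /circle_val/= mulr0 cos0 sin0.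
have : continuous (fun t : R => circle_val (expi t) : R[i]^o).
  move=> t; apply: (@continuous_comp _ _ _ (@expi R)); first exact: continuous_expi.
  exact: continuous_val_circle.
have rhoC : 0 < rho%:C :> R[i] by rewrite ltcR.
move=> /(_ 0) /cvgrPdist_lt /(_ _ rhoC) /nbhs_ballP[eta /= eta0 H].
pose r := Num.min (eta / 2) 1.
have r0 : 0 < r by rewrite lt_min ltr01 divr_gt0.
have Hd (t : R) : t \in `[0, r]%classic -> \1_(disk 1 rho) (expi t) = 1 :> R.
  rewrite inE/= in_itv/= => /andP[t0 tr]; rewrite indicE mem_set//.
  have : ball (0 : R) eta t.
    rewrite /ball/= sub0r normrN ger0_norm// (le_lt_trans tr)// gt_min.
    by rewrite ltr_pdivrMr// mulr2n mulrDr mulr1 ltrDl eta0.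
  by move=> /H; rewrite e0 normC_normc ltcR -normcN opprB.
have mD := measurable_disk 1 rho.
change (0 < fine (haar (disk 1 rho))).
rewrite fine_gt0//; apply/andP; split; last by rewrite -ge0_fin_numE//; exact: fin_num_measure.
have -> : haar (disk 1 rho) = (\int[haar]_z (\1_(disk 1 rho) z)%:E)%E by rewrite integral_indic// setIT.
rewrite integral_haar//.
apply: (@lt_le_trans _ _ (\int[@lebesgue_measure R]_(t in `[0%R, r]) (\1_(disk 1 rho) (expi t))%:E)%E).
  rewrite (eq_integral (cst 1%E)) => [|t /Hd ->//].
  by rewrite integral_cst//= mul1e lebesgue_measure_itv/= lte_fin r0 sube0 lte_fin.
apply: ge0_subset_integral => //.
- apply/measurable_EFinP; apply: measurable_funTS.
  by apply: measurableT_comp; [exact: measurable_indic|exact: measurable_expi].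
- by move=> t /=; rewrite !in_itv/= => /andP[-> tr]/=; rewrite (le_trans tr)// ge_min lexx orbT.
Qed.

Lemma Rintegral_haar_pow n (h : circle -> R) : n != 0 -> measurable_fun setT h ->
  (forall z, 0 <= h z) -> \int[haar]_z h (circle_pow n z) = \int[haar]_z h z.
Proof.
move=> n0 mh h0; rewrite /Rintegral; congr fine.
have mp := measurable_circle_pow n.
have := @ge0_integral_pushforward _ _ _ _ R _ mp haar setT (EFin \o h) measurableT.
rewrite preimage_setT /= => <-.
- apply: eq_measure_integral => A mA _; exact: haar_pow.
- exact/measurable_EFinP.
- by move=> z _; rewrite lee_fin.
Qed.

End haar_invariance.

Section independence.
Variable R : realType.
Notation circle := (circle R).
Notation haar := (haar R).

(** Collecting terms over the frequencies from -N to N gives finitely many polynomials one common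
    index type, so that their product expands over functions into it. *)
Lemma epoly_canon (I : finType) (p : I -> int) (a : I -> R[i]) : exists N0, forall N, (N0 <= N)%N ->
  exists c : 'I_(N.*2.+1) -> R[i], forall z, epoly p a z = epoly (fun k : 'I_(N.*2.+1) => (k : nat)%:Z - N%:Z) c z.
Proof.
exists (\max_i absz (p i))%N => N N0N.
exists (fun k => \sum_(i | p i == (k : nat)%:Z - N%:Z) a i) => z.
rewrite /epoly; under [RHS]eq_bigr do rewrite mulr_suml.
rewrite (exchange_big_dep xpredT)//=; apply: eq_bigr => i _.
have piN : (absz (p i) <= N)%N by apply: leq_trans N0N; exact: leq_bigmax.
have kE : (inord (absz (p i + N%:Z)) : 'I_(N.*2.+1))%:Z = p i + N%:Z.
  rewrite inordK; move: (p i) piN => x; lia.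
rewrite (big_pred1 (inord (absz (p i + N%:Z)))) ?kE ?addrK// => k.
apply/eqP/eqP => [e|->]; last by rewrite kE addrK.
by apply: val_inj; apply/eqP; rewrite -eqz_nat kE e subrK.
Qed.

(** The arithmetic side of Weyl's criterion: it excludes frequency 0 from the nonconstant terms of a
    product of polynomials of degree at most N in the characters of the p i. *)
Definition independent_at_infinity (E : set int) := forall n N : nat, exists M : nat,
  forall p : 'I_n -> int, injective p -> (forall i, E (p i)) -> (forall i, (M <= absz (p i))%N) ->
  forall z : 'I_n -> int, (forall i, (absz (z i) <= N)%N) -> \sum_i z i * p i = 0 -> forall i, z i = 0.

Lemma ler_dist_prod (I : finType) (x y : I -> R) :
  (forall i, 0 <= x i <= 1) -> (forall i, 0 <= y i <= 1) ->
  `|\prod_i x i - \prod_i y i| <= \sum_i `|x i - y i|.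
Proof.
move=> x01 y01.
suff : [/\ 0 <= \prod_i x i <= 1, 0 <= \prod_i y i <= 1 &
  `|\prod_i x i - \prod_i y i| <= \sum_i `|x i - y i|] by case.
elim/big_ind3 : _ => [|a b c a' b' c' [a0 b0 abc] [a0' b0' abc']|i _].
- by rewrite subrr normr0 ler01 lexx.
- split.
  + by case/andP: a0 => ? ?; case/andP: a0' => ? ?; rewrite mulr_ge0// mulr_ile1.
  + by case/andP: b0 => ? ?; case/andP: b0' => ? ?; rewrite mulr_ge0// mulr_ile1.
  have -> : c * c' - b * b' = (c - b) * c' + b * (c' - b') by ring.
  case/andP: a0' => c0' c1'; case/andP: b0 => b0 b1.
  rewrite (le_trans (ler_normD _ _))// !normrM lerD//.
    by rewrite (le_trans _ abc)// ler_piMr// ger0_norm.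
  by rewrite (le_trans _ abc')// ler_piMl// ger0_norm.
- by split.
Qed.

Lemma Rintegrable_sum (nu : probability circle R) (I : Type) (r : seq I) (f : I -> circle -> R) :
  (forall i, nu.-integrable setT (EFin \o f i)) ->
  nu.-integrable setT (EFin \o (fun z => \sum_(i <- r) f i z)).
Proof.
move=> fi; elim: r => [|i r ih].
  rewrite (_ : _ \o _ = EFin \o cst (0 : R)); first exact: finite_measure_integrable_cst.
  by apply/funext => z /=; rewrite big_nil.
have := integrableD measurableT (fi i) ih.
by apply: eq_integrable => // z _ /=; rewrite big_cons.
Qed.

Lemma Rintegral_sum (nu : probability circle R) (I : Type) (r : seq I) (f : I -> circle -> R) :
  (forall i, nu.-integrable setT (EFin \o f i)) ->
  \int[nu]_z (\sum_(i <- r) f i z) = \sum_(i <- r) \int[nu]_z f i z.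
Proof.
move=> fi; elim: r => [|i r ih].
  by under eq_Rintegral do rewrite big_nil; rewrite big_nil Rintegral_cst// mul0r.
under eq_Rintegral do rewrite big_cons.
by rewrite big_cons RintegralD ?ih//; exact: Rintegrable_sum.
Qed.

(** Replace each indicator by a polynomial of degree at most N. In the product of the P_i(z^(p_i)) a
    term has frequency sum z_i p_i with |z_i| <= N, so independence leaves only the constant one and
    the integral factors exactly. As z -> z^(p_i) preserves [haar], the error on each factor is that
    of P_i itself. *)
Lemma independent_pseudo_independent E :
  independent_at_infinity E -> pseudo_independent R E.
Proof.
move=> indE n A n0 mA eps eps0.
(* An error n d is spent on the product of indicators and another n d on the product of measures; 2n
   d < eps. *)
pose d := eps / (n + n).+1%:R.
have d0 : 0 < d by rewrite divr_gt0.
have /choice[P HP] : forall i, exists P, [/\ real_epoly P, forall z, 0 <= P z <= 1 &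
    \int[haar]_z `|P z - \1_(A i) z| < d].
  move=> i; have [_ /(_ d d0)[P [? ? ? _]]] := approximable_measurable haar haar (mA i).
  by exists P.
have [N HN] : exists N, forall i, exists c : 'I_(N.*2.+1) -> R[i],
    forall z, (P i z)%:C = epoly (fun k : 'I_(N.*2.+1) => (k : nat)%:Z - N%:Z) c z.
  have /choice[N0 HN0] : forall i, exists N0, forall N, (N0 <= N)%N ->
      exists c : 'I_(N.*2.+1) -> R[i], forall z, (P i z)%:C = epoly (fun k : 'I_(N.*2.+1) => (k : nat)%:Z - N%:Z) c z.
    move=> i; have [[I [p [a Pe]]] _ _] := HP i; have [N0 H] := epoly_canon p a.
    by exists N0 => N /H[c Hc]; exists c => z; rewrite Pe.
  by exists (\max_i N0 i)%N => i; apply: HN0; exact: leq_bigmax.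
have {HN} /choice[c Hc] := HN.
have [M HM] := indE n N.
(* The successor ensures p i <> 0, without which z -> z^(p i) would not preserve [haar]. *)
exists M.+1 => p pinj pE pM.
have p0 i : p i != 0 by have := pM i; case: eqP => // ->.
have {HM} indp := HM p pinj pE (fun i => ltnW (pM i)).
set S := [set z | _].
pose F z := \prod_i P i (circle_pow (p i) z).
pose g i z := `|P i z - \1_(A i) z|.
have mi i : measurable_fun setT (\1_(A i) : circle -> R) by exact: measurable_indic.
have mP i : measurable_fun setT (P i) by have [/real_epoly_measurable] := HP i.
have P01 i z : 0 <= P i z <= 1 by have [_ ] := HP i.
have A01 i z : 0 <= (\1_(A i) z : R) <= 1 by rewrite indicE; case: (_ \in _); rewrite ?lexx ?ler01.
have mpow i := @measurable_circle_pow R (p i).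
have mg i : measurable_fun setT (g i) by apply: measurableT_comp => //; exact: measurable_funB.
have g1 i z : `|g i z| <= 1.
  by rewrite /g normr_id ler_norml; have := P01 i z; have := A01 i z; lra.
have mS : measurable S.
  rewrite (_ : S = \bigcap_(i in setT) (circle_pow (p i) @^-1` A i)); last first.
    by apply/seteqP; split => [z Sz i _|z Sz i]; [exact: Sz|exact: (Sz i I)].
  apply: fin_bigcap_measurable => // i _; rewrite -[X in measurable X]setTI; exact: (mpow i).
have SE z : \1_S z = \prod_i \1_(A i) (circle_pow (p i) z) :> R.
  rewrite indicE; have [Sz|nSz] := pselect (S z).
    by rewrite mem_set// big1// => i _; rewrite indicE mem_set//; exact: Sz.
  rewrite memNset//; have [i nAi] : exists i, ~ A i (circle_pow (p i) z).
    by apply: contrapT => H; apply: nSz => i; apply: contrapT => H'; apply: H; exists i.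
  by rewrite (bigD1 i)//= indicE memNset// mul0r.
have Fe z : (F z)%:C = epoly (fun f : {ffun 'I_n -> 'I_(N.*2.+1)} =>
    \sum_i p i * ((f i : nat)%:Z - N%:Z)) (fun f => \prod_i c i (f i)) z.
  rewrite rmorph_prod/=; under eq_bigr do rewrite Hc epoly_pow /epoly.
  rewrite bigA_distr_bigA; apply: eq_bigr => f _.
  by rewrite big_split/= echar_sum.
have mF : measurable_fun setT F by apply: real_epoly_measurable; do 3 eexists; exact: Fe.
have F01 z : 0 <= F z <= 1.
  rewrite prodr_ile1//= prodr_ge0// => i _.
  by case/andP: (P01 i (circle_pow (p i) z)).
have FS z : `|F z - \1_S z| <= \sum_i g i (circle_pow (p i) z).
  by rewrite SE ler_dist_prod.
have IF : \int[haar]_z F z = \prod_i \int[haar]_z P i z.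
  apply: complexI; rewrite (Rintegral_real_epoly Fe) rmorph_prod/=.
  pose k0 : 'I_(N.*2.+1) := inord N.
  have k0E : (k0 : nat) = N by rewrite inordK// ltnS -addnn leq_addr.
  under [RHS]eq_bigr => i _.
    rewrite (Rintegral_real_epoly (Hc i)) (big_pred1 k0) => [|k]; last first.
      by rewrite subr_eq0 eqz_nat /= -val_eqE /= k0E.
    over.
  rewrite (big_pred1 [ffun=> k0]) => [|f]; first by apply: eq_bigr => i _; rewrite ffunE.
  apply/eqP/eqP => [f0|->]; last first.
    by rewrite big1// => i _; rewrite ffunE k0E subrr mulr0.
  apply/ffunP => i; rewrite ffunE; apply: val_inj; apply/eqP.
  rewrite -eqz_nat /= k0E -subr_eq0; apply/eqP.
  apply: (indp (fun i => (f i : nat)%:Z - N%:Z)).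
    by move=> j; have := ltn_ord (f j); move: (f j : nat) => k; lia.
  by rewrite -[RHS]f0; apply: eq_bigr => j _; rewrite mulrC.
have intb (h : circle -> R) : measurable_fun setT h -> (forall z, `|h z| <= 1) ->
    haar.-integrable setT (EFin \o h).
  by move=> mh h1; exact: (@bounded_integrable _ haar h 1).
have b01 (x : R) : 0 <= x <= 1 -> `|x| <= 1 by rewrite ler_norml; lra.
have indic B : measurable B -> fine (haar B) = \int[haar]_z \1_B z.
  by move=> mB; rewrite /Rintegral integral_indic// setIT.
have S01 z : 0 <= (\1_S z : R) <= 1 by rewrite indicE; case: (_ \in _); rewrite ?lexx ?ler01.
have mSi : measurable_fun setT (\1_S : circle -> R) by exact: measurable_indic.
have IP i : `|\int[haar]_z P i z - fine (haar (A i))| < d.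
  have [_ _] := HP i; apply: le_lt_trans; rewrite indic// -RintegralB//; last 2 first.
  - by apply: intb => // z; exact: b01.
  - by apply: intb => // z; exact: b01.
  apply: le_normr_Rintegral => //; apply: intb; first exact: measurable_funB.
  by move=> z; have := g1 i z; rewrite /g normr_id.
have H1 : `|fine (haar S) - \int[haar]_z F z| <= n%:R * d.
  rewrite indic// -RintegralB//; last 2 first.
  - by apply: intb => // z; exact: b01.
  - by apply: intb => // z; exact: b01.
  have mSF : measurable_fun setT (fun z => \1_S z - F z) by exact: measurable_funB.
  have SF1 z : `|\1_S z - F z| <= 1 by rewrite ler_norml; have := F01 z; have := S01 z; lra.
  apply: le_trans (le_normr_Rintegral _ _) _ => //; first exact: intb.
  have ig i : haar.-integrable setT (EFin \o (fun z => g i (circle_pow (p i) z))).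
    by apply: intb => //; exact: measurableT_comp.
  apply: (@le_trans _ _ (\int[haar]_z \sum_i g i (circle_pow (p i) z))).
    apply: le_Rintegral => //.
    - by apply: intb; [exact: measurableT_comp|move=> z; rewrite normr_id].
    - exact: Rintegrable_sum.
    - by move=> z _; rewrite distrC.
  rewrite Rintegral_sum// mulr_natl -[n in _ *+ n]card_ord -sumr_const; apply: ler_sum => i _.
  rewrite Rintegral_haar_pow//; first by have [_ _ /ltW] := HP i.
  by move=> z; rewrite /g.
have H2 : `|\int[haar]_z F z - \prod_i fine (haar (A i))| <= n%:R * d.
  rewrite IF; apply: le_trans (ler_dist_prod _ _) _.
  - move=> i; rewrite Rintegral_ge0/=; last by move=> z _; case/andP: (P01 i z).
    have -> : 1 = \int[haar]_(z in setT) 1 :> R.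
      by rewrite Rintegral_haar_cst.
    apply: le_Rintegral => //; [by apply: intb => // z; exact: b01| |by move=> z _; case/andP: (P01 i z)].
    by apply: intb => // z; rewrite normr1.
  - by move=> i; exact: fine_haar_itv.
  rewrite mulr_natl -[n in _ *+ n]card_ord -sumr_const; apply: ler_sum => i _.
  exact/ltW/IP.
apply: (@le_lt_trans _ _ (n%:R * d + n%:R * d)).
  by rewrite -(subrKA (\int[haar]_z F z)) (le_trans (ler_normD _ _))// lerD.
rewrite -mulrDl -natrD /d mulrA ltr_pdivrMr// mulrC ltr_pM2l// ltr_nat.
by [].
Qed.

End independence.

(** * Sidon constants *)

Section transfer.
Variables (R : realType) (sigma : R).
Hypothesis sigma_gt1 : 1 < sigma.
Local Notation fl k := (Num.floor (sigma ^+ k)).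

Lemma transcendental_peval : ~ algebraicOver (ratr : rat -> R) sigma ->
  forall P : {poly int}, P != 0 -> peval sigma P != 0.
Proof.
move=> tr P P0; apply/eqP => Ps; apply: tr; exists (map_poly intr P).
  by rewrite map_poly_eq0_id0// intr_eq0 lead_coef_eq0.
apply/eqP; rewrite -map_poly_comp (eq_map_poly (fun x => ratr_int R x)).
by rewrite -pevalE.
Qed.

Lemma floor_powers_index (L : nat) : exists M : nat, forall q : int,
  floor_powers sigma q -> (M <= absz q)%N -> exists2 k, (L <= k)%N & q = fl k.
Proof.
exists (\max_(k < L) absz (fl k)).+1%N => q [k _ <-] Mk; exists k => //.
rewrite leqNgt; apply/negP => kL.
by move: Mk; rewrite ltnNge (leq_bigmax (Ordinal kL)).
Qed.

Lemma floor_powers_independent : ~ algebraicOver (ratr : rat -> R) sigma ->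
  independent_at_infinity (floor_powers sigma).
Proof.
move=> /transcendental_peval tr n N.
have [L HL] := floor_independent sigma_gt1 tr n N.
have [M HM] := floor_powers_index L; exists M => p pinj pE pM z zN z0.
have /choice[k Hk] : forall i, exists k, (L <= k)%N /\ p i = fl k.
  by move=> i; have [k Lk pk] := HM _ (pE i) (pM i); exists k.
apply: (HL k) => //.
- by move=> i j kij; apply: pinj; rewrite !(proj2 (Hk _)) kij.
- by move=> i; have [] := Hk i.
- by rewrite -[RHS]z0; apply: eq_bigr => i _; rewrite (proj2 (Hk i)).
Qed.

Lemma floor_powers_unbounded (M : nat) : exists L, forall k, (L <= k)%N -> (M <= absz (fl k))%N.
Proof.
have [L HL] := pow_unbounded sigma_gt1 M%:R; exists L => k Lk.
have : M%:Z <= fl k.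
  by rewrite floor_ge_int_tmp (le_trans HL)// ler_eXn2l.
by move: (fl k) => x; lia.
Qed.

End transfer.

Section sidon.
Variable R : realType.
Notation circle := (circle R).
Notation haar := (haar R).

Lemma disk_rot (w : circle) rho : fine (haar (disk (circle_val w) rho)) = fine (haar (disk 1 rho)).
Proof.
rewrite -(haar_mul w (measurable_disk (circle_val w) rho)); congr (fine (haar _)).
have e z : normc (circle_val (circle_mul w z) - circle_val w) = normc (circle_val z - 1).
  by rewrite -[normc (circle_val z - 1)]mul1r -(normc_circle w) -normcM mulrBr mulr1.
by apply/seteqP; split => z; rewrite /disk/preimage/mkset e.
Qed.

Lemma supnorm_ge (f : circle -> R[i]) z : ((normc (f z))%:E <= supnorm f)%E.
Proof. by apply: ereal_sup_ubound; exists z. Qed.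

Lemma sidon_constant_le (E : set int) (C : R) : 0 <= C ->
  (forall (I : finType) (p : I -> int) (a : I -> R[i]), (0 < #|I|)%N -> injective p ->
     (forall i, E (p i)) ->
     exists z : circle, \sum_i normc (a i) <= C * normc (epoly p a z)) ->
  (sidon_constant R E <= C%:E)%E.
Proof.
move=> C0 H; apply: ereal_inf_lbound; exists C => // G a GE.
have [G0|G0] := posnP #|{: G}|.
  rewrite big_seq_fsetE/= big1 => [|i _]; last by have := fintype0 i G0.
  rewrite mule_ge0 ?lee_fin//.
  by apply: le_trans (supnorm_ge _ point); rewrite lee_fin normc_ge0.
have [z Hz] := H _ (val : G -> int) (a \o val) G0 val_inj (fun i => GE _ (valP i)).
rewrite big_seq_fsetE trigpolyE; apply: (@le_trans _ _ (C * normc (epoly (val : G -> int) (a \o val) z))%:E).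
  by rewrite lee_fin.
by rewrite EFinM lee_wpmul2l ?lee_fin// supnorm_ge.
Qed.

Lemma grid (delta : R) : 0 < delta -> exists (T : finType) (c : T -> R[i]),
  forall u, normc u <= 1 -> exists t, normc (u - c t) < delta.
Proof.
move=> d0; have d20 : 0 < 2 / delta by rewrite divr_gt0.
pose K := (Num.bound (2 / delta)).+1.
have KR0 : (0 : R) < K%:R by [].
have Kd : 2 / K%:R < delta.
  rewrite ltr_pdivrMr// mulrC -ltr_pdivrMr//.
  by rewrite (lt_trans (archi_boundP (ltW d20)))// ltr_nat.
exists ('I_(K.*2.+1) * 'I_(K.*2.+1))%type.
exists (fun t : 'I_(K.*2.+1) * 'I_(K.*2.+1) => (t.1%:R / K%:R - 1) +i* (t.2%:R / K%:R - 1)) => u u1le.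
have approx (x : R) : `|x| <= 1 -> exists j : 'I_(K.*2.+1), `|x - (j%:R / K%:R - 1)| <= K%:R^-1.
  rewrite ler_norml => /andP[x0 x1].
  have t0 : 0 <= (x + 1) * K%:R by rewrite mulr_ge0//; lra.
  have /andP[j1 j2] := truncn_itv t0.
  have jK : (Num.truncn ((x + 1) * K%:R) < K.*2.+1)%N.
    rewrite ltnS -(ler_nat R) (le_trans j1)// -muln2 natrM mulrC ler_wpM2l//; lra.
  exists (Ordinal jK) => /=.
  rewrite opprB addrA ger0_norm; last by rewrite subr_ge0 ler_pdivrMr.
  by rewrite lerBlDr -[X in _ <= X + _]mul1r -mulrDl ler_pdivlMr// [1 + _%:R]addrC natr1 ltW.
have [j Hj] := approx (Re u) (le_trans (le_Re_normc u) u1le).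
have [l Hl] := approx (Im u) (le_trans (le_Im_normc u) u1le).
exists (j, l); apply: le_lt_trans Kd; rewrite (le_trans (normc_le_ReIm _))//.
have -> : 2 / K%:R = K%:R^-1 + K%:R^-1 :> R by rewrite (mulr_natl _ 2) mulr2n.
by move: Hj Hl; case: (u) => x y /= Hj Hl; rewrite lerD.
Qed.

(** Pseudo-independence supplies a threshold for given sets only. To have one M for all targets u,
    the sets are disks of radius delta / 2 about the points of a finite net of mesh delta / 4, and M
    is the maximum over the finitely many choices. The disk about the net point close to u i
    contains the disk of radius delta / 4 about u i, whose measure is c0 whatever its centre on the
    circle; the product of the measures is thus at least c0^n and the intersection is not empty. *)
Lemma pseudo_independent_dense (E : set int) : pseudo_independent R E ->
  forall (n : nat) (delta : R), (0 < n)%N -> 0 < delta -> exists M : nat,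
  forall (I : finType) (p : I -> int), #|I| = n -> injective p -> (forall i, E (p i)) ->
  (forall i, (M <= absz (p i))%N) ->
  forall u : I -> R[i], (forall i, normc (u i) = 1) ->
  exists z : circle, forall i, normc (echar (p i) z - u i) < delta.
Proof.
move=> psE n delta n0 delta0.
have d40 : 0 < delta / 4 by rewrite divr_gt0.
have [T [c Hc]] := grid d40.
pose c0 := fine (haar (disk 1 (delta / 4))).
have c00 : 0 < c0 by exact: disk1_pos.
pose A (tau : {ffun 'I_n -> T}) i := disk (c (tau i)) (delta / 2).
have c0n : 0 < c0 ^+ n by rewrite exprn_gt0.
have /choice[M0 HM0] : forall tau, exists M : nat,
      forall p : 'I_n -> int, injective p -> (forall i, E (p i)) ->
        (forall i, (M <= `|p i|)%N) ->
        `| fine (haar [set z | forall i, A tau i (circle_pow (p i) z)])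
           - \prod_(i < n) fine (haar (A tau i)) | < c0 ^+ n.
  by move=> tau; apply: psE => // i; exact: measurable_disk.
exists (\max_tau M0 tau)%N => I p In pinj pE pM u u1.
have /choice[t Ht] : forall i : I, exists t, normc (u i - c t) < delta / 4 by move=> i; apply: Hc; rewrite u1.
pose e (i : 'I_n) : I := enum_val (cast_ord (esym In) i).
have einj : injective e by move=> i j /enum_val_inj /cast_ord_inj.
pose tau := [ffun i => t (e i)].
have := HM0 tau (p \o e) (inj_comp pinj einj) (fun i => pE (e i))
  (fun i => leq_trans (leq_bigmax tau) (pM (e i))).
set S := [set z | _].
have prodA : c0 ^+ n <= \prod_(i < n) fine (haar (A tau i)).
  rewrite -[n in _ ^+ n]card_ord -prodr_const; apply: ler_prod => i _.
  rewrite (ltW c00) andTb.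
  have uC : (u (e i) : R[i]^o) \in unit_circle R by rewrite inE /unit_circle/= normC_normc u1.
  rewrite /c0 -(disk_rot (SigSub uC)).
  apply: fine_le; do ?by apply: fin_num_measure; exact: measurable_disk.
  apply: le_measure; rewrite ?inE; [exact: measurable_disk|exact: measurable_disk|].
  move=> z; rewrite /A /disk/mkset ffunE => h.
  have -> : circle_val z - c (t (e i)) = (circle_val z - u (e i)) + (u (e i) - c (t (e i))) by ring.
  rewrite (le_lt_trans (le_normcD _ _))//.
  have -> : delta / 2 = delta / 4 + delta / 4 by field.
  by rewrite ltrD// Ht.
have [S0|[z Sz] _] : S = set0 \/ S !=set0 by have [->|/set0P] := eqVneq S set0; [left|right].
  rewrite S0 measure0/= sub0r normrN ger0_norm ?ltNge ?prodA//.
  exact: le_trans (ltW c0n) prodA.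
exists z => i.
have := Sz (cast_ord In (enum_rank i)).
rewrite /A ffunE /e /= cast_ordK enum_rankK /disk/mkset => h.
have -> : echar (p i) z - u i = (echar (p i) z - c (t i)) - (u i - c (t i)) by ring.
rewrite (le_lt_trans (le_normcD _ _))// normcN.
have -> : delta = delta / 2 + delta / 4 + delta / 4 by field.
by rewrite -addrA ltrD// (lt_trans (Ht i))// ltrDl.
Qed.

(** Aim the characters at the conjugate phases of the coefficients: up to delta all terms then add
    up, and (1 - delta) sum |a_i| <= |epoly p a z|. *)
Lemma pseudo_independent_sidon (E : set int) (m : nat) (eps : R) : pseudo_independent R E ->
  0 < eps -> exists M : nat, forall E' : set int,
  E' `<=` E -> (forall q, E' q -> (M <= absz q)%N) ->
  (exists f : 'I_m -> int, E' `<=` range f) ->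
  (sidon_constant R E' < (1 + eps)%:E)%E.
Proof.
move=> psE eps0.
pose C := 1 + eps / 2; have C0 : 0 < C by rewrite /C; lra.
(* So 1 - delta = 1 / C, while C = 1 + eps / 2 leaves room for the strict inequality. *)
pose delta := 1 - C^-1.
have delta0 : 0 < delta by rewrite subr_gt0 invf_lt1// /C; lra.
have /choice[M0 HM0] : forall n : nat, exists M : nat, (0 < n)%N ->
  forall (I : finType) (p : I -> int), #|I| = n -> injective p -> (forall i, E (p i)) ->
  (forall i, (M <= absz (p i))%N) ->
  forall u : I -> R[i], (forall i, normc (u i) = 1) ->
  exists z : circle, forall i, normc (echar (p i) z - u i) < delta.
  case=> [|n]; first by exists 0%N.
  by have [M HM] := pseudo_independent_dense psE (ltn0Sn n) delta0; exists M.
(* The polynomials to be tested have at most m frequencies, possibly fewer; every cardinality up to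
   m is provided for. *)
exists (\max_(n < m.+1) M0 n)%N => E' E'E E'M [f E'f].
apply: (@le_lt_trans _ _ C%:E); last by rewrite lte_fin /C; lra.
apply: sidon_constant_le => [|I p a I0 pinj pE']; first exact: ltW.
have /choice[g Hg] : forall i : I, exists j, f j = p i.
  by move=> i; have [j _ fj] := E'f _ (pE' i); exists j.
have ginj : injective g by move=> i j gij; apply: pinj; rewrite -!Hg gij.
have Im : (#|I| < m.+1)%N by rewrite ltnS -[m]card_ord; exact: leq_card ginj.
pose u i : R[i] := if normc (a i) == 0 then 1 else (a i)^* * ((normc (a i))^-1)%:C.
have u1 i : normc (u i) = 1.
  rewrite /u; case: eqP => [_|/eqP n0]; first exact: normc1.
  rewrite normcM normc_conj [X in _ * X]/= expr0n/= addr0 sqrtr_sqr.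
  by rewrite ger0_norm ?invr_ge0 ?normc_ge0// divff.
have au i : a i * u i = (normc (a i))%:C.
  rewrite /u; case: eqP => [n0|/eqP n0]; first by rewrite mulr1 n0 (eq0_normc n0).
  by rewrite mulrA mulC_conj -rmorphM/= expr2 mulfK.
have [z Hz] := HM0 _ I0 I p erefl pinj (fun i => E'E _ (pE' i))
  (fun i => leq_trans (leq_bigmax (Ordinal Im)) (E'M _ (pE' i))) u u1.
exists z; set S := \sum_i _; set F := epoly p a z.
have S0 : 0 <= S by apply: sumr_ge0 => i _; exact: normc_ge0.
have h : S + 0 <= normc F + S * delta.
  have -> : S + 0 = normc (\sum_i a i * u i).
    rewrite addr0; under eq_bigr do rewrite au; rewrite -rmorph_sum/= -/S expr0n/= addr0 sqrtr_sqr.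
    by rewrite ger0_norm.
  have -> : \sum_i a i * u i = F - \sum_i a i * (echar (p i) z - u i).
    by rewrite /F /epoly -sumrB; apply: eq_bigr => i _; ring.
  rewrite (le_trans (le_normcD _ _))// normcN lerD2l.
  rewrite (le_trans (normc_sum _ _ _))// mulr_suml; apply: ler_sum => i _.
  by rewrite normcM ler_wpM2l ?normc_ge0// ltW.
rewrite mulrC -ler_pdivrMr//.
have : S / C = S - S * delta by rewrite /delta; ring.
by move=> ->; lra.
Qed.

End sidon.

(** * Relations between two blocks of frequencies *)

Section signed_parts.

Definition zpos (x : int) : nat := if x < 0 then 0%N else absz x.
Definition zneg (x : int) : nat := if x < 0 then absz x else 0%N.

Lemma zposBneg x : (zpos x)%:Z - (zneg x)%:Z = x.
Proof. by rewrite /zpos /zneg; case: ifP => h; lia. Qed.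

Lemma zposDneg x : (zpos x + zneg x)%N = absz x.
Proof. by rewrite /zpos /zneg; case: ifP => h; lia. Qed.

Lemma mulrnB_int (x : int) (m m' : nat) : x *+ m - x *+ m' = x * (m%:Z - m'%:Z).
Proof. by rewrite mulrBr -(mulr_natr x m) -(mulr_natr x m') (natz m) (natz m'). Qed.

Section blocks.
Variables (d : nat) (P : 'I_d -> int) (k k' : nat).
Local Notation I := (bool * 'I_d)%type.

Definition block_index (t : I) : nat := ((if t.1 then k' else k) + t.2)%N.
(** In the relation sum P_i fl(k + i) = sum P_i fl(k' + i), negative terms change sides. [block_exp]
    and [block_exp'] are the resulting multiplicities, both of total sum |P_i|; the boolean is true
    on the block of k'. *)
Definition block_exp (t : I) : nat := if t.1 then zneg (P t.2) else zpos (P t.2).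
Definition block_exp' (t : I) : nat := if t.1 then zpos (P t.2) else zneg (P t.2).

Lemma sum_block (A : nmodType) (F : I -> A) :
  \sum_t F t = \sum_i F (true, i) + \sum_i F (false, i).
Proof.
rewrite (eq_bigr (fun t => F (t.1, t.2))) => [|[]//].
by rewrite -(pair_bigA _ (fun b i => F (b, i)))/= big_bool.
Qed.

Lemma prod_block (A : comNzRingType) (F : I -> A) :
  \prod_t F t = \prod_i F (true, i) * \prod_i F (false, i).
Proof.
rewrite (eq_bigr (fun t => F (t.1, t.2))) => [|[]//].
by rewrite -(pair_bigA _ (fun b i => F (b, i)))/= big_bool.
Qed.

Lemma sum_block_exp : (\sum_t block_exp t)%N = (\sum_i absz (P i))%N.
Proof.
rewrite (sum_block block_exp) -big_split/=; apply: eq_bigr => i _.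
by rewrite /block_exp/= -[LHS]/(zneg _ + zpos _)%N addnC zposDneg.
Qed.

Lemma sum_block_exp' : (\sum_t block_exp' t)%N = (\sum_i absz (P i))%N.
Proof.
rewrite (sum_block block_exp') -big_split/=; apply: eq_bigr => i _.
by rewrite /block_exp'/= -[LHS]/(zpos _ + zneg _)%N zposDneg.
Qed.

Lemma block_index_inj : (k + d <= k')%N -> injective block_index.
Proof.
clear P; move=> kk' [[] i] [[] j]; rewrite /block_index/= => e; have := ltn_ord i; have := ltn_ord j;
  try lia; move=> _ _; congr (_, _); apply: val_inj; by move: e => /eqP; rewrite eqn_add2l => /eqP.
Qed.

End blocks.

End signed_parts.

Section algebraic_relations.
Variables (R : realType) (sigma : R).
Hypothesis sigma_gt1 : 1 < sigma.
Local Notation fl k := (Num.floor (sigma ^+ k)).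

Lemma algebraic_recurrence : algebraicOver (ratr : rat -> R) sigma ->
  exists (d : nat) (P : 'I_d -> int) (c : int), [/\ \sum_i P i != 0, exists i, odd (absz (P i)) &
    forall L, exists2 k, (L <= k)%N & \sum_i P i * fl (k + i) = c].
Proof.
move=> /(algebraic_int_poly sigma_gt1)[P [Ps P1 [i iodd]]].
have [c Hc] := floor_comb_recurrent sigma_gt1 Ps.
exists (size P), (fun i => P`_i), c; split => //.
- by move: P1; rewrite horner_coef; under eq_bigr do rewrite expr1n mulr1.
- have iP : (i < size P)%N by rewrite ltnNge; apply/negP => /(nth_default 0) h; rewrite h in iodd.
  by exists (Ordinal iP).
Qed.

Lemma block_relation (d : nat) (P : 'I_d -> int) (k k' : nat) :
  \sum_i P i * fl (k + i) = \sum_i P i * fl (k' + i) ->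
  \sum_t fl (block_index k k' t) *+ block_exp P t = \sum_t fl (block_index k k' t) *+ block_exp' P t.
Proof.
move=> PE.
apply/eqP; rewrite -subr_eq0 -sumrB.
under eq_bigr do rewrite mulrnB_int.
rewrite sum_block /block_index/block_exp/block_exp'/=.
under eq_bigr do rewrite -opprB zposBneg mulrN.
under [X in _ + X]eq_bigr do rewrite zposBneg.
rewrite sumrN addrC subr_eq0; apply/eqP.
by under eq_bigr do rewrite mulrC; rewrite PE; apply: eq_bigr => i _; rewrite mulrC.
Qed.

Lemma sign_exponent (x : int) : odd (absz x) ->
  (-1) ^+ zpos x = - (-1) ^+ zneg x :> R[i].
Proof.
rewrite /zpos /zneg => ox; rewrite -signr_odd -[X in _ = - X]signr_odd.
by case: ifP => _; rewrite ox /= ?expr0 ?expr1 ?opprK.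
Qed.

(** Of the exponents [zpos] and [zneg] of an odd coefficient one is 0 and the other is odd, so a
    single -1 at this index changes exactly one side. *)
Lemma prod_sign_block (d : nat) (P : 'I_d -> int) i0 : odd (absz (P i0)) ->
  let s (t : bool * 'I_d) : R[i] := if t == (false, i0) then -1 else 1 in
  \prod_t s t ^+ block_exp P t = - \prod_t s t ^+ block_exp' P t.
Proof.
move=> oi s; rewrite (bigD1 (false, i0))//= [in RHS](bigD1 (false, i0))//=.
rewrite !big1 => [|t /negbTE ti|t /negbTE ti]; rewrite ?/s ?ti ?expr1n//.
by rewrite eqxx !mulr1; exact: sign_exponent.
Qed.

End algebraic_relations.

Section gap.
Variable R : realType.
Notation circle := (circle R).

Lemma parallelogram (x y : R[i]) : normc x = 1 -> normc y = 1 ->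
  normc (x - y) ^+ 2 = 4 - normc (x + y) ^+ 2.
Proof.
case: x y => a b [c e] /(congr1 (fun t => t ^+ 2)) /= + /(congr1 (fun t => t ^+ 2)) /=.
rewrite !sqr_sqrtr ?addr_ge0 ?sqr_ge0//; rewrite !expr2; lra.
Qed.

Lemma normc_prodB_le (N : nat) (x y : 'I_N -> R[i]) (eta : R) :
  (forall j, normc (x j) = 1) -> (forall j, normc (y j) = 1) ->
  (forall j, normc (x j - y j) <= eta) ->
  normc (\prod_j x j - \prod_j y j) <= N%:R * eta.
Proof.
elim: N x y => [|N ih] x y x1 y1 xy; first by rewrite !big_ord0 subrr normc0 mul0r.
rewrite !big_ord_recr/=; set X := \prod_(j < N) _; set Y := \prod_(j < N) _.
have -> : X * x ord_max - Y * y ord_max = (X - Y) * x ord_max + Y * (x ord_max - y ord_max) by ring.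
have Y1 : normc Y = 1 by rewrite normc_prod big1.
rewrite (le_trans (le_normcD _ _))// !normcM x1 Y1 mul1r mulr1 -natr1 mulrDl mul1r lerD//.
exact: ih.
Qed.

(** If the sum came closer than kappa to its maximal modulus, the parallelogram identity would give
    |x i - x j|^2 <= 4 kappa = 1 / N^2 for all i and j. Products of N of these numbers would then
    differ by at most 1, whereas opposite unimodular numbers differ by 2. *)
Lemma normc_sum_gap (I : finType) (x : I -> R[i]) (N : nat) (u v : 'I_N -> I) : (0 < N)%N ->
  (forall i, normc (x i) = 1) -> \prod_j x (u j) = - \prod_j x (v j) ->
  normc (\sum_i x i) <= #|I|%:R - (4 * N%:R ^+ 2)^-1.
Proof.
move=> N0 x1 xuv; rewrite leNgt; apply/negP => H.
set kappa := _^-1 in H.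
have NR0 : (0 : R) < N%:R by rewrite ltr0n.
have k0 : 0 < kappa by rewrite invr_gt0 mulr_gt0// exprn_gt0.
have close i j : normc (x i - x j) <= N%:R^-1.
  have [<-|ij] := eqVneq i j; first by rewrite subrr normc0 invr_ge0 ltW.
  have big2 : 2 - kappa <= normc (x i + x j).
    have : normc (\sum_i x i) <= normc (x i + x j) + (#|I|%:R - 2).
      rewrite (bigD1 i)//= (bigD1 j) ?(eq_sym j)//= addrA (le_trans (le_normcD _ _))// lerD2l.
      rewrite (le_trans (normc_sum _ _ _))//; under eq_bigr do rewrite x1.
      have : \sum_(t : I) 1 = #|I|%:R :> R by rewrite sumr_const.
      by rewrite (bigD1 i)//= (bigD1 j) ?(eq_sym j)//=; lra.
    lra.
  have n0 := normc_ge0 (x i - x j).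
  rewrite -(@ler_pXn2r _ 2) ?nnegrE ?invr_ge0 ?(ltW NR0)//.
  rewrite parallelogram// exprVn.
  have -> : (N%:R ^+ 2)^-1 = 4 * kappa by rewrite /kappa; field; rewrite gt_eqF.
  have [k2|k2] := leP kappa 2; last by have := normc_ge0 (x i + x j); nra.
  have : (2 - kappa) ^+ 2 <= normc (x i + x j) ^+ 2.
    by rewrite ler_pXn2r// nnegrE ?subr_ge0// (le_trans _ big2)// subr_ge0.
  rewrite expr2; nra.
have := @normc_prodB_le N (x \o u) (x \o v) N%:R^-1 (fun j => x1 _) (fun j => x1 _) (fun j => close _ _).
rewrite /= xuv -opprD normcN -mulr2n mulfV ?gt_eqF// -mulr_natl normcM.
have -> : normc (\prod_j x (v j)) = 1 by rewrite normc_prod big1.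
have -> : normc (2 : R[i]) = 2 by apply: complexI; rewrite -normC_normc normr_nat rmorph_nat.
lra.
Qed.

End gap.

Lemma echarX (R : realType) n k (z : circle R) : echar n z ^+ k = echar (n *+ k) z.
Proof. by rewrite -mulr_natr natz /echar exprnP exprz_exp. Qed.

Section transport.
Variables (R : realType) (I : finType) (p : I -> int).
Hypothesis pinj : injective p.

Definition image_fset : {fset int} := [fset q in [seq p i | i <- enum I]]%fset.

Lemma in_image_fset q : (q \in image_fset) = (q \in [seq p i | i <- enum I]).
Proof. by rewrite in_fset. Qed.

Lemma image_fsetP q : q \in image_fset -> exists i, p i = q.
Proof. by rewrite in_image_fset => /mapP[i _ ->]; exists i. Qed.

Lemma sum_image_fset (A : nmodType) (F : int -> A) : \sum_(q <- image_fset) F q = \sum_i F (p i).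
Proof.
rewrite (perm_big [seq p i | i <- enum I]) /=; first by rewrite big_map big_enum.
apply: uniq_perm => [||q]; first exact: fset_uniq.
  by rewrite map_inj_uniq// enum_uniq.
exact: in_image_fset.
Qed.

Lemma trigpoly_image (a : int -> R[i]) : trigpoly image_fset a = epoly p (a \o p).
Proof. by apply/funext => z; rewrite /trigpoly sum_image_fset. Qed.

Definition lift_coef (A : Type) (a0 : A) (a : I -> A) (q : int) : A :=
  if [pick i | p i == q] is Some i then a i else a0.

Lemma lift_coefE (A : Type) (a0 : A) (a : I -> A) i : lift_coef a0 a (p i) = a i.
Proof.
rewrite /lift_coef; case: pickP => [j /eqP/pinj ->//|/(_ i)].
by rewrite eqxx.
Qed.

End transport.

Section converse_sidon.
Variables (R : realType) (sigma : R).
Hypothesis sigma_gt1 : 1 < sigma.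
Local Notation fl k := (Num.floor (sigma ^+ k)).

(** Take coefficients 1, with a single -1, on two related blocks. At every z the terms satisfy the
    hypotheses of [normc_sum_gap], so the sup norm is at most m - kappa while the moduli add up to
    m. Here kappa depends on P only, so the gap persists however far the blocks are. *)
Lemma sidon_transcendental :
  (forall (eps : R) (m : nat), 0 < eps -> (1 <= m)%N ->
         exists l : nat, forall k : 'I_m -> nat, (forall i, (l <= k i)%N) ->
           (sidon_constant R (range (fun i => Num.floor (sigma ^+ k i)))
              < (1 + eps)%:E)%E) ->
  ~ algebraicOver (ratr : rat -> R) sigma.
Proof.
move=> H /(algebraic_recurrence sigma_gt1)[d [P [c [P1 [i0 oi0] Hc]]]].
pose I := (bool * 'I_d)%type.
pose N := (\sum_i absz (P i))%N.
have N0 : (0 < N)%N by rewrite /N (bigD1 i0)//= ltn_addr//; case: (absz _) oi0.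
pose m := #|{: I}|.
have m0 : (0 < m)%N by apply/card_gt0P; exists (true, i0).
pose kappa : R := (4 * N%:R ^+ 2)^-1.
have NR0 : (0 : R) < N%:R by rewrite ltr0n.
have k0 : 0 < kappa by rewrite invr_gt0 mulr_gt0// exprn_gt0.
have mR : (0 : R) < m%:R by rewrite ltr0n.
(* This eps contradicts the gap because (1 + kappa / m) (m - kappa) < m. *)
have [l Hl] := H (kappa / m%:R) m (divr_gt0 k0 mR) m0.
have [K0 HK0] := floor_powers_inj sigma_gt1.
have [k kL Pk] := Hc (maxn l K0); have [k' kL' Pk'] := Hc (k + d)%N.
have kl : (l <= k)%N by rewrite (leq_trans _ kL)// leq_maxl.
have kK : (K0 <= k)%N by rewrite (leq_trans _ kL)// leq_maxr.
pose idx (t : I) := block_index k k' t.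
have idxk t : (k <= idx t)%N.
  rewrite /idx /block_index; case: t => [[] i]/=; rewrite ?leq_addr//.
  by rewrite (leq_trans _ (leq_addr _ _))// (leq_trans _ kL')// leq_addr.
pose p (t : I) := fl (idx t).
have pinj : injective p.
  move=> s t e; apply: (block_index_inj kL').
  by apply: HK0 e; exact: leq_trans kK (idxk _).
have /ereal_inf_lt[_ [C HC <-] C1] := Hl (fun j => idx (enum_val j)) (fun j => leq_trans kl (idxk _)).
rewrite lte_fin in C1.
pose a q : R[i] := if q == p (false, i0) then -1 else 1.
have a1 q : normc (a q) = 1 by rewrite /a; case: ifP; rewrite ?normcN normc1.
have HE : [set` image_fset p] `<=` range (fun j : 'I_m => fl (idx (enum_val j))).
  move=> q /= /image_fsetP[t <-]; exists (enum_rank t) => //.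
  by rewrite enum_rankK.
have {}HC := HC (image_fset p) a HE.
have sup : (supnorm (trigpoly (image_fset p) a) <= (m%:R - kappa)%:E)%E.
  apply: ge_ereal_sup => _ [z _ <-]; rewrite lee_fin trigpoly_image//.
  have [u um] := exists_mult (sum_block_exp P).
  have [v vm] := exists_mult (sum_block_exp' P).
  apply: (normc_sum_gap (u := u) (v := v)) => //.
    by move=> t; rewrite normcM a1 normc_echar mulr1.
  rewrite !(prod_mult (fun t => (a \o p) t * echar (p t) z)).
  under eq_bigr do rewrite um exprMn echarX.
  under [in RHS]eq_bigr do rewrite vm exprMn echarX.
  rewrite !big_split/= -!echar_sum (block_relation (etrans Pk (esym Pk'))) -mulNr.
  have ap t : a (p t) = if t == (false, i0) then -1 else 1 by rewrite /a (inj_eq pinj).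
  congr (_ * _); under eq_bigr do rewrite ap; under [in RHS]eq_bigr do rewrite ap.
  exact: prod_sign_block.
have sup0 : (0 <= supnorm (trigpoly (image_fset p) a))%E.
  by apply: le_trans (supnorm_ge _ point); rewrite lee_fin normc_ge0.
have sumE : \sum_(q <- image_fset p) normc (a q) = m%:R.
  by rewrite sum_image_fset// (eq_bigr (fun=> 1)) ?sumr_const// => t _.
rewrite {}sumE in HC.
(* The infimum defining the Sidon constant runs over real C of any sign, so a negative C is excluded
   first. *)
have [C0|C0] := ltP C 0.
  have : (m%:R%:E <= 0 :> \bar R)%E.
    by apply: le_trans HC _; rewrite mule_le0_ge0// lee_fin ltW.
  by rewrite lee_fin leNgt mR.
have : (m%:R%:E <= (C * (m%:R - kappa))%:E)%E.
  by apply: le_trans HC _; rewrite EFinM lee_wpmul2l// lee_fin.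
rewrite lee_fin leNgt => /negP; apply.
have mk : 0 <= m%:R - kappa by rewrite -lee_fin (le_trans sup0).
apply: (@le_lt_trans _ _ ((1 + kappa / m%:R) * (m%:R - kappa))).
  by rewrite ler_wpM2r// ltW.
have -> : (1 + kappa / m%:R) * (m%:R - kappa) = m%:R - kappa ^+ 2 / m%:R.
  by field; rewrite gt_eqF.
by rewrite gtrBl divr_gt0// exprn_gt0.
Qed.

End converse_sidon.

(** * Unconditional basic sequences *)

Section even_norms.
Variables (R : realType) (n : nat).
Hypothesis n_gt0 : (0 < n)%N.
Notation circle := (circle R).
Implicit Types f g : circle -> R[i].
Local Notation N := (cLnorm R (n + n)%:R).

Definition tame f := cmeasurable f /\ (N f < +oo)%E.

Lemma tame_epoly (I : finType) (p : I -> int) (a : I -> R[i]) : tame (epoly p a).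
Proof.
split; first exact: cmeasurable_epoly.
exact: cLnorm_bounded_fin (cmeasurable_epoly _ _) (normc_epoly_le p a).
Qed.

Lemma tame_fineK f : tame f -> (fine (N f))%:E = N f.
Proof. by move=> [mf Nf]; rewrite fineK// ge0_fin_numE// cLnorm_ge0. Qed.

Lemma fine_cLnorm_ge0 f : 0 <= fine (N f).
Proof. by rewrite fine_ge0// cLnorm_ge0. Qed.

Lemma cLnorm_le_moment f g (c : R) : 0 <= c -> tame f -> tame g ->
  (N f <= c%:E * N g)%E = (moment n f <= c ^+ (n + n) * moment n g).
Proof.
move=> c0 tf tg.
rewrite -(tame_fineK tf) -(tame_fineK tg) -EFinM lee_fin.
rewrite -(cLnorm_moment n_gt0 tf.1 tf.2) -(cLnorm_moment n_gt0 tg.1 tg.2) -exprMn.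
by rewrite ler_pXn2r ?addn_gt0 ?n_gt0// nnegrE ?mulr_ge0 ?fine_cLnorm_ge0.
Qed.

Lemma moment_epoly_le (I : finType) (p : I -> int) (a : I -> R[i]) :
  moment n (epoly p a) <= (\sum_i normc (a i)) ^+ (n + n).
Proof.
rewrite /moment -(Rintegral_haar_cst ((\sum_i normc (a i)) ^+ (n + n))).
have S0 : 0 <= \sum_i normc (a i) by apply: sumr_ge0 => i _; exact: normc_ge0.
have h z : 0 <= normc (epoly p a z) ^+ (n + n) <= (\sum_i normc (a i)) ^+ (n + n).
  by rewrite exprn_ge0 ?normc_ge0//= ler_pXn2r ?addn_gt0 ?n_gt0 ?nnegrE ?normc_ge0 ?normc_epoly_le.
apply: le_Rintegral => //.
- apply: (@bounded_integrable _ (haar R) _ ((\sum_i normc (a i)) ^+ (n + n))).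
    by apply: measurable_funX; exact: measurable_normc (cmeasurable_epoly _ _).
  by move=> z; have /andP[h1 h2] := h z; rewrite ger0_norm.
- exact: finite_measure_integrable_cst.
- by move=> z _; have /andP[] := h z.
Qed.

End even_norms.

Section counting_products.
Variable n : nat.
Implicit Types x y : 'I_n -> nat.

Lemma prod_high (A : comNzRingType) (s : nat -> A) (c : A) (L : nat) x :
  (forall j, (L <= x j)%N \/ s (x j) = c) ->
  \prod_j s (x j) = (\prod_(k <- [seq x j | j <- enum 'I_n] | (L <= k)%N) s k) *
    c ^+ (n - count (leq L) [seq x j | j <- enum 'I_n]).
Proof.
move=> xs; set X := [seq x j | j <- enum 'I_n].
have sX : size X = n by rewrite size_map size_enum_ord.
transitivity (\prod_(k <- X) s k); first by rewrite big_map big_enum.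
rewrite (bigID (leq L))/=; congr (_ * _).
rewrite -sX -(count_predC (leq L)) addKn.
have : all (fun k => (L <= k)%N || (s k == c)) X.
  by apply/allP => k /mapP[j _ ->]; case: (xs j) => [->//|->]; rewrite eqxx orbT.
elim: (X) => [|k r ih]; first by rewrite big_nil expr0.
rewrite big_cons /= => /andP[kc /ih ->].
by case: (leqP L k) kc => //= _ /eqP ->; rewrite exprS.
Qed.

(** The indices at least L form the same multiset on both sides; hence equally many indices remain,
    and each of them contributes c. *)
Lemma eq_prod_high (A : comNzRingType) (s : nat -> A) (c : A) (L : nat) x y :
  (forall k, (L <= k)%N -> #|[pred j | x j == k]| = #|[pred j | y j == k]|) ->
  (forall j, (L <= x j)%N \/ s (x j) = c) -> (forall j, (L <= y j)%N \/ s (y j) = c) ->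
  \prod_j s (x j) = \prod_j s (y j).
Proof.
move=> xy xs ys; rewrite (prod_high xs) (prod_high ys).
set X := [seq x j | j <- _]; set Y := [seq y j | j <- _].
have cnt (z : 'I_n -> nat) (k : nat) : count_mem k [seq z j | j <- enum 'I_n] = #|[pred j | z j == k]|.
  by rewrite count_map -sum1_count big_enum_cond sum1_card; apply: eq_card.
have e : perm_eq [seq k <- X | (L <= k)%N] [seq k <- Y | (L <= k)%N].
  apply/allP => k _ /=; rewrite !count_filter; apply/eqP.
  have [Lk|kL] := leqP L k.
    rewrite !(@eq_count _ (predI _ _) (pred1 k)) ?cnt ?xy// => t /=.
      by case: eqP => [->|//]; rewrite Lk.
    by case: eqP => [->|//]; rewrite Lk.
  rewrite !(@eq_count _ (predI _ _) pred0) ?count_pred0// => t /=.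
    by case: eqP => [->|//]; rewrite leqNgt kL.
  by case: eqP => [->|//]; rewrite leqNgt kL.
rewrite -!size_filter (perm_size e); congr (_ * _).
by rewrite -!(big_filter _ (leq L)); apply: perm_big.
Qed.

End counting_products.

Section transcendental_umbs.
Variables (R : realType) (sigma : R).
Hypothesis sigma_gt1 : 1 < sigma.
Hypothesis sigma_trans : ~ algebraicOver (ratr : rat -> R) sigma.
Local Notation fl k := (Num.floor (sigma ^+ k)).

Lemma resonance_prod n l : exists2 L, (l <= L)%N & forall x y : 'I_n -> nat,
  (forall j, (x j < l)%N || (L <= x j)%N) -> (forall j, (y j < l)%N || (L <= y j)%N) ->
  \sum_j fl (x j) = \sum_j fl (y j) ->
  forall (s : nat -> R[i]) c, (forall k, (k < l)%N -> s k = c) ->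
  \prod_j s (x j) = \prod_j s (y j).
Proof.
have [L lL HL] := floor_resonance sigma_gt1 (transcendental_peval sigma_trans) n l.
exists L => // x y xl yl xy s c sc; apply: (@eq_prod_high _ _ _ c L).
- exact: HL xl yl xy.
- by move=> j; have /orP[/sc|] := xl j; [right|left].
- by move=> j; have /orP[/sc|] := yl j; [right|left].
Qed.

(** With l = 0 in [resonance_prod] there are no low indices: among exponents at least L every
    resonance is a permutation, so every unimodular change of the coefficients is an isometry, and
    the factor 1 + eps enters only through 1 <= 1 + eps. *)
Lemma transcendental_complex_umbs (n : nat) : (0 < n)%N ->
  complex_umbs (cLnorm R (n + n)%:R) (floor_powers sigma).
Proof.
move=> n0 eps eps0; have [L _ HL] := resonance_prod n 0.
exists (image_fset (fun k : 'I_L => fl k)) => G a s GE Gs.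
have /choice[kap Hk] : forall q : G, exists k, (L <= k)%N /\ val q = fl k.
  move=> q; have [[k _ kq] qF] := GE _ (valP q); exists k; split => //.
  rewrite leqNgt; apply/negP => kL; apply: qF => /=.
  rewrite in_image_fset; apply/mapP; exists (Ordinal kL); rewrite ?mem_enum//.
rewrite !trigpolyE.
have tf (b : int -> R[i]) : tame n (epoly (val : G -> int) (b \o val)) by exact: tame_epoly.
rewrite cLnorm_le_moment//; last by rewrite addr_ge0// ltW.
have -> : moment n (epoly (val : G -> int) ((fun q => s q * a q) \o val)) =
    moment n (epoly (val : G -> int) (a \o val)).
  have := @moment_isometry _ _ (val : G -> int) (a \o val) (s \o val) n; apply => [q|u v uv _ _].
    have := Gs _ (valP q); rewrite /= normC_normc.
    by move=> /(congr1 Re).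
  have eu (w : 'I_n -> G) : \sum_j fl (kap (w j)) = \sum_j val (w j).
    by apply: eq_bigr => j _; rewrite -(proj2 (Hk _)).
  have es (w : 'I_n -> G) : \prod_j s (fl (kap (w j))) = \prod_j s (val (w j)).
    by apply: eq_bigr => j _; rewrite -(proj2 (Hk _)).
  apply: etrans (esym (es u)) _; apply: etrans (es v).
  apply: (HL (fun j => kap (u j)) (fun j => kap (v j)) _ _ _ (fun k => s (fl k)) 1) => //.
  - by move=> j; rewrite (proj1 (Hk _)) orbT.
  - by move=> j; rewrite (proj1 (Hk _)) orbT.
  - by rewrite (eu u) (eu v).
by rewrite ler_peMl ?moment_ge0// exprn_ege1// lerDl ltW.
Qed.

End transcendental_umbs.

Section umbs_transcendental.
Variables (R : realType) (sigma : R).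
Hypothesis sigma_gt1 : 1 < sigma.
Local Notation fl k := (Num.floor (sigma ^+ k)).

Lemma exists_expr_le (delta : R) (m : nat) : 0 < delta ->
  exists2 eps : R, 0 < eps & (1 + eps) ^+ m <= 1 + delta.
Proof.
elim: m delta => [|m ih] delta d0; first by exists 1; rewrite // expr0 lerDl ltW.
have d20 : 0 < delta / 2 by rewrite divr_gt0.
have [e e0 He] := ih _ d20.
have x0 : 0 < delta / (2 + delta) by rewrite divr_gt0// addr_gt0.
exists (Num.min e (delta / (2 + delta))); first by rewrite lt_min e0.
set e' := Num.min _ _; have e'0 : 0 < e' by rewrite lt_min e0.
have e'e : e' <= e by rewrite ge_min lexx.
have e'd : e' <= delta / (2 + delta) by rewrite ge_min lexx orbT.
rewrite exprS; apply: (@le_trans _ _ ((1 + delta / (2 + delta)) * (1 + delta / 2))).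
  apply: ler_pM; [by rewrite addr_ge0// ltW|by rewrite exprn_ge0// addr_ge0// ltW|by rewrite lerD2l|].
  by apply: le_trans He; rewrite lerXn2r ?nnegrE ?addr_ge0 ?(ltW e0) ?(ltW e'0)// lerD2l.
have -> // : (1 + delta / (2 + delta)) * (1 + delta / 2) = 1 + delta.
by field; rewrite gt_eqF// addr_gt0.
Qed.

(** For p = 2n with n = sum |P_i|, the relation between two far blocks is visible in the moment, and
    [moment_flip] finds unimodular coefficients a for which one change of sign moves the moment by
    at least 1. The umbs property, applied to a and to s a, allows only 1 / 2 in either direction,
    since s^2 = 1. *)
Lemma real_umbs_transcendental :
  (forall p : nat, (2 <= p)%N -> ~~ odd p -> real_umbs (cLnorm R p%:R) (floor_powers sigma)) ->
  ~ algebraicOver (ratr : rat -> R) sigma.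
Proof.
move=> H /(algebraic_recurrence sigma_gt1)[d [P [c [P1 [i0 oi0] Hc]]]].
pose I := (bool * 'I_d)%type.
pose n := (\sum_i absz (P i))%N.
have n0 : (0 < n)%N by rewrite /n (bigD1 i0)//= ltn_addr//; case: (absz _) oi0.
pose m := #|{: I}|.
have m0 : (0 < m)%N by apply/card_gt0P; exists (true, i0).
(* B bounds every moment with m unimodular coefficients, so (1 + eps)^(2n) <= 1 + 1 / (2 B) turns
   the factor into an additive 1 / 2. *)
pose B : R := m%:R ^+ (n + n).
have B0 : 0 < B by rewrite exprn_gt0// ltr0n.
have d0 : 0 < (2 * B)^-1 by rewrite invr_gt0 mulr_gt0.
have [eps eps0 Heps] := exists_expr_le (n + n) d0.
have evn : ~~ odd (n + n) by rewrite addnn odd_double.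
have [F HF] := H (n + n)%N (leq_add n0 n0) evn eps eps0.
have [K0 HK0] := floor_powers_inj sigma_gt1.
have [L HL] := floor_powers_unbounded sigma_gt1 (\max_(q <- F) absz q).+1%N.
have [k kL Pk] := Hc (maxn L (maxn K0 1%N)); have [k' kL' Pk'] := Hc (k + d)%N.
move: kL; rewrite !geq_max => /and3P[kL kK k1].
pose idx (t : I) := block_index k k' t.
have idxk t : (k <= idx t)%N.
  rewrite /idx /block_index; case: t => [[] i]/=; rewrite ?leq_addr//.
  by rewrite (leq_trans _ (leq_addr _ _))// (leq_trans _ kL')// leq_addr.
pose p (t : I) := fl (idx t).
have pinj : injective p.
  move=> s t e; apply: (block_index_inj kL').
  by apply: HK0 e; exact: leq_trans kK (idxk _).
have pE : [set` image_fset p] `<=` floor_powers sigma `\` [set` F].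
  move=> q /= /image_fsetP[t <-]; split; first by exists (idx t) => //=; exact: leq_trans k1 (idxk t).
  move=> pF; have := HL _ (leq_trans kL (idxk t)); rewrite ltnNge => /negP; apply.
  by rewrite (big_rem _ pF)/= leq_maxl.
pose s (t : I) : R[i] := if t == (false, i0) then -1 else 1.
have s1 t : normc (s t) = 1 by rewrite /s; case: ifP; rewrite ?normcN normc1.
have ss t : s t * s t = 1 by rewrite /s; case: ifP; rewrite ?mulrNN mulr1.
have umbs_le (a : I -> R[i]) : (forall t, normc (a t) = 1) ->
    moment n (epoly p (fun t => s t * a t)) <= moment n (epoly p a) + 2^-1.
  move=> a1.
  have := HF (image_fset p) (lift_coef p 1 a) (lift_coef p 1 s) pE _.
  have -> : trigpoly (image_fset p) (fun q => lift_coef p 1 s q * lift_coef p 1 a q) =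
      epoly p (fun t => s t * a t).
    by rewrite trigpoly_image//; congr epoly; apply/funext => t /=; rewrite !lift_coefE.
  have -> : trigpoly (image_fset p) (lift_coef p 1 a) = epoly p a.
    by rewrite trigpoly_image//; congr epoly; apply/funext => t /=; rewrite lift_coefE.
  rewrite cLnorm_le_moment//; [|by rewrite addr_ge0// ltW|exact: tame_epoly|exact: tame_epoly].
  move=> h; apply: le_trans (h _) _.
    by move=> q /image_fsetP[t <-]; rewrite lift_coefE// /s; case: ifP => _; [right|left].
  have mB : moment n (epoly p a) <= B.
    apply: le_trans (moment_epoly_le n0 _ _) _.
    by rewrite (eq_bigr (fun=> 1)) ?sumr_const.
  apply: le_trans (ler_wpM2r (moment_ge0 _ _) Heps) _.
  rewrite mulrDl mul1r lerD2l invfM -mulrA ler_piMr// mulrC ler_pdivrMr// mul1r.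
  by [].
have [a a1] := moment_flip (sum_block_exp P) (sum_block_exp' P) (block_relation (etrans Pk (esym Pk')))
  s1 (prod_sign_block R oi0).
have h1 := umbs_le a a1.
have h2 := umbs_le (fun t => s t * a t) (fun t => etrans (normcM _ _) (etrans (congr2 *%R (s1 t) (a1 t)) (mulr1 1))).
rewrite leNgt => /negP; apply.
move: h2; rewrite (_ : (fun t => s t * (s t * a t)) = a); last by apply/funext => t; rewrite mulrA ss mul1r.
by move: h1; rewrite ltr_norml; clear; lra.
Qed.

End umbs_transcendental.

(** * Fourier coefficients of p-integrable functions *)

Section elementary_powers.
Variable R : realType.
Implicit Types s t : R.

(** A convex function lies above its tangent at s. Used pointwise under an integral, this stands in
    for the inequalities of Jensen and Hoelder. *)
Lemma pow_tangent s t m : 0 <= s -> 0 <= t ->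
  s ^+ m.+1 + m.+1%:R * s ^+ m * (t - s) <= t ^+ m.+1.
Proof.
move=> s0 t0; elim: m => [|m ih]; first by rewrite !expr1 expr0; lra.
apply: (le_trans _ (ler_wpM2l t0 ih)); rewrite -subr_ge0.
have -> : t * (s ^+ m.+1 + m.+1%:R * s ^+ m * (t - s)) -
    (s ^+ m.+2 + m.+2%:R * s ^+ m.+1 * (t - s)) = m.+1%:R * s ^+ m * (t - s) ^+ 2.
  by rewrite !exprS -[m.+2%:R]natr1 -!natr1; ring.
by rewrite mulr_ge0 ?sqr_ge0// mulr_ge0 ?exprn_ge0.
Qed.

Lemma expr_le1D t k m : 0 <= t -> (k <= m)%N -> t ^+ k <= 1 + t ^+ m.
Proof.
move=> t0 km; have [t1|t1] := leP t 1.
  by rewrite (@le_trans _ _ 1) ?exprn_ile1// lerDl exprn_ge0.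
by rewrite (le_trans (ler_weXn2l (ltW t1) km))// lerDr.
Qed.

End elementary_powers.

Section tame_functions.
Variables (R : realType) (n : nat).
Hypothesis n_gt0 : (0 < n)%N.
Notation circle := (circle R).
Notation haar := (haar R).
Implicit Types f g : circle -> R[i].

Let p1 : 1 <= (n + n)%:R :> R.
Proof. by rewrite ler1n addn_gt0 n_gt0. Qed.

Lemma tame_integrable f : tame n f ->
  haar.-integrable setT (EFin \o (fun z => normc (f z) ^+ (n + n))).
Proof.
move=> [mf Nf]; apply/integrableP; split.
  by apply/measurable_EFinP; apply: measurable_funX; exact: measurable_normc mf.
have p0 : (n + n)%:R != 0 :> R by rewrite gt_eqF// (lt_le_trans _ p1).
have := poweR_Lnorm haar (fun z => (normc (f z))%:E) p0.
rewrite -[X in (X `^ _)%E]/(cLnorm R (n + n)%:R f) => e.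
rewrite (_ : \int[haar]_z _ = \int[haar]_z `|(normc (f z))%:E| `^ (n + n)%:R)%E.
  by rewrite -e poweR_lty.
apply: eq_integral => z _; rewrite poweR_EFin.
by rewrite /= !ger0_norm ?exprn_ge0 ?normc_ge0// powR_mulrn ?normc_ge0.
Qed.

Lemma tame_integrableX f k : tame n f -> (k <= n + n)%N ->
  haar.-integrable setT (EFin \o (fun z => normc (f z) ^+ k)).
Proof.
move=> tf kn; have i1 : haar.-integrable setT (EFin \o cst (1 : R)).
  exact: finite_measure_integrable_cst.
have := integrableD measurableT i1 (tame_integrable tf); apply: le_integrable => //.
  by apply/measurable_EFinP; apply: measurable_funX; exact: measurable_normc tf.1.
move=> z _ /=; rewrite lee_fin !ger0_norm ?addr_ge0 ?exprn_ge0 ?normc_ge0//.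
by apply: expr_le1D => //; exact: normc_ge0.
Qed.

Lemma tame_cintegrable f : tame n f -> cintegrable f.
Proof.
move=> tf; split; first exact: tf.1.
by apply: (tame_integrableX (k := 1) tf); rewrite addn_gt0 n_gt0.
Qed.

Lemma tameB f g : tame n f -> tame n g -> tame n (fun z => f z - g z).
Proof.
move=> [mf Nf] [mg Ng].
have m1 : cmeasurable (fun=> -1 : R[i]) by exact: cmeasurable_cst.
split; first exact: cmeasurableB.
under eq_fun do rewrite -mulN1r.
apply: le_lt_trans (cLnormD p1 mf (cmeasurableM m1 mg)) _.
by rewrite lte_add_pinfty// cLnormZ// lte_mul_pinfty// lee_fin normc_ge0.
Qed.

Lemma moment1_le f : tame n f -> moment 1 f ^+ n <= moment n f.
Proof.
move=> tf; set A := moment 1 f.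
have nn : (1 + 1 <= n + n)%N by rewrite leq_add.
have iX := tame_integrableX tf nn.
have i1 (c : R) : haar.-integrable setT (EFin \o cst c) by exact: finite_measure_integrable_cst.
have A0 : 0 <= A by exact: moment_ge0.
case E : n n_gt0 => [//|m] _.
pose c := m.+1%:R * A ^+ m.
have iZ : haar.-integrable setT (EFin \o (fun z => c * normc (f z) ^+ (1 + 1))).
  by rewrite (_ : _ \o _ = fun z => (c%:E * (normc (f z) ^+ (1 + 1))%:E)%E)//; exact: integrableZl.
have -> : A ^+ m.+1 = \int[haar]_z ((A ^+ m.+1 - c * A) + c * normc (f z) ^+ (1 + 1)).
  rewrite RintegralD//; [|exact: i1]; rewrite Rintegral_haar_cst RintegralZl//.
  by rewrite -[X in _ + c * X]/A subrK.
rewrite /moment; apply: le_Rintegral => //.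
- by have := integrableD measurableT (i1 (A ^+ m.+1 - c * A)) iZ.
- by rewrite -E; exact: tame_integrable tf.
- move=> z _; have f2 : 0 <= normc (f z) ^+ 2 by rewrite exprn_ge0// normc_ge0.
  have := pow_tangent m A0 f2; rewrite -exprM mul2n -addnn -/c.
  by rewrite mulrBr addrA addrAC.
Qed.

Lemma cintegral_mul_epoly f (I : finType) (p : I -> int) (a : I -> R[i]) : cintegrable f ->
  cintegral (fun z => f z * epoly p a z) = \sum_i a i * fourier f (- p i).
Proof.
move=> fi; have h i : cintegrable (fun z => f z * echar (p i) z).
  apply: (cintegrableM (M := 1)) => //; first exact: cmeasurable_echar.
  by move=> z; rewrite normc_echar.
transitivity (cintegral (fun z => \sum_i a i * (f z * echar (p i) z))).
  by congr cintegral; apply/funext => z; rewrite mulr_sumr; apply: eq_bigr => i _; rewrite mulrCA.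
rewrite cintegral_sum; last by move=> i; exact: cintegrableZ.
by apply: eq_bigr => i _; rewrite cintegralZ// /fourier opprK.
Qed.

Lemma normc_sqrB (x y : R[i]) :
  normc (x - y) ^+ 2 = normc x ^+ 2 + normc y ^+ 2 - 2 * Re (x * y^*).
Proof.
case: x => a b; case: y => c d /=; rewrite !sqr_sqrtr ?addr_ge0 ?sqr_ge0//.
by ring.
Qed.

Lemma bessel f (I : finType) (p : I -> int) : injective p -> tame n f ->
  moment 1 (fun z => f z - epoly p (fourier f \o p) z) =
  moment 1 f - \sum_i normc (fourier f (p i)) ^+ 2.
Proof.
move=> pinj tf; set w := epoly _ _; set S := \sum_i _.
have nn : (1 + 1 <= n + n)%N by rewrite leq_add.
have tw : tame n w by exact: tame_epoly.
have if2 := tame_integrableX tf nn; have iw2 := tame_integrableX tw nn.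
have ifw : cintegrable (fun z => f z * (w z)^*).
  apply: (cintegrableM (M := \sum_i normc (fourier f (p i)))).
  - exact: tame_cintegrable.
  - exact: cmeasurable_conj tw.1.
  - by move=> z; rewrite normc_conj normc_epoly_le.
have [ifwr _] := cintegrable_ReIm ifw.
have Ifw : cintegral (fun z => f z * (w z)^*) = S%:C.
  under eq_fun do rewrite epoly_conj.
  rewrite cintegral_mul_epoly ?rmorph_sum; last exact: tame_cintegrable.
  by apply: eq_bigr => i _; rewrite opprK mulrC mulC_conj.
rewrite /moment; under eq_Rintegral do rewrite [normc _ ^+ _]normc_sqrB.
rewrite RintegralB//; first last.
- by rewrite (_ : _ \o _ = fun z => (2%:E * (Re (f z * (w z)^*))%:E)%E)//; exact: integrableZl.
- by have := integrableD measurableT if2 iw2.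
rewrite RintegralD// RintegralZl//.
rewrite -[X in _ + X - _]/(moment 1 w) (moment1_epoly _ pinj) -/S.
rewrite (_ : \int[haar]_z Re (f z * (w z)^*) = Re (cintegral (fun z => f z * (w z)^*)))//.
by rewrite Ifw /=; ring.
Qed.

Lemma bessel_le f (I : finType) (p : I -> int) : injective p -> tame n f ->
  \sum_i normc (fourier f (p i)) ^+ 2 <= moment 1 f.
Proof. by move=> pinj tf; rewrite -subr_ge0 -bessel// moment_ge0. Qed.

End tame_functions.

Section bounded_approximation.
Variable R : realType.
Notation circle := (circle R).
Notation haar := (haar R).

Lemma sum_levels (x : R) N : 0 <= x ->
  let S := \sum_(j < N) (j.+1%:R <= x)%R%:R : R in
  [/\ S <= x, x <= N%:R -> x <= S + 1 & N%:R <= x -> S = N%:R].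
Proof.
move=> x0; elim: N => [|N [h1 h2 h3]] /=.
  by rewrite big_ord0; split => //; lra.
rewrite big_ord_recr/=; have [xN|xN] /= := leP (N.+1%:R : R) x.
  rewrite h3; last by rewrite (le_trans _ xN)// ler_nat.
  by rewrite natr1; split => // h; rewrite -natr1 in xN *; lra.
split; rewrite ?addr0//; last by lra.
Qed.

(** By layers: g is within 1 / N of the mean of the indicators of the sets j / N <= g, for j = 1,
    ..., N, and each indicator is approximated by a polynomial with values in [0, 1]. *)
Lemma approx_unit (g : circle -> R) (delta : R) : measurable_fun setT g ->
  (forall z, 0 <= g z <= 1) -> 0 < delta -> exists P, [/\ real_epoly P,
    forall z, 0 <= P z <= 1 & \int[haar]_z `|P z - g z| <= delta].
Proof.
move=> mg g01 d0; have d20 : 0 < delta / 2 by rewrite divr_gt0.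
pose N := (Num.bound `|(delta / 2)^-1|).+1.
have N0 : 0 < N%:R :> R by [].
have Nd : N%:R^-1 <= delta / 2.
  rewrite -[leRHS]invrK lef_pV2 ?posrE ?invr_gt0// (le_trans (ler_norm _))//.
  by rewrite ltW// (lt_le_trans (archi_boundP _))// ler_nat.
pose A (j : 'I_N) := [set z | (j.+1%:R <= N%:R * g z)%R].
have mA j : measurable (A j).
  rewrite (_ : A j = setT `&` (fun z => N%:R * g z) @^-1` `[j.+1%:R, +oo[%classic).
    by apply: measurable_funM.
  by rewrite setTI; apply/seteqP; split => z /=; rewrite in_itv/= andbT.
have /choice[P HP] : forall j, exists P, [/\ real_epoly P, forall z, 0 <= P z <= 1 &
    \int[haar]_z `|P z - \1_(A j) z| < delta / 2].
  by move=> j; have [_ /(_ _ d20)[P [? ? ? _]]] := approximable_measurable haar haar (mA j); exists P.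
pose Q z := N%:R^-1 * \sum_j P j z.
have eQ : real_epoly Q.
  apply: real_epolyM; first exact: real_epoly_cst.
  elim: (index_enum _) => [|j r ih]; first by under eq_fun do rewrite big_nil; exact: real_epoly_cst.
  by under eq_fun do rewrite big_cons; apply: real_epolyD => //; case: (HP j).
have Q01 z : 0 <= Q z <= 1.
  have P01 j : 0 <= P j z <= 1 by case: (HP j).
  rewrite mulr_ge0 ?invr_ge0 ?(ltW N0) ?sumr_ge0//=; last by move=> j _; case/andP: (P01 j).
  rewrite /Q mulrC ler_pdivrMr// mul1r -[leRHS]mulr1 mulr_natl -[N in leRHS]card_ord -sumr_const.
  by apply: ler_sum => j _; case/andP: (P01 j).
exists Q; split => //.
have i1 (c : R) : haar.-integrable setT (EFin \o cst c) by exact: finite_measure_integrable_cst.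
have iP j : haar.-integrable setT (EFin \o (fun z => `|P j z - \1_(A j) z|)).
  have [eP P01 _] := HP j; apply: (@bounded_integrable _ haar _ (1)).
    by apply: measurableT_comp => //; apply: measurable_funB; [exact: real_epoly_measurable|exact: measurable_indic].
  move=> z; rewrite normr_id indicE ler_norml; have := P01 z.
  by case: (_ \in _) => /=; lra.
have iS : haar.-integrable setT (EFin \o (fun z => N%:R^-1 * \sum_j `|P j z - \1_(A j) z|)).
  have := integrableZl measurableT N%:R^-1 (Rintegrable_sum (index_enum _) iP).
  by [].
apply: (@le_trans _ _ (\int[haar]_z (N%:R^-1 * (\sum_j `|P j z - \1_(A j) z|) + N%:R^-1))).
  apply: le_Rintegral => //.
  - apply: (@bounded_integrable _ haar _ (1)).
      by apply: measurableT_comp => //; apply: measurable_funB => //; exact: real_epoly_measurable.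
    by move=> z; rewrite normr_id ler_norml; have := Q01 z; have := g01 z; lra.
  - by have := integrableD measurableT iS (i1 N%:R^-1).
  - move=> z _; have /andP[g0 g1] := g01 z.
    have x0 : 0 <= N%:R * g z by rewrite mulr_ge0.
    have [] := sum_levels N x0.
    set S := \sum_(j < N) _ => h1 h2 _.
    have {}h2 : N%:R * g z <= S + 1 by apply: h2; rewrite ler_piMr.
    have -> : Q z - g z = N%:R^-1 * (\sum_j (P j z - \1_(A j) z)) + N%:R^-1 * (S - N%:R * g z).
      rewrite sumrB (_ : \sum_j \1_(A j) z = S).
        by rewrite /Q; field; rewrite gt_eqF.
      by apply: eq_bigr => j _; rewrite indicE; congr (_%:R); congr nat_of_bool; apply/idP/idP; rewrite inE.
    rewrite (le_trans (ler_normD _ _))// !normrM ger0_norm ?invr_ge0 ?(ltW N0)// lerD//.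
      by rewrite ler_wpM2l ?invr_ge0 ?(ltW N0)// ler_norm_sum.
    by rewrite ler_piMr ?invr_ge0 ?(ltW N0)// ler_norml; lra.
rewrite (RintegralD measurableT iS (i1 _)) Rintegral_haar_cst RintegralZl ?Rintegral_sum//; last exact: Rintegrable_sum.
rewrite [leRHS]splitr lerD// mulrC ler_pdivrMr// mulr_natr.
rewrite -[N in leRHS]card_ord -sumr_const.
by apply: ler_sum => j _; rewrite ltW//; case: (HP j).
Qed.

(** A uniform bound has to survive the approximation in mean. Real and imaginary parts are treated
    separately, each rescaled from [-M, M] to [0, 1], which doubles the bound. *)
Lemma approx_bounded (h : circle -> R[i]) (M delta : R) : cmeasurable h -> 0 < M ->
  (forall z, normc (h z) <= M) -> 0 < delta ->
  exists (I : finType) (p : I -> int) (a : I -> R[i]),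
  (forall z, normc (epoly p a z) <= M + M) /\ \int[haar]_z normc (h z - epoly p a z) <= delta.
Proof.
move=> [mr mi] M0 hM d0.
have M20 : 0 < M + M by rewrite addr_gt0.
have key (g : circle -> R) : measurable_fun setT g -> (forall z, `|g z| <= M) ->
    exists P, [/\ real_epoly P, forall z, `|P z| <= M & \int[haar]_z `|P z - g z| <= delta / 2].
  move=> mg gM.
  have e0 : 0 < delta / 2 / (M + M) by rewrite !divr_gt0.
  have g01 z : 0 <= (g z + M) / (M + M) <= 1.
    have := gM z; rewrite ler_norml => /andP[h1 h2].
    rewrite ler_pdivrMr// mul1r divr_ge0 ?(ltW M20)//=; lra.
  have mg' : measurable_fun setT (fun z => (g z + M) / (M + M)).
    by apply: measurable_funM => //; exact: measurable_funD.
  have [P [eP P01 iP]] := approx_unit mg' g01 e0.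
  have eP' : real_epoly (fun z => (M + M) * P z + - M).
    by apply: real_epolyD; [apply: real_epolyM => //; exact: real_epoly_cst|exact: real_epoly_cst].
  exists (fun z => (M + M) * P z + - M); split => //.
    move=> z; have /andP[P0 P1] := P01 z; rewrite ler_norml.
    have : 0 <= (M + M) * P z <= M + M by rewrite mulr_ge0 ?(ltW M20)//= ler_piMr// ltW.
    by lra.
  have E z : `|(M + M) * P z + - M - g z| = (M + M) * `|P z - (g z + M) / (M + M)|.
    rewrite -[X in X * `|_|]gtr0_norm// -normrM; congr (`| _ |); field.
    by rewrite gt_eqF.
  under eq_Rintegral do rewrite E.
  rewrite RintegralZl//; first by rewrite mulrC -ler_pdivlMr.
  apply: (@bounded_integrable _ haar _ (1)).
    by apply: measurableT_comp => //; apply: measurable_funB => //; exact: real_epoly_measurable.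
  by move=> z; rewrite normr_id ler_norml; have := P01 z; have := g01 z; lra.
have [P [eP PM iP]] := key _ mr (fun z => le_trans (le_Re_normc _) (hM z)).
have [Q [eQ QM iQ]] := key _ mi (fun z => le_trans (le_Im_normc _) (hM z)).
have mP := real_epoly_measurable eP; have mQ := real_epoly_measurable eQ.
have [I [p [a Pe]]] := eP; have [J [q [b Qe]]] := eQ.
pose r (k : I + J) := match k with inl i => p i | inr j => q j end.
pose c (k : I + J) := match k with inl i => a i | inr j => 'i * b j end.
have E z : epoly r c z = P z +i* Q z.
  rewrite /epoly big_sumType/= -/(epoly p a z) -Pe.
  under eq_bigr do rewrite -mulrA.
  rewrite -mulr_sumr -/(epoly q b z) -Qe.
  by rewrite [RHS]complexE.
exists (I + J)%type, r, c; split.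
  move=> z; rewrite E (le_trans (normc_le_ReIm _))//= lerD//.
have iPQ (g k : circle -> R) : measurable_fun setT g -> measurable_fun setT k ->
    (forall z, `|g z| <= M) -> (forall z, `|k z| <= M) ->
    haar.-integrable setT (EFin \o (fun z => `|g z - k z|)).
  move=> mg mk gM kM; apply: (@bounded_integrable _ haar _ (M + M)).
    by apply: measurableT_comp => //; exact: measurable_funB.
  by move=> z; rewrite normr_id (le_trans (ler_normB _ _))// lerD.
have i1 := iPQ _ _ mP mr PM (fun z => le_trans (le_Re_normc _) (hM z)).
have i2 := iPQ _ _ mQ mi QM (fun z => le_trans (le_Im_normc _) (hM z)).
apply: (@le_trans _ _ (\int[haar]_z (`|P z - Re (h z)| + `|Q z - Im (h z)|))).
  have mh : cmeasurable h by split.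
  have mE : cmeasurable (epoly r c) by exact: cmeasurable_epoly.
  apply: le_Rintegral => //.
  - apply: (@bounded_integrable _ haar _ (M + (M + M))).
      exact: (measurable_normc (cmeasurableB mh mE)).
    move=> z; rewrite ger0_norm ?normc_ge0// (le_trans (le_normcD _ _))// normcN lerD// E.
    by rewrite (le_trans (normc_le_ReIm _))//= lerD.
  - by have := integrableD measurableT i1 i2.
  - move=> z _; rewrite E (le_trans (normc_le_ReIm _))//.
    by case: (h z) => x y /=; rewrite lerD// distrC.
by rewrite RintegralD// [leRHS]splitr lerD.
Qed.

End bounded_approximation.

Lemma normc_real (R : realType) (x : R) : 0 <= x -> normc x%:C = x.
Proof. by move=> x0; rewrite [LHS]/= expr0n/= addr0 sqrtr_sqr ger0_norm. Qed.

Lemma measurable_fun_le_cst (R : realType) (g : circle R -> R) (c : R) : measurable_fun setT g ->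
  measurable_fun setT (fun z => (g z <= c)%R%:R : R).
Proof.
move=> mg; rewrite (_ : (fun z => _) = \1_[set z | g z <= c]).
  apply: measurable_indic.
  rewrite (_ : [set z | _] = setT `&` g @^-1` `]-oo, c]%classic); first exact: mg.
  by rewrite setTI; apply/seteqP; split => z /=; rewrite in_itv/=.
by apply/funext => z; rewrite indicE; congr (_%:R); congr nat_of_bool; apply/idP/idP; rewrite inE.
Qed.

Section lower_semicontinuity.
Variables (R : realType) (n : nat).
Hypothesis n_gt0 : (0 < n)%N.
Notation circle := (circle R).
Notation haar := (haar R).
Implicit Types f g : circle -> R[i].

Lemma fourierB f g q : tame n f -> tame n g ->
  fourier (fun z => f z - g z) q = fourier f q - fourier g q.
Proof.
move=> tf tg.
have h (k : circle -> R[i]) : tame n k -> cintegrable (fun z => k z * echar (- q) z).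
  move=> tk; apply: (cintegrableM (M := 1)); first exact: tame_cintegrable tk.
    exact: cmeasurable_echar.
  by move=> z; rewrite normc_echar.
rewrite -[- fourier g q]mulN1r /fourier -cintegralZ; last exact: h.
rewrite -cintegralD; [|exact: h|by apply: cintegrableZ; exact: h].
by congr cintegral; apply/funext => z; rewrite mulN1r mulrBl.
Qed.

Lemma moment_truncation_cvg f (B : R) : tame n f ->
  (forall K : nat, (0 < K)%N -> \int[haar]_z ((normc (f z) <= K%:R)%R%:R * normc (f z) ^+ (n + n)) <= B) ->
  moment n f <= B.
Proof.
move=> tf H; have fi := tame_integrable n_gt0 tf.
have mf : measurable_fun setT (fun z => normc (f z)) by exact: measurable_normc tf.1.
have mg (K : nat) : measurable_fun setT (fun z => (normc (f z) <= K%:R)%R%:R * normc (f z) ^+ (n + n)).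
  by apply: measurable_funM; [exact: measurable_fun_le_cst|exact: measurable_funX].
have ge0 z : 0 <= normc (f z) ^+ (n + n) by rewrite exprn_ge0// normc_ge0.
have [] := @dominated_convergence _ _ _ haar setT measurableT
  (fun K z => ((normc (f z) <= K%:R)%R%:R * normc (f z) ^+ (n + n))%:E)
  (fun z => (normc (f z) ^+ (n + n))%:E) (EFin \o (fun z => normc (f z) ^+ (n + n)))
  _ _ _ fi _.
- by move=> K; exact/measurable_EFinP.
- by apply/measurable_EFinP; exact: measurable_funX.
- apply/nearW => z _; apply: cvg_EFin; first exact: nearW.
  apply: cvg_near_cst; near=> K => /=.
  suff -> : normc (f z) <= K%:R by rewrite mul1r.
  near: K; exists (Num.bound (normc (f z))) => // K /= hK.
  by rewrite ltW// (lt_le_trans (archi_boundP (normc_ge0 _)))// ler_nat.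
- apply/nearW => z K _ /=; rewrite lee_fin ger0_norm ?mulr_ge0//.
  by case: (normc (f z) <= K%:R); rewrite ?mul1r ?mul0r.
move=> _ _; rewrite -[X in _ --> X](fineK (integrable_fin_num measurableT fi)).
move=> /fine_cvgP[_] c; rewrite leNgt; apply/negP => lt.
have /cvgr_gt/(_ _ lt) [K0 _ HK] := c.
have := HK K0.+1 (leqnSn _); rewrite ltNge /= => /negP; apply.
exact: H.
Unshelve. all: by end_near.
Qed.

(* Weak lower semicontinuity: pair f with a truncation h of its dual function, which is close to a
   trigonometric polynomial and hence nearly orthogonal to f - w for a large partial sum w. *)
Lemma moment_le_partial f (B : R) : tame n f ->
  (forall (J : finType) (r : J -> int), exists (I : finType) (p : I -> int),
    [/\ injective p, forall j, fourier (epoly p (fourier f \o p)) (r j) = fourier f (r j)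
      & moment n (epoly p (fourier f \o p)) <= B]) ->
  moment n f <= B.
Proof.
move=> tf H; apply: moment_truncation_cvg => // K K0.
set m := \int[haar]_z _.
have K1 : 1 <= K%:R :> R by rewrite ler1n.
pose t z : R := (normc (f z) <= K%:R)%R%:R.
pose s z := t z * normc (f z).
have mf : measurable_fun setT (fun z => normc (f z)) by exact: measurable_normc tf.1.
have mt : measurable_fun setT t by exact: measurable_fun_le_cst.
have tX k z : t z ^+ k.+1 = t z by rewrite /t; case: (_ <= _); rewrite ?expr1n ?expr0n.
have s0 z : 0 <= s z by rewrite mulr_ge0 ?normc_ge0.
have sK z : s z <= K%:R.
  by rewrite /s /t; have [h|h] /= := leP (normc (f z)) K%:R; [rewrite mul1r|rewrite mul0r; exact: le_trans K1].
pose q := (n + n).-1; have nq : (n + n = q.+1)%N by rewrite prednK// addn_gt0 n_gt0.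
pose q' := q.-1; have qq : (q = q'.+1)%N.
  by rewrite prednK// /q -subn1 subn_gt0; case: n n_gt0 => // k; rewrite addSn addnS.
(* The truncated dual function, with q = 2n - 1 and q' = 2n - 2: |h| = s^(2n-1) and Re (h f) =
   s^(2n). *)
pose h z : R[i] := (f z)^* * (t z * normc (f z) ^+ q')%:C.
have hn z : normc (h z) = s z ^+ q.
  rewrite normcM normc_conj normc_real ?mulr_ge0 ?exprn_ge0 ?normc_ge0//.
  by rewrite /s exprMn qq tX exprS; ring.
have hf z : Re (h z * f z) = s z ^+ q.+1.
  rewrite /h mulrAC [_^* * _]mulrC mulC_conj -rmorphM /=.
  by rewrite /s exprMn tX qq !exprS; ring.
have mh : cmeasurable h.
  apply: cmeasurableM; first exact: cmeasurable_conj tf.1.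
  split; last exact: measurable_cst.
  by apply: measurable_funM => //; exact: measurable_funX.
pose M : R := K%:R ^+ q; have M0 : 0 < M by rewrite exprn_gt0// ltr0n.
have hM z : normc (h z) <= M by rewrite hn /M lerXn2r ?nnegrE.
apply/ler_addgt0Pr => eta eta0.
pose A := moment 1 f; have A0 : 0 <= A by exact: moment_ge0.
pose c : R := q.+1%:R; have c0 : 0 < c by rewrite ltr0n.
(* The pairing of u = f - w with h - P is estimated by x y <= kappa x^2 + y^2 / kappa. By Bessel the
   first term costs at most kappa A; the second is small because |h - P| <= 3 M and its mean is at
   most delta. Each half is at most eta / (2 c). *)
pose kappa := eta / (2 * c * (A + 1)).
have kappa0 : 0 < kappa by rewrite divr_gt0// !mulr_gt0// ltr_wpDl.
pose delta := kappa * eta / (2 * c * (3 * M)).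
have delta0 : 0 < delta by apply: divr_gt0; [exact: mulr_gt0|rewrite !mulr_gt0].
have [J [r [b [bM bd]]]] := approx_bounded mh M0 hM delta0.
have [I [p [pinj pf pB]]] := H J (fun j => - r j).
set w := epoly p _ in pf pB; pose P := epoly r b.
pose u z := f z - w z.
have tw : tame n w by exact: tame_epoly.
have tu : tame n u by exact: tameB.
have iu := tame_cintegrable n_gt0 tu.
have mP : cmeasurable P by exact: cmeasurable_epoly.
have mhP : cmeasurable (fun z => h z - P z) by exact: cmeasurableB.
have hPM z : normc (h z - P z) <= 3 * M.
  rewrite (le_trans (le_normcD _ _))// normcN; have := hM z; have := bM z; rewrite -/(P z); clear; lra.
have iuh : cintegrable (fun z => u z * h z) by exact: (cintegrableM (M := M)).
have iuP : cintegrable (fun z => u z * P z) by exact: (cintegrableM (M := M + M)).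
have iuhP : cintegrable (fun z => u z * (h z - P z)) by exact: (cintegrableM (M := 3 * M)).
have uP0 : cintegral (fun z => u z * P z) = 0.
  rewrite cintegral_mul_epoly// big1// => j _.
  by rewrite fourierB// pf subrr mulr0.
have uh : cintegral (fun z => u z * h z) = cintegral (fun z => u z * (h z - P z)).
  rewrite -[RHS]addr0 -uP0 -cintegralD//; congr cintegral; apply/funext => z.
  by rewrite -mulrDr subrK.
have nn : (1 + 1 <= n + n)%N by rewrite leq_add.
have iu2 := tame_integrableX n_gt0 tu nn.
have iZ (x : R) (g : circle -> R) : haar.-integrable setT (EFin \o g) ->
    haar.-integrable setT (EFin \o (fun z => x * g z)).
  move=> ig; rewrite (_ : _ \o _ = fun z => (x%:E * (g z)%:E)%E)//.
  exact: integrableZl.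
have ihP : haar.-integrable setT (EFin \o (fun z => normc (h z - P z))).
  apply: (@bounded_integrable _ haar _ (3 * M)); first exact: measurable_normc mhP.
  by move=> z; rewrite ger0_norm ?normc_ge0.
have bound : normc (cintegral (fun z => u z * h z)) <= eta / c.
  rewrite uh (le_trans (le_normc_cintegral iuhP))//.
  apply: (@le_trans _ _ (\int[haar]_z (kappa * normc (u z) ^+ (1 + 1) + (3 * M / kappa) * normc (h z - P z)))).
    apply: le_Rintegral => //; first by case: iuhP.
      by have := integrableD measurableT (iZ kappa _ iu2) (iZ (3 * M / kappa) _ ihP).
    move=> z _; rewrite normcM.
    have := hPM z; have := normc_ge0 (h z - P z); set y := normc (h z - P z).
    have := normc_ge0 (u z); set x := normc (u z) => x0 y0 y3.
    have : x * y <= kappa * x ^+ 2 + y ^+ 2 / kappa.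
      rewrite -subr_ge0.
      have -> : kappa * x ^+ 2 + y ^+ 2 / kappa - x * y =
        ((kappa * x - y / 2) ^+ 2 + 3 / 4 * y ^+ 2) / kappa by field; rewrite gt_eqF.
      by rewrite divr_ge0 ?(ltW kappa0)// addr_ge0 ?sqr_ge0// mulr_ge0 ?sqr_ge0.
    move=> /le_trans; apply; rewrite lerD2l [leRHS]mulrAC ler_wpM2r ?invr_ge0 ?(ltW kappa0)//.
    by rewrite expr2 ler_wpM2r.
  rewrite RintegralD//; [|exact: iZ|exact: iZ]; rewrite !RintegralZl//.
  have uA : \int[haar]_z normc (u z) ^+ (1 + 1) <= A.
    rewrite -[leLHS]/(moment 1 u) /u /w (bessel n_gt0)// lerBlDr lerDl sumr_ge0// => i _.
    by rewrite exprn_ge0// normc_ge0.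
  apply: (@le_trans _ _ (kappa * A + 3 * M / kappa * delta)).
    have k1 : 0 <= 3 * M / kappa by apply: divr_ge0; [rewrite mulr_ge0 ?(ltW M0)|exact: ltW].
    by apply: lerD; apply: ler_wpM2l => //; exact: ltW.
  have -> : 3 * M / kappa * delta = eta / c / 2.
    by rewrite /delta; field; rewrite !gt_eqF.
  rewrite [leRHS]splitr lerD2r.
  have -> : eta / c / 2 = kappa * (A + 1) by rewrite /kappa; field; rewrite !gt_eqF// ltr_wpDl.
  by rewrite ler_wpM2l ?lerDl ?(ltW kappa0).
have [iuhr _] := cintegrable_ReIm iuh.
have iS : haar.-integrable setT (EFin \o (fun z => s z ^+ q.+1)).
  apply: (@bounded_integrable _ haar _ (K%:R ^+ q.+1)).
    by apply: measurable_funX; exact: measurable_funM.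
  by move=> z; rewrite ger0_norm ?exprn_ge0// lerXn2r ?nnegrE.
(* The tangent at s, evaluated at |w|, gives |w|^(2n) >= s^(2n) + 2n s^(2n-1) (|w| - s), and Re (h
   w) <= s^(2n-1) |w|. *)
have tan : m - c * Re (cintegral (fun z => u z * h z)) <= moment n w.
  have -> : m - c * Re (cintegral (fun z => u z * h z)) =
      \int[haar]_z (s z ^+ q.+1 - c * Re (u z * h z)).
    rewrite RintegralB//; [|exact: iZ]; rewrite RintegralZl//; congr (_ - _).
    by apply: eq_Rintegral => z _; rewrite nq /s exprMn tX.
  apply: le_Rintegral => //; first by have := integrableB measurableT iS (iZ c _ iuhr).
    exact: tame_integrable.
  move=> z _; rewrite nq; apply: le_trans (pow_tangent q (s0 z) (normc_ge0 (w z))).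
  rewrite lerD2l -/c -mulrN -mulrA ler_wpM2l ?(ltW c0)// mulrBr -exprSr -hf -hn.
  have : Re (h z * w z) <= normc (h z) * normc (w z).
    by rewrite -normcM (le_trans (ler_norm _))// le_Re_normc.
  have -> : Re (u z * h z) = Re (h z * f z) - Re (h z * w z).
    by rewrite /u mulrC mulrBr; case: (h z * f z); case: (h z * w z).
  by clear; lra.
have : c * Re (cintegral (fun z => u z * h z)) <= eta.
  rewrite mulrC -ler_pdivlMr// (le_trans (ler_norm _))//.
  by rewrite (le_trans (le_Re_normc _)).
by move: tan pB; clear; lra.
Qed.

End lower_semicontinuity.

(** * The spaces of functions with spectrum in E *)

Section LpE_toolbox.
Variables (R : realType) (n : nat) (E : set int).
Hypothesis n_gt0 : (0 < n)%N.
Hypothesis p1 : 1 <= (n + n)%:R :> R.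
Notation circle := (circle R).
Notation haar := (haar R).
Local Notation Y := (LpE E p1).
Local Notation "\pi u" := (\pi_Y u)%qT (at level 10).
Implicit Types (y x : Y) (u v : LpE_fun E p1).

(** The norm of the complex space Y takes its values in R[i]; this is the underlying real number. *)
Definition nrm y : R := fine (cLnorm R (n + n)%:R (repr y)).

Definition fcoef y q : R[i] := fourier (repr y) q.

Lemma norm_nrm y : `|y| = (nrm y)%:C.
Proof. by []. Qed.

Lemma nrm_ge0 y : 0 <= nrm y.
Proof. exact: fine_cLnorm_ge0. Qed.

Lemma nrmD x y : nrm (x + y) <= nrm x + nrm y.
Proof. by have := ler_normD x y; rewrite !norm_nrm -rmorphD lecR. Qed.

Lemma nrmZ a y : nrm (a *: y) = normc a * nrm y.
Proof. by apply: complexI; rewrite rmorphM/= -normC_normc -!norm_nrm normrZ. Qed.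

Lemma nrm0 : nrm 0 = 0.
Proof. by apply: complexI; rewrite -norm_nrm normr0. Qed.

Lemma nrmN y : nrm (- y) = nrm y.
Proof. by apply: complexI; rewrite -!norm_nrm normrN. Qed.

Lemma nrm_sum (I : Type) (r : seq I) (F : I -> Y) :
  nrm (\sum_(i <- r) F i) <= \sum_(i <- r) nrm (F i).
Proof.
elim: r => [|i r ih]; first by rewrite !big_nil nrm0.
by rewrite !big_cons (le_trans (nrmD _ _))// lerD2l.
Qed.

Lemma tame_LpE u : tame n u.
Proof. by have [mu Nu _] := LpE_funP u; split. Qed.

Lemma fourier_ae f g q : tame n f -> tame n g -> (\forall z \ae haar, f z = g z) ->
  fourier f q = fourier g q.
Proof.
move=> [mf _] [mg _] fg.
have [rf jf] := cmeasurableM mf (cmeasurable_echar R (- q)).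
have [rg jg] := cmeasurableM mg (cmeasurable_echar R (- q)).
rewrite /fourier /cintegral /Rintegral; congr (fine _ +i* fine _).
- by apply: ae_eq_integral => //; [exact/measurable_EFinP|exact/measurable_EFinP|];
    apply: filterS fg => z -> _.
- by apply: ae_eq_integral => //; [exact/measurable_EFinP|exact/measurable_EFinP|];
    apply: filterS fg => z -> _.
Qed.

Lemma fcoef_pi u q : fcoef (\pi u) q = fourier u q.
Proof. by apply: fourier_ae; [exact: tame_LpE|exact: tame_LpE|exact: repr_ae]. Qed.

Lemma fcoefD x y q : fcoef (x + y) q = fcoef x q + fcoef y q.
Proof.
rewrite -[x]reprK -[y]reprK pi_LpED !fcoef_pi.
have [mx Nx] := tame_LpE (repr x); have [my Ny] := tame_LpE (repr y).
exact: (fourierD p1 q mx Nx my Ny).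
Qed.

Lemma fcoefZ a y q : fcoef (a *: y) q = a * fcoef y q.
Proof.
have [my Ny] := tame_LpE (repr y).
by rewrite [LHS]fcoef_pi; exact: (fourierZ p1 a q my Ny).
Qed.

Lemma fcoef0 q : fcoef 0 q = 0.
Proof. by rewrite -[0](scale0r (0 : Y)) fcoefZ mul0r. Qed.

Lemma fcoef_sum (I : Type) (r : seq I) (F : I -> Y) q :
  fcoef (\sum_(i <- r) F i) q = \sum_(i <- r) fcoef (F i) q.
Proof.
elim: r => [|i r ih]; first by rewrite !big_nil fcoef0.
by rewrite !big_cons fcoefD ih.
Qed.

Lemma fcoef_outside y q : ~ E q -> fcoef y q = 0.
Proof. by have [_ _] := LpE_funP (repr y); exact. Qed.

Lemma nrm_moment y : nrm y ^+ (n + n) = moment n (repr y).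
Proof. by have [my Ny] := tame_LpE (repr y); exact: cLnorm_moment. Qed.

Lemma nrm_pi u : nrm (\pi u) ^+ (n + n) = moment n u.
Proof.
have [mu Nu] := tame_LpE u; rewrite -cLnorm_moment//; congr (_ ^+ _).
by apply: complexI; rewrite -norm_nrm; exact: normLpE_pi.
Qed.

Lemma moment1_nrm y : moment 1 (repr y) <= nrm y ^+ 2.
Proof.
rewrite -(@ler_pXn2r _ n)// ?nnegrE ?moment_ge0 ?exprn_ge0 ?nrm_ge0//.
by rewrite -exprM mul2n -addnn nrm_moment; apply: moment1_le => //; exact: tame_LpE.
Qed.

Lemma bessel_nrm y (I : finType) (q : I -> int) : injective q ->
  \sum_i normc (fcoef y (q i)) ^+ 2 <= nrm y ^+ 2.
Proof.
move=> qinj; apply: le_trans (moment1_nrm y).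
by apply: (bessel_le n_gt0) => //; exact: tame_LpE.
Qed.

Lemma normc_fcoef y q : normc (fcoef y q) <= nrm y.
Proof.
rewrite -(@ler_pXn2r _ 2)// ?nnegrE ?normc_ge0 ?nrm_ge0//.
have := @bessel_nrm y unit (fun=> q); rewrite (big_pred1 tt); last by case.
by apply; case=> -[].
Qed.

Section exponentials.
Variables (T : Type) (e : T -> int).
Hypothesis Ee : forall t, E (e t).

Lemma echar_LpE t : (echar (e t) : circle -> R[i]^o) \in LpE_pred E p1.
Proof.
have e1 : epoly (fun _ : unit => e t) (fun=> 1 : R[i]) = echar (e t).
  by apply/funext => z; rewrite /epoly (big_pred1 tt) ?mul1r//; case.
have [m1 N1] := tame_epoly n (fun _ : unit => e t) (fun=> 1 : R[i]).
rewrite e1 in m1 N1; apply/LpE_predP; split => // q Eq.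
rewrite /fourier; under eq_fun do rewrite -echarD.
rewrite cintegral_echar subr_eq0; case: eqP => // eq.
by case: Eq; rewrite -eq.
Qed.

Definition eLp t : Y := \pi (LpEFun (echar_LpE t)).

Lemma fcoef_eLp t q : fcoef (eLp t) q = (e t == q)%:R.
Proof.
rewrite /eLp fcoef_pi /fourier; under eq_fun do rewrite /= -echarD.
by rewrite cintegral_echar subr_eq0.
Qed.

Lemma sum_eLp (I : Type) (r : seq I) (x : I -> T) (a : I -> R[i]) :
  exists2 u : LpE_fun E p1, \sum_(i <- r) a i *: eLp (x i) = \pi u &
    forall z, u z = \sum_(i <- r) a i * echar (e (x i)) z.
Proof.
elim: r => [|i r [u ih uz]].
  by exists 0 => [|z]; rewrite !big_nil ?piE.
exists (a i *: LpEFun (echar_LpE (x i)) + u) => [|z]; rewrite big_cons.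
  by rewrite ih /eLp -pi_LpED; congr (_ + _); exact: pi_scaleLpE.
by rewrite -uz.
Qed.

Lemma nrm_sum_eLp (I : finType) (x : I -> T) (a : I -> R[i]) :
  nrm (\sum_i a i *: eLp (x i)) ^+ (n + n) = moment n (epoly (e \o x) a).
Proof.
have [u -> uz] := sum_eLp (index_enum I) x a; rewrite nrm_pi.
by congr moment; apply/funext => z; rewrite uz.
Qed.

Lemma fcoef_sum_eLp (I : finType) (x : I -> T) (a : I -> R[i]) i : injective (e \o x) ->
  fcoef (\sum_i a i *: eLp (x i)) (e (x i)) = a i.
Proof.
move=> exinj; rewrite fcoef_sum (bigD1 i)//= big1 => [|j ji].
  by rewrite addr0 fcoefZ fcoef_eLp eqxx mulr1.
rewrite fcoefZ fcoef_eLp; case: eqP => [/exinj eji|_]; last by rewrite mulr0.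
by rewrite eji eqxx in ji.
Qed.

End exponentials.

End LpE_toolbox.

(** * From umap to transcendence *)

Section finite_rank_nets.
Variables (R : realType) (V : lmodType R[i]) (N : V -> R).
Hypothesis ND : forall x y, N (x + y) <= N x + N y.
Hypothesis NZ : forall a x, N (a *: x) = normc a * N x.

Lemma disc_grid (A delta : R) : 0 < delta -> exists (T : finType) (c : T -> R[i]),
  forall u, normc u <= A -> exists t, normc (u - c t) <= delta.
Proof.
move=> d0; pose A' := `|A| + 1; have A0 : 0 < A' by rewrite ltr_wpDl.
have [T [c Hc]] := grid (divr_gt0 d0 A0).
exists T, (fun t => A'%:C * c t) => u uA.
have A1 : A'%:C != 0 :> R[i] by rewrite eq_complex/= eqxx andbT gt_eqF.
have nA (z : R[i]) : normc (A'%:C * z) = A' * normc z by rewrite normcM normc_real// ltW.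
have e : u = A'%:C * (A'%:C^-1 * u) by rewrite mulVKf.
have [t Ht] : exists t, normc (A'%:C^-1 * u - c t) < delta / A'.
  apply: Hc; rewrite -(ler_pM2l A0) mulr1 -nA -e (le_trans uA)//.
  by rewrite (le_trans (ler_norm A))// lerDl.
by exists t; rewrite e -mulrBr nA mulrC -ler_pdivlMr// ltW.
Qed.

(* By induction on the number of generators. When the last one is in the closure of the span of the
   others its coefficient is not controlled, but then it can be replaced by approximants. *)
Lemma finite_rank_net (r : nat) (b : 'I_r -> V) (M delta : R) : 0 < delta ->
  exists (T : finType) (w : T -> V), forall c : 'I_r -> R[i],
    N (\sum_i c i *: b i) <= M -> exists t, N (\sum_i c i *: b i - w t) <= delta.
Proof.
have N0 : N 0 = 0 by rewrite -(scale0r 0) NZ normc0 mul0r.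
have NN x : N (- x) = N x by rewrite -scaleN1r NZ normcN normc1 mul1r.
have Npos x : 0 <= N x.
  by have := ND x (- x); rewrite subrr N0 NN; lra.
elim: r b M delta => [|r ih] b M delta d0.
  by exists unit, (fun=> 0) => c _; exists tt; rewrite big_ord0 subr0 N0 ltW.
pose b' (i : 'I_r) := b (widen_ord (leqnSn r) i); pose x := b ord_max.
have d20 : 0 < delta / 2 by rewrite divr_gt0.
have [close|[d dpos far]] : (forall eta : R, 0 < eta -> exists u : 'I_r -> R[i], N (x - \sum_i u i *: b' i) <= eta)
    \/ (exists2 d : R, 0 < d & forall u : 'I_r -> R[i], d <= N (x - \sum_i u i *: b' i)).
- have [h|h] := pselect (exists2 d : R, 0 < d & forall u : 'I_r -> R[i], d <= N (x - \sum_i u i *: b' i)).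
    by right.
  left => eta eta0; apply: contrapT => h'; apply: h; exists eta => // u.
  by rewrite leNgt; apply/negP => /ltW lt; apply: h'; exists u.
- have [T [w Hw]] := ih b' (M + delta / 2) _ d20; exists T, w => c cM.
  have eta0 : 0 < delta / 2 / (normc (c ord_max) + 1) by rewrite divr_gt0// ltr_wpDl// normc_ge0.
  have [u Hu] := close _ eta0.
  pose c' i := c (widen_ord (leqnSn r) i) + c ord_max * u i.
  set v := \sum_i c i *: b i in cM *; set v' := \sum_i c' i *: b' i.
  have vv' : N (v - v') <= delta / 2.
    have -> : v - v' = c ord_max *: (x - \sum_i u i *: b' i).
      rewrite /v big_ord_recr/= /v' /c'; under [X in _ - X]eq_bigr do rewrite scalerDl -scalerA.
      by rewrite big_split/= -scaler_sumr scalerBr opprD addrACA subrr add0r.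
    rewrite NZ; apply: (@le_trans _ _ (normc (c ord_max) * (delta / 2 / (normc (c ord_max) + 1)))).
      by rewrite ler_wpM2l ?normc_ge0.
    rewrite mulrCA ler_piMr ?(ltW d20)// ler_pdivrMr ?mul1r ?lerDl//.
    by rewrite ltr_wpDl// normc_ge0.
  have v'M : N v' <= M + delta / 2.
    rewrite (_ : v' = v - (v - v')); last by rewrite opprB addrC subrK.
    by rewrite (le_trans (ND _ _))// NN lerD.
  have [t Ht] := Hw c' v'M; exists t.
  rewrite (_ : v - w t = (v - v') + (v' - w t)); last by rewrite addrA subrK.
  by rewrite (le_trans (ND _ _))// [leRHS]splitr lerD.
- have x0 : 0 < N x + 1 by rewrite ltr_wpDl.
  have [T1 [g Hg]] := disc_grid (M / d) (divr_gt0 d20 x0).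
  have [T2 [w Hw]] := ih b' (M + M / d * (N x + 1)) _ d20.
  exists (T1 * T2)%type, (fun t => g t.1 *: x + w t.2) => c cM.
  set k := c ord_max; pose v' := \sum_(i < r) c (widen_ord (leqnSn r) i) *: b' i.
  have cv : \sum_i c i *: b i = v' + k *: x by rewrite big_ord_recr.
  rewrite cv in cM *.
  (* A combination with last coefficient k <> 0 is k times the difference of x and a point of the
     span of the others, so its norm is at least |k| d. *)
  have kM : normc k <= M / d.
    rewrite ler_pdivlMr// (le_trans _ cM)//.
    have [->|k0] := eqVneq k 0; first by rewrite normc0 mul0r.
    have -> : v' + k *: x = k *: (x - \sum_i (- k^-1 * c (widen_ord (leqnSn r) i)) *: b' i).
      rewrite scalerBr addrC scaler_sumr -sumrN; congr (_ + _); apply: eq_bigr => i _.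
      by rewrite scalerA mulrA mulrN mulfV// mulN1r scaleNr opprK.
    by rewrite NZ ler_wpM2l ?normc_ge0.
  have [t1 Ht1] := Hg k kM.
  have [t2 Ht2] : exists t, N (v' - w t) <= delta / 2.
    apply: Hw; rewrite -/v' -[v'](addrK (k *: x)) (le_trans (ND _ _))// NN NZ lerD//.
    by apply: ler_pM => //; rewrite ?normc_ge0// lerDl.
  exists (t1, t2) => /=; rewrite [g t1 *: x + _]addrC opprD addrACA -scalerBl.
  rewrite (le_trans (ND _ _))// [leRHS]splitr lerD// NZ.
  have := ler_wpM2r (ltW x0) Ht1; rewrite divfK ?gt_eqF//; apply: le_trans.
  by rewrite ler_wpM2l ?normc_ge0// lerDl.
Qed.

End finite_rank_nets.

Lemma frequently_nat (Q : nat -> Prop) : (forall L, exists2 k, (L <= k)%N & Q k) ->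
  exists f : nat -> nat, injective f /\ forall i, Q (f i).
Proof.
move=> HQ; have /choice[g Hg] : forall L, exists k, (L <= k)%N /\ Q k.
  by move=> L; have [k] := HQ L; exists k.
pose f i := iter i (fun k => g k.+1) (g 0%N).
have fS i : (f i < f i.+1)%N by exact: (Hg (f i).+1).1.
have fmono i j : (i < j)%N -> (f i < f j)%N.
  elim: j => [//|j ih]; rewrite ltnS leq_eqVlt => /orP[/eqP ->//|/ih h].
  exact: ltn_trans h (fS j).
exists f; split => [i j e|i]; last by case: i => [|i]; [exact: (Hg 0%N).2|exact: (Hg _).2].
by apply/eqP; case: ltngtP => // /fmono; rewrite e ltnn.
Qed.

Section finite_rank_operators.
Variables (R : realType) (n : nat) (E : set int).
Hypothesis n_gt0 : (0 < n)%N.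
Hypothesis p1 : 1 <= (n + n)%:R :> R.
Variable e : nat -> int.
Hypothesis Ee : forall k, E (e k).
Hypothesis einj : exists K, forall j k, (K <= j)%N -> (K <= k)%N -> e j = e k -> j = k.
Local Notation Y := (LpE E p1).
Local Notation eL := (eLp p1 Ee).

Lemma normc_natV (K : nat) : normc (K%:R^-1 : R[i]) = K%:R^-1.
Proof.
have -> : (K%:R^-1 : R[i]) = (K%:R^-1 : R)%:C by rewrite fmorphV rmorph_nat.
by rewrite normc_real// invr_ge0.
Qed.

(** The mean of K distinct characters has sup norm at most 1, so its 2n-th moment is at most the
    second one, which is 1 / K by orthogonality. *)
Lemma nrm_mean_eLp (K : nat) (f : 'I_K -> nat) : (0 < K)%N -> injective (e \o f) ->
  nrm (\sum_i K%:R^-1 *: eL (f i)) ^+ (n + n) <= K%:R^-1.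
Proof.
move=> K0 finj; rewrite nrm_sum_eLp//.
have KR : (0 : R) < K%:R by rewrite ltr0n.
set w := epoly _ _.
have w1 z : normc (w z) <= 1.
  rewrite (le_trans (normc_epoly_le _ _ _))//.
  by under eq_bigr do rewrite normc_natV; rewrite sumr_const card_ord -[leLHS]mulr_natl divff ?gt_eqF.
have tw : tame n w by exact: tame_epoly.
have nn : (1 + 1 <= n + n)%N by rewrite leq_add.
apply: (@le_trans _ _ (moment 1 w)).
  apply: le_Rintegral => //; [exact: tame_integrable|exact: tame_integrableX tw nn|].
  by move=> z _; rewrite ler_wiXn2l// normc_ge0.
rewrite /w moment1_epoly//; under eq_bigr do rewrite normc_natV.
by rewrite sumr_const card_ord -[leLHS]mulr_natl expr2 mulrA divff ?gt_eqF// mul1r.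
Qed.

Lemma nrm_eLp_le1 k : nrm (eL k) <= 1.
Proof.
have := @nrm_mean_eLp 1 (fun=> k) isT (fun i j _ => etrans (ord1 i) (esym (ord1 j))).
rewrite big_ord1 !invr1 scale1r => h.
by rewrite -(@ler_pXn2r _ (n + n)) ?addn_gt0 ?n_gt0 ?nnegrE ?nrm_ge0// expr1n.
Qed.

(* If T e_k stays large along a sequence, a single point is close to infinitely many T e_k, hence to
   the images of their averages; but these averages tend to 0. *)
Lemma finite_rank_eLp (T : {linear Y -> Y}) (delta : R) : bounded_op T -> finite_rank T ->
  0 < delta -> exists L, forall k, (L <= k)%N -> nrm (T (eL k)) <= delta.
Proof.
move=> [M TM] [r [b Tb]] d0.
have M' x : nrm (T x) <= `|M| * nrm x.
  have := TM x; rewrite !norm_nrm -rmorphM lecR => /le_trans; apply.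
  by rewrite ler_wpM2r ?nrm_ge0// ler_norm.
have d30 : 0 < delta / 3 by rewrite divr_gt0.
have eL1 k := nrm_eLp_le1 k.
have [S [w Hw]] := finite_rank_net (@nrmD _ _ _ _) (@nrmZ _ _ _ p1) b (`|M|) d30.
apply: contrapT => H.
have {H} H L : exists2 k, (L <= k)%N & delta < nrm (T (eL k)).
  apply: contrapT => H'; apply: H; exists L => k Lk; rewrite leNgt; apply/negP => lt.
  by apply: H'; exists k.
have [K Kinj] := einj.
have net k : exists t, nrm (T (eL k) - w t) <= delta / 3.
  have [c Tc] := Tb (eL k); rewrite Tc; apply: Hw; rewrite -Tc.
  by rewrite (le_trans (M' _))// ler_piMr.
have [t Ht] : exists t, forall L, exists2 k, (L <= k)%N &
    delta < nrm (T (eL k)) /\ nrm (T (eL k) - w t) <= delta / 3.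
  apply: contrapT => H'.
  have /choice[L HL] : forall t, exists L, forall k, (L <= k)%N -> delta < nrm (T (eL k)) ->
      delta / 3 < nrm (T (eL k) - w t).
    move=> t; apply: contrapT => h; apply: H'; exists t => L.
    apply: contrapT => h'; apply: h; exists L => k Lk lt; rewrite ltNge; apply/negP => le.
    by apply: h'; exists k.
  have [k Lk lt] := H (\max_t L t); have [t] := net k.
  by apply/negP; rewrite -ltNge; apply: HL => //; exact: leq_trans (leq_bigmax t) Lk.
have {}Ht L : exists2 k, (L <= k)%N & [/\ (K <= k)%N, delta < nrm (T (eL k)) & nrm (T (eL k) - w t) <= delta / 3].
  have [k] := Ht (maxn L K); rewrite geq_max => /andP[Lk Kk] [h1 h2].
  by exists k.
have [f [finj Hf]] := frequently_nat Ht.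
(* The images T e_k exceed delta and lie within delta / 3 of w t; their mean T y lies within delta /
   3 of w t as well, so its norm is at least delta / 3. *)
have wt : delta / 3 + delta / 3 <= nrm (w t).
  have [_ h1 h2] := Hf 0%N.
  have := nrmD (T (eL (f 0%N)) - w t) (w t); rewrite subrK; move: h1 h2; clear; lra.
have [m m0 Hm] : exists2 m : nat, (0 < m)%N & m%:R^-1 * `|M| ^+ (n + n) < (delta / 3) ^+ (n + n).
  pose x := (`|M| ^+ (n + n)) / (delta / 3) ^+ (n + n).
  have c0 : 0 < (delta / 3) ^+ (n + n) by rewrite exprn_gt0.
  have x0 : 0 <= x by rewrite divr_ge0 ?exprn_ge0// ltW.
  exists (Num.bound x).+1 => //; rewrite mulrC ltr_pdivrMr// mulrC -ltr_pdivrMr//.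
  by rewrite (lt_trans (archi_boundP x0))// ltr_nat.
have mR : (m%:R : R[i]) != 0 by rewrite pnatr_eq0 -lt0n.
pose y : Y := \sum_(i < m) m%:R^-1 *: eL (f i).
have y1 : nrm y ^+ (n + n) <= m%:R^-1.
  apply: (@nrm_mean_eLp m (fun i => f i)) => // i j /= eij; apply: val_inj; apply: finj.
  by have [Ki _ _] := Hf i; have [Kj _ _] := Hf j; exact: Kinj.
have Tyw : nrm (T y - w t) <= delta / 3.
  have -> : T y - w t = \sum_(i < m) m%:R^-1 *: (T (eL (f i)) - w t).
    have -> : T y = \sum_(i < m) m%:R^-1 *: T (eL (f i)).
      by rewrite linear_sum; apply: eq_bigr => i _; rewrite linearZ.
    have {1}-> : w t = \sum_(i < m) m%:R^-1 *: w t.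
      by rewrite sumr_const card_ord scalerMnl -[_ *+ m]mulr_natr mulVf// scale1r.
    by rewrite -sumrB; apply: eq_bigr => i _; rewrite scalerBr.
  rewrite (le_trans (nrm_sum _ _))//.
  apply: (@le_trans _ _ (\sum_(i < m) m%:R^-1 * (delta / 3))).
    by apply: ler_sum => i _; rewrite nrmZ normc_natV ler_wpM2l ?invr_ge0//; case: (Hf i).
  by rewrite sumr_const card_ord -[leLHS]mulr_natl mulrA mulfV ?mul1r// pnatr_eq0 -lt0n.
have Ty : delta / 3 <= nrm (T y).
  have := nrmD (w t - T y) (T y); rewrite subrK -opprB nrmN; move: wt Tyw; clear; lra.
have := lt_le_trans Hm (lerXn2r (n + n) _ _ Ty).
rewrite ltNge !nnegrE nrm_ge0 (ltW d30) => /(_ isT isT)/negP; apply.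
rewrite (@le_trans _ _ ((`|M| * nrm y) ^+ (n + n)))//.
  by rewrite lerXn2r ?nnegrE ?nrm_ge0 ?mulr_ge0 ?nrm_ge0.
by rewrite exprMn mulrC ler_wpM2r ?exprn_ge0.
Qed.

End finite_rank_operators.

(** Converts a small error in the norm into a small error in the moment, uniformly over norms
    bounded by A. *)
Lemma expr_uniform (R : realType) (A delta : R) N : 0 <= A -> 0 < delta ->
  exists2 kappa : R, 0 < kappa <= 1 & forall y x, 0 <= y <= A -> 0 <= x <= kappa ->
    (y + x) ^+ N <= y ^+ N + delta.
Proof.
move=> A0; elim: N delta => [|N ih] delta d0.
  by exists 1 => [|y x _ _]; rewrite ?ltr01 ?lexx// !expr0 lerDl ltW.
have A1 : 0 < A + 1 by rewrite ltr_wpDl.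
have AN : 0 < A ^+ N + 1 by rewrite ltr_wpDl// exprn_ge0.
have [k /andP[k0 k1] Hk] := ih (delta / (2 * (A + 1))) (divr_gt0 d0 (mulr_gt0 (ltr0Sn _ _) A1)).
have k'0 : 0 < delta / (2 * (A ^+ N + 1)) by rewrite divr_gt0// mulr_gt0.
exists (Num.min k (delta / (2 * (A ^+ N + 1)))).
  by rewrite lt_min k0 k'0/= ge_min k1.
move=> y x /andP[y0 yA] /andP[x0]; rewrite le_min => /andP[xk xk'].
have yx : 0 <= y + x by rewrite addr_ge0.
have h : (y + x) ^+ N <= y ^+ N + delta / (2 * (A + 1)) by apply: Hk; rewrite ?y0 ?x0.
rewrite exprS (le_trans (ler_wpM2l yx h))// mulrDr mulrDl -exprS -addrA lerD2l.
rewrite [leRHS]splitr lerD//.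
  have yN : y ^+ N <= A ^+ N + 1 by rewrite (@le_trans _ _ (A ^+ N)) ?lerDl// lerXn2r ?nnegrE.
  have := ler_pM x0 (exprn_ge0 N y0) xk' yN => /le_trans; apply.
  by rewrite [leLHS](_ : _ = delta / 2)//; field; rewrite gt_eqF.
have yxA : y + x <= A + 1 by rewrite lerD// (le_trans xk).
rewrite (@le_trans _ _ ((A + 1) * (delta / (2 * (A + 1)))))//.
  by rewrite ler_wpM2r// divr_ge0 ?(ltW d0)// mulr_ge0 ?(ltW A1).
by rewrite [leLHS](_ : _ = delta / 2)//; field; rewrite gt_eqF.
Qed.

Section umap_sums.
Variables (R : realType) (n : nat) (E : set int).
Hypothesis n_gt0 : (0 < n)%N.
Hypothesis p1 : 1 <= (n + n)%:R :> R.
Local Notation Y := (LpE E p1).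

Lemma nrm_cvg (f : nat -> Y) (y : Y) (eta : R) : f k @[k --> \oo] --> y -> 0 < eta ->
  exists K, forall k, (K <= k)%N -> nrm (f k - y) <= eta.
Proof.
move=> /cvgrPdist_le /(_ eta%:C) fy eta0.
have [|K _ HK] := fy; first by rewrite ltcR.
by exists K => k Kk; have := HK k Kk; rewrite /= distrC norm_nrm lecR.
Qed.

Lemma nrm_cvg_fin (I : finType) (f : nat -> Y -> Y) (y : I -> Y) (eta : R) :
  (forall i, f k (y i) @[k --> \oo] --> y i) -> 0 < eta ->
  exists K, forall k i, (K <= k)%N -> nrm (f k (y i) - y i) <= eta.
Proof.
move=> fy eta0; have /choice[K HK] := fun i => nrm_cvg (fy i) eta0.
by exists (\max_i K i) => k i h; apply: HK; exact: leq_trans (leq_bigmax i) h.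
Qed.

(** Both ranges telescope. The umap inequality is tested with two signs only, 1 up to k0 and theta
    beyond. *)
Lemma sum_two_signs (T : nat -> {linear Y -> Y}) (theta : R[i]) k0 k1 y :
  (forall y, T 0%N y = 0) -> (k0 <= k1)%N ->
  \sum_(1 <= k < k1.+1) (if (k <= k0)%N then 1 else theta) *: (T k y - T k.-1 y) =
  T k0 y + theta *: (T k1 y - T k0 y).
Proof.
move=> T0 k01; rewrite big_add1/= (big_cat_nat (n := k0))//=; congr (_ + _).
  under eq_big_nat => k /andP[_ kk0] do rewrite kk0 scale1r.
  by rewrite telescope_sumr// T0 subr0.
under eq_big_nat => k /andP[kk0 _] do rewrite ltnNge kk0/=.
by rewrite -scaler_sumr telescope_sumr.
Qed.

End umap_sums.

Section umap_transcendental.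
Variables (R : realType) (sigma : R).
Hypothesis sigma_gt1 : 1 < sigma.
Local Notation fl k := (Num.floor (sigma ^+ k)).

Definition high_sign (d : nat) (theta : R[i]) (t : bool * 'I_d) : R[i] :=
  if t.1 then theta else 1.

(** On the high block the exponents of the common constant add up to sum [zneg] on one side and to
    sum [zpos] on the other; these differ by P(1), so the products differ by the factor -1. *)
Lemma prod_high_sign (d : nat) (P : 'I_d -> int) (w : circle R) : echar (\sum_i P i) w = -1 ->
  \prod_t high_sign (circle_val w) t ^+ block_exp P t =
  - \prod_t high_sign (circle_val w) t ^+ block_exp' P t.
Proof.
move=> wP; rewrite !prod_block /high_sign /=.
rewrite !(big1 _ _ (fun i => 1 ^+ _)) => [|i _|i _]; rewrite ?expr1n// !mulr1.
have e (z : int -> nat) : \prod_i circle_val w ^+ z (P i) = echar (\sum_i (z (P i))%:Z) w.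
  by rewrite echar_sum; apply: eq_bigr => i _.
rewrite !e (_ : \sum_i (zpos (P i))%:Z = \sum_i P i + \sum_i (zneg (P i))%:Z).
  by rewrite echarD wP mulN1r opprK.
rewrite -big_split/=; apply: eq_bigr => i _.
by have := zposBneg (P i); lia.
Qed.

(** The choices are made in this order: the low block k; k0 with T_k0 close to the identity on it;
    by [finite_rank_eLp], L beyond which T_k0 nearly kills the characters; the high block k' past L;
    kk with T_kk close to the identity on both blocks. Then T_k0 + theta (T_kk - T_k0), of norm at
    most 1 + eps, nearly fixes the low block and nearly multiplies the high one by theta. *)
Lemma umap_transcendental :
  (forall (p : nat) (p1 : 1 <= p%:R :> R), (2 <= p)%N -> ~~ odd p ->
     complex_umap (LpE (floor_powers sigma) p1)) ->
  ~ algebraicOver (ratr : rat -> R) sigma.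
Proof.
move=> H /(algebraic_recurrence sigma_gt1)[d [P [c [P1 [i0 oi0] Hc]]]].
pose I := (bool * 'I_d)%type.
have [n nE] : exists n, n = (\sum_i absz (P i))%N by eexists.
have n0 : (0 < n)%N by rewrite nE (bigD1 i0)//= ltn_addr//; case: (absz _) oi0.
have p1 : 1 <= (n + n)%:R :> R by rewrite ler1n addn_gt0 n0.
have evn : ~~ odd (n + n) by rewrite addnn odd_double.
(* E starts with the exponent 1; the maximum keeps all values of e in E. *)
pose e k := fl (maxn k 1).
have Ee k : floor_powers sigma (e k) by exists (maxn k 1) => //=; exact: leq_maxr.
pose eL := eLp p1 Ee.
have e1 k : (1 <= k)%N -> e k = fl k by move=> k1; rewrite /e; congr (fl _); exact/maxn_idPl.
have [K0 HK0] := floor_powers_inj sigma_gt1.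
have einj : exists K, forall j k, (K <= j)%N -> (K <= k)%N -> e j = e k -> j = k.
  exists (maxn K0 1) => j k; rewrite !geq_max => /andP[Kj j1] /andP[Kk k1].
  by rewrite !e1//; exact: HK0.
pose m : R := #|{: I}|%:R.
have m0 : 0 < m by rewrite ltr0n; apply/card_gt0P; exists (true, i0).
have [kappa /andP[kappa0 _] Hkappa] := expr_uniform (n + n) (ltW m0) (divr_gt0 ltr01 (ltr0Sn R 1)).
(* An error kappa in the norm costs at most 1 / 2 in the moment. Half of it is spent on the factor 1
   + eps, as eps m = kappa / 2, and half on the errors 3 eta at each of the m characters. *)
pose eps := kappa / (2 * m); have eps0 : 0 < eps by rewrite divr_gt0// mulr_gt0.
pose eta := kappa / (6 * m); have eta0 : 0 < eta by rewrite divr_gt0// mulr_gt0.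
have [T [T0 Tfin Tcvg Tsum]] := H _ p1 (leq_add n0 n0) evn eps eps0.
have [k kK Pk] := Hc (maxn K0 1%N).
move: kK; rewrite geq_max => /andP[kK k1].
have [k0 Hk0] := nrm_cvg_fin (f := fun j => T j) (fun i : 'I_d => Tcvg (eL (k + i)%N)) eta0.
have [Tb Tf] := Tfin k0.
have [L HL] := finite_rank_eLp n0 Ee einj Tb Tf eta0.
have [k' kL' Pk'] := Hc (maxn (k + d) L).
move: kL'; rewrite geq_max => /andP[kd' kL'].
pose idx (t : I) := block_index k k' t.
have idxk t : (k <= idx t)%N.
  rewrite /idx /block_index; case: t => [[] i]/=; rewrite ?leq_addr//.
  by rewrite (leq_trans _ (leq_addr _ _))// (leq_trans _ kd')// leq_addr.
have [k1' Hk1] := nrm_cvg_fin (f := fun j => T j) (fun t : I => Tcvg (eL (idx t))) eta0.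
pose kk := maxn k0 k1'.
pose p (t : I) := fl (idx t).
have pE : p = e \o idx by apply/funext => t; rewrite /p /= e1// (leq_trans k1).
have eL1 j : nrm (eL j) <= 1 by exact: nrm_eLp_le1.
have sum_le (a : I -> R[i]) : (forall t, normc (a t) = 1) -> nrm (\sum_t a t *: eL (idx t)) <= m.
  move=> a1; rewrite (le_trans (nrm_sum _ _))//.
  apply: (@le_trans _ _ (\sum_(t : I) 1)); last by rewrite sumr_const.
  by apply: ler_sum => t _; rewrite nrmZ a1 mul1r.
have flip_le (theta : R[i]) (a : I -> R[i]) : normc theta = 1 -> (forall t, normc (a t) = 1) ->
    moment n (epoly p (fun t => high_sign theta t * a t)) <= moment n (epoly p a) + 1 / 2.
  move=> th1 a1; pose S y := T k0 y + theta *: (T kk y - T k0 y).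
  set y := \sum_t a t *: eL (idx t).
  have Sy : nrm (S y) <= (1 + eps) * nrm y.
    have := Tsum kk (fun j => if (j <= k0)%N then 1 else theta) _ y.
    rewrite sum_two_signs ?leq_maxl// !norm_nrm -rmorphM lecR; apply => j.
    by case: ifP => _; rewrite normC_normc ?normc1 ?th1.
  have near t : nrm (high_sign theta t *: eL (idx t) - S (eL (idx t))) <= 3 * eta.
    have hT1 : nrm (T kk (eL (idx t)) - eL (idx t)) <= eta by apply: Hk1; exact: leq_maxr.
    case: t hT1 => [[] i]; rewrite /high_sign /= => hT1; set x := eL _ in hT1 *.
      have hT0 : nrm (T k0 x) <= eta by apply: HL; rewrite (leq_trans kL')// leq_addr.
      have -> : theta *: x - S x = (theta *: (- (T kk x - x)) + theta *: T k0 x) + - T k0 x.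
        by rewrite /S opprB !scalerBr opprD opprB [_ *: T k0 x - _]addrC [- T k0 x + _]addrC !addrA.
      by rewrite (le_trans (nrmD _ _))// nrmN (le_trans (lerD (nrmD _ _) (lexx _)))//
        !nrmZ nrmN th1 !mul1r; move: hT0 hT1; clear; lra.
    have hT0 : nrm (T k0 x - x) <= eta by apply: (Hk0 k0 i).
    have -> : 1 *: x - S x = - (T k0 x - x) + theta *: (- (T kk x - x) + (T k0 x - x)).
      by rewrite scale1r /S !opprB [x - T kk x + _]addrC addrA subrK opprD -scalerN opprB addrA.
    rewrite (le_trans (nrmD _ _))// nrmN nrmZ th1 mul1r.
    by have := nrmD (- (T kk x - x)) (T k0 x - x); rewrite nrmN; move: hT0 hT1; clear; lra.
  have SyE : S y = \sum_t a t *: S (eL (idx t)).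
    have Ty j : T j y = \sum_t a t *: T j (eL (idx t)).
      by rewrite linear_sum; apply: eq_bigr => t _; rewrite linearZ.
    rewrite /S !Ty -sumrB scaler_sumr -big_split/=.
    by apply: eq_bigr => t _; rewrite !scalerDr !scalerN !scalerA ![theta * a t]mulrC.
  have diff : nrm (\sum_t (high_sign theta t * a t) *: eL (idx t) - S y) <= 3 * eta * m.
    rewrite SyE -sumrB (le_trans (nrm_sum _ _))//.
    apply: (@le_trans _ _ (\sum_(t : I) 3 * eta)); last by rewrite sumr_const mulr_natr.
    by apply: ler_sum => t _; rewrite mulrC -scalerA -scalerBr nrmZ a1 mul1r.
  have ym : nrm y <= m by exact: sum_le.
  have key : nrm (\sum_t (high_sign theta t * a t) *: eL (idx t)) <= nrm y + kappa.
    have := nrmD (\sum_t (high_sign theta t * a t) *: eL (idx t) - S y) (S y); rewrite subrK.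
    have : 3 * eta * m = kappa / 2 by rewrite /eta; field; rewrite gt_eqF.
    have : eps * nrm y <= kappa / 2.
      have -> : kappa / 2 = eps * m by rewrite /eps; field; rewrite gt_eqF.
      by rewrite ler_wpM2l// ltW.
    by move: Sy diff; clear; lra.
  rewrite pE -!(nrm_sum_eLp n0 p1 Ee).
  have := Hkappa (nrm y) kappa; rewrite nrm_ge0 ym lexx (ltW kappa0) => /(_ isT isT); apply: le_trans.
  by rewrite lerXn2r ?nnegrE ?nrm_ge0// addr_ge0 ?nrm_ge0 ?(ltW kappa0).
(* That is exp(i pi / P(1)), whose power of exponent P(1) is -1. *)
pose w := expi ((2 * (\sum_i P i)%:~R)^-1 : R).
have wP : echar (\sum_i P i) w = -1.
  rewrite /w echar_expi invfM mulrCA mulfV ?intr_eq0// mulr1.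
  rewrite /circle_val /=.
  rewrite mulrAC mulfV// mul1r cospi sinpi.
  by apply/eqP; rewrite eq_complex/= oppr0 !eqxx.
have th1 : normc (circle_val w) = 1 by exact: normc_circle.
have s1 (t : I) : normc (high_sign (circle_val w) t) = 1 by rewrite /high_sign; case: ifP => _ //; rewrite normc1.
have [a a1] := moment_flip (etrans (sum_block_exp P) (esym nE)) (etrans (sum_block_exp' P) (esym nE)) (block_relation (etrans Pk (esym Pk')))
  s1 (prod_high_sign wP).
rewrite leNgt => /negP; apply.
have h1 := flip_le _ _ th1 a1.
have th1' : normc (circle_val w)^* = 1 by rewrite normc_conj.
(* The conjugate constant undoes the first change and yields the reverse inequality. *)
have h2 := flip_le _ (fun t => high_sign (circle_val w) t * a t) th1' (fun t => etrans (normcM _ _) (etrans (congr2 *%R (s1 t) (a1 t)) (mulr1 1))).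
move: h2; rewrite (_ : (fun t => high_sign _ t * _) = a); last first.
  apply/funext => t; rewrite mulrA /high_sign; case: ifP => _; rewrite ?mul1r//.
  by rewrite [_^* * _]mulrC mulC_conj th1 expr1n mul1r.
by move: h1; rewrite ltr_norml; clear; lra.
Qed.

End umap_transcendental.

(** * From transcendence to umap *)

(** A tuple v resonant with u takes only values of u, so v is u composed with one of the n^n maps g,
    and it has the same product of moduli. Summing over u and g gives n^n times the n-th power of
    the squared 2-norm. *)
Lemma moment_le_ell2 (R : realType) (I : finType) (p : I -> int) (a : I -> R[i]) n :
  (forall u v : {ffun 'I_n -> I}, \sum_j p (u j) = \sum_j p (v j) ->
     (forall j, a (u j) != 0) -> (forall j, a (v j) != 0) -> mult u =1 mult v) ->
  moment n (epoly p a) <= (n%:R * \sum_i normc (a i) ^+ 2) ^+ n.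
Proof.
move=> H; pose A i := normc (a i).
pose F (w : {ffun 'I_n -> I} * {ffun 'I_n -> I}) (g : {ffun 'I_n -> 'I_n}) : R :=
  (w.2 == [ffun j => w.1 (g j)])%:R * \prod_j A (w.1 j) ^+ 2.
have F0 w g : 0 <= F w g.
  by rewrite mulr_ge0// prodr_ge0// => j _; rewrite exprn_ge0// normc_ge0.
have h : moment n (epoly p a) <= \sum_w \sum_g F w g.
  rewrite -(normc_real (moment_ge0 n (epoly p a))) moment_epoly.
  rewrite (le_trans (normc_sum _ _ _))// big_mkcond/=; apply: ler_sum => w _.
  case: ifP => [/eqP res|_]; last by apply: sumr_ge0 => g _; exact: F0.
  rewrite normcM normc_conj !normc_prod -/A.
  have [/existsP[j /eqP a0]|] := boolP [exists j, a (w.1 j) == 0].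
    by rewrite (bigD1 j)//= a0 normc0 !mul0r sumr_ge0.
  have [/existsP[j /eqP a0] _|] := boolP [exists j, a (w.2 j) == 0].
    rewrite [X in _ * X](bigD1 j)//= a0 normc0 mul0r mulr0 sumr_ge0//.
  rewrite !negb_exists => /forallP a2 /forallP a1.
  have uv := H _ _ res a1 a2.
  have /fin_all_exists[g Hg] : forall j, exists j', w.1 j' = w.2 j.
    move=> j; have : (0 < mult w.1 (w.2 j))%N.
      by rewrite uv; apply/card_gt0P; exists j; rewrite inE.
    by move=> /card_gt0P[j']; rewrite inE => /eqP; exists j'.
  rewrite [leRHS](bigD1 [ffun j => g j])//= ler_wpDr ?sumr_ge0//.
  have e2 : w.2 == [ffun j => w.1 ([ffun j => g j] j)].
    by apply/eqP/ffunP => j; rewrite !ffunE Hg.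
  rewrite /F e2 mul1r; under [leRHS]eq_bigr do rewrite expr2.
  have eA : \prod_j A (w.2 j) = \prod_j A (w.1 j).
    by rewrite !(prod_mult A); apply: eq_bigr => i _; rewrite uv.
  by rewrite big_split/= -[X in _ * X <= _]/(\prod_j A (w.2 j)) eA.
apply: le_trans h _; rewrite exprMn.
rewrite -(pair_bigA _ (fun u v => \sum_g F (u, v) g))/=.
have -> : (\sum_i normc (a i) ^+ 2) ^+ n = \sum_(u : {ffun 'I_n -> I}) \prod_j A (u j) ^+ 2.
  by rewrite -(bigA_distr_bigA (fun _ i => A i ^+ 2)) prodr_const card_ord.
rewrite mulr_sumr; apply: ler_sum => u _; rewrite exchange_big/=.
have sumF g : \sum_v F (u, v) g = \prod_j A (u j) ^+ 2.
  rewrite (bigD1 [ffun j => u (g j)])//= [X in _ + X]big1 => [|v /negbTE vg].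
    by rewrite addr0 /F eqxx mul1r.
  by rewrite /F/= vg mul0r.
by under eq_bigr do rewrite sumF; rewrite sumr_const card_ffun card_ord -[leLHS]mulr_natl natrX.
Qed.

(** A monotone sequence of booleans starting at false jumps at most once, and only the sign at the
    jump survives in S. *)
Lemma sum_jumps (R : realType) (b : nat -> bool) (s : nat -> R[i]) m :
  b 0%N = false -> (forall k, b k -> b k.+1) ->
  let S := \sum_(1 <= k < m.+1) s k * ((b k)%:R - (b k.-1)%:R) in
  [/\ ~~ b m -> S = 0, S = 0 \/ exists k, S = s k & b 1%N -> (0 < m)%N -> S = s 1%N].
Proof.
move=> b0 bS; elim: m => [|m [h1 h2 h3]] /=; first by rewrite big_nil; split => //; left.
rewrite big_nat_recr//=; split.
- move=> nb; have nb' : ~~ b m by apply: contra nb; exact: bS.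
  by rewrite h1// (negbTE nb) (negbTE nb') subrr mulr0 addr0.
- have [bm|bm] := boolP (b m).
    by rewrite bS// subrr mulr0 addr0.
  rewrite h1// subr0 add0r; case: (b m.+1); last by left; rewrite mulr0.
  by right; exists m.+1; rewrite mulr1.
- move=> b1 _; case: m h1 h2 h3 => [_ _ _|m _ _ h3].
    by rewrite big_nil b1 b0 subr0 mulr1 add0r.
  have bk k : b k.+1 by elim: k => [//|k /bS].
  by rewrite h3// !bk subrr mulr0 addr0.
Qed.

Section unconditional.
Variables (R : realType) (n : nat) (E : set int).
Hypothesis n_gt0 : (0 < n)%N.
Hypothesis p1 : 1 <= (n + n)%:R :> R.
Variable e : nat -> int.
Hypothesis Ee : forall k, E (e k).
Hypothesis einj : injective e.
Hypothesis Esurj : forall q, E q -> exists k, e k = q.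
Hypothesis resonance : forall l, exists2 L, (l <= L)%N & forall x y : 'I_n -> nat,
  (forall j, (x j < l)%N || (L <= x j)%N) -> (forall j, (y j < l)%N || (L <= y j)%N) ->
  \sum_j e (x j) = \sum_j e (y j) ->
  forall k, (L <= k)%N -> #|[pred j | x j == k]| = #|[pred j | y j == k]|.
Local Notation Y := (LpE E p1).
Local Notation eL := (eLp p1 Ee).
Implicit Types (a s t : nat -> R[i]) (y : Y).

Definition pol K a : Y := \sum_(i < K) a i *: eL i.

Lemma nrm_pol K a : nrm (pol K a) ^+ (n + n) = moment n (epoly (fun i : 'I_K => e i) (fun i => a i)).
Proof. exact: nrm_sum_eLp. Qed.

Lemma pol_inj K : injective (fun i : 'I_K => e i).
Proof. by move=> i j /einj /val_inj. Qed.

Lemma fcoef_pol K a i : (i < K)%N -> fcoef (pol K a) (e i) = a i.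
Proof. by move=> iK; exact: (fcoef_sum_eLp p1 Ee (x := fun i : 'I_K => i) (fun i => a i) (Ordinal iK) (@pol_inj K)).
Qed.

Lemma polD K a b : pol K (fun i => a i + b i) = pol K a + pol K b.
Proof. by rewrite /pol -big_split; apply: eq_bigr => i _; rewrite scalerDl. Qed.

Lemma polZ K c a : pol K (fun i => c * a i) = c *: pol K a.
Proof. by rewrite /pol scaler_sumr; apply: eq_bigr => i _; rewrite scalerA. Qed.

Lemma eq_pol K a b : (forall i, (i < K)%N -> a i = b i) -> pol K a = pol K b.
Proof. by move=> ab; apply: eq_bigr => i _; rewrite ab. Qed.

Lemma pol_sum K (I : Type) (r : seq I) (P : pred I) (F : I -> nat -> R[i]) :
  \sum_(k <- r | P k) pol K (F k) = pol K (fun i => \sum_(k <- r | P k) F k i).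
Proof. by rewrite /pol exchange_big/=; apply: eq_bigr => i _; rewrite scaler_suml. Qed.

Lemma pol_widen K K' a : (K <= K')%N -> (forall i, (K <= i)%N -> a i = 0) -> pol K' a = pol K a.
Proof.
move=> KK' a0; rewrite /pol (big_ord_widen K' (fun i => a i *: eL i) KK') [RHS]big_mkcond/=.
by apply: eq_bigr => i _; case: ltnP => // /a0 ->; rewrite scale0r.
Qed.

Lemma ell2_le_pol K a : \sum_(i < K) normc (a i) ^+ 2 <= nrm (pol K a) ^+ 2.
Proof.
have := bessel_nrm n_gt0 (pol K a) (@pol_inj K).
by under eq_bigr => i _ do rewrite fcoef_pol//.
Qed.

(** Beyond L0 all resonances are permutations, by [resonance] with l = 0, so [moment_le_ell2]
    applies. *)
Lemma pol_ell2 : exists L0, forall K a, (forall i, (i < L0)%N -> a i = 0) ->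
  nrm (pol K a) ^+ 2 <= n%:R * \sum_(i < K) normc (a i) ^+ 2.
Proof.
have [L0 _ HL] := resonance 0; exists L0 => K a a0.
rewrite -(@ler_pXn2r _ n)// ?nnegrE ?exprn_ge0 ?nrm_ge0//; last first.
  by rewrite mulr_ge0// sumr_ge0// => i _; rewrite exprn_ge0// normc_ge0.
rewrite -exprM mul2n -addnn nrm_pol; apply: moment_le_ell2 => u v uv au av i.
have big (w : {ffun 'I_n -> 'I_K}) j : a (w j) != 0 -> (L0 <= w j)%N.
  by move=> aw; rewrite leqNgt; apply: contra aw => /a0 ->.
have [iL|Li] := ltnP i L0.
  have z (w : {ffun 'I_n -> 'I_K}) : (forall j, a (w j) != 0) -> mult w i = 0%N.
    move=> aw; apply: eq_card0 => j; rewrite !inE; apply/negbTE.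
    by apply: contraL iL => /eqP <-; rewrite -leqNgt; exact: big.
  by rewrite !z.
have := HL (fun j => u j) (fun j => v j) _ _ uv i Li.
by apply=> j; rewrite big// orbT.
Qed.

(** For unimodular s this is an isometry, by [resonance] across the gap where a vanishes. A
    multiplier with zeros is the mean of two unimodular ones, with 1 and with -1 in place of 0;
    truncations are covered in this way. *)
Lemma pol_contract l : exists2 L, (l <= L)%N & forall K a s c, normc c = 1 ->
  (forall i, (i < l)%N -> s i = c) -> (forall i, s i = 0 \/ normc (s i) = 1) ->
  (forall i, (l <= i < L)%N -> a i = 0) ->
  nrm (pol K (fun i => s i * a i)) <= nrm (pol K a).
Proof.
have [L lL HL] := resonance l; exists L => // K a s c c1 sc s01 agap.
have iso (t : nat -> R[i]) : (forall i, (i < l)%N -> t i = c) -> (forall i, normc (t i) = 1) ->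
    nrm (pol K (fun i => t i * a i)) = nrm (pol K a).
  move=> tc t1; apply/eqP; rewrite -(@eqrXn2 _ (n + n)) ?addn_gt0 ?n_gt0 ?nrm_ge0//.
  rewrite !nrm_pol; apply/eqP.
  have := @moment_isometry R 'I_K (fun i => e i) (fun i => a i) (fun i => t i) n.
  apply => [i|u v uv au av]; first exact: t1.
  have gap (w : {ffun 'I_n -> 'I_K}) j : a (w j) != 0 -> (w j < l)%N || (L <= w j)%N.
    apply: contraR; rewrite negb_or -leqNgt -ltnNge => h.
    by rewrite agap.
  have cnt := HL (fun j => u j) (fun j => v j) (fun j => gap u j (au j)) (fun j => gap v j (av j)) uv.
  apply: (@eq_prod_high n _ t c L (fun j => u j) (fun j => v j) cnt) => j.
    by have /orP[/tc|] := gap u j (au j); [right|left].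
  by have /orP[/tc|] := gap v j (av j); [right|left].
pose sg (x : R[i]) i := if s i == 0 then x else s i.
have sg1 x : normc x = 1 -> nrm (pol K (fun i => sg x i * a i)) = nrm (pol K a).
  move=> x1; apply: iso => i.
    move=> il; rewrite /sg sc//; case: eqP => // c0.
    by move: c1; rewrite c0 normc0 => /eqP; rewrite eq_sym oner_eq0.
  by rewrite /sg; case: eqP => // s0; case: (s01 i).
have -> : pol K (fun i => s i * a i) =
    2^-1 *: (pol K (fun i => sg 1 i * a i) + pol K (fun i => sg (-1) i * a i)).
  rewrite -polD -polZ; apply: eq_pol => i _; rewrite -mulrDl mulrA; congr (_ * _).
  rewrite /sg; case: eqP => [->|_]; first by rewrite subrr mulr0.
  by rewrite -mulr2n -[s i *+ 2]mulr_natl mulrA mulVf ?mul1r// pnatr_eq0.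
rewrite nrmZ (@normc_natV R 2) (le_trans (ler_wpM2l _ (nrmD _ _)))//.
by rewrite !sg1 ?normcN ?normc1//; lra.
Qed.

Lemma fourier_epoly (I : finType) (p : I -> int) (a : I -> R[i]) q :
  fourier (epoly p a) q = \sum_(i | p i == q) a i.
Proof.
rewrite /fourier.
have -> : (fun z => epoly p a z * echar (- q) z) = epoly (fun i => p i - q) a.
  by apply/funext => z; rewrite /epoly mulr_suml; apply: eq_bigr => i _; rewrite -mulrA -echarD.
by rewrite cintegral_epoly; apply: eq_bigl => i; rewrite subr_eq0.
Qed.

(** Weak lower semicontinuity for partial sums along e: a long enough one has the right coefficients
    at any finite set of frequencies, including those outside E, where both vanish. *)
Lemma nrm_le_pol y (B : R) : 0 <= B ->
  (forall l, exists2 l', (l <= l')%N & nrm (pol l' (fun i => fcoef y (e i))) <= B) -> nrm y <= B.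
Proof.
move=> B0 H; rewrite -(@ler_pXn2r _ (n + n)) ?nnegrE ?nrm_ge0 ?addn_gt0 ?n_gt0// nrm_moment//.
apply: moment_le_partial => //; first exact: tame_LpE.
move=> J r.
have /fin_all_exists[x Hx] : forall j, exists k, E (r j) -> e k = r j.
  move=> j; have [/Esurj[k ek]|nE] := pselect (E (r j)); first by exists k.
  by exists 0%N.
have [l lmax Hl] := H (\max_j x j).+1.
exists 'I_l, (fun i : 'I_l => e i); split; first exact: pol_inj.
  move=> j; rewrite fourier_epoly; have [Er|nE] := pselect (E (r j)); last first.
    rewrite big_pred0 => [|i]; last by apply/negbTE/eqP => ei; apply: nE; rewrite -ei.
    by rewrite -[RHS]/(fcoef y (r j)) fcoef_outside.
  have xl : (x j < l)%N by rewrite (leq_trans _ lmax)// ltnS leq_bigmax.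
  rewrite (big_pred1 (Ordinal xl)) => [/=|i]; first by rewrite Hx.
  by rewrite -(Hx j Er) (inj_eq einj).
by have := lerXn2r (n + n) (nrm_ge0 _) B0 Hl; rewrite nrm_pol.
Qed.

(** Otherwise every K would be followed by a stretch of sum more than eta, and the partial sums
    would pass B. *)
Lemma sum_tail (c : nat -> R) (B eta : R) : (forall i, 0 <= c i) ->
  (forall l, \sum_(i < l) c i <= B) -> 0 < eta ->
  exists K, forall l, \sum_(i < l) (K <= i)%N%:R * c i <= eta.
Proof.
move=> c0 cB eta0; apply: contrapT => H.
have step K : exists l, eta + \sum_(i < K) c i <= \sum_(i < l) c i.
  have [l Hl] : exists l, eta < \sum_(i < l) (K <= i)%N%:R * c i.
    apply: contrapT => h; apply: H; exists K => l; rewrite leNgt; apply/negP => lt.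
    by apply: h; exists l.
  exists (maxn K l).
  have -> : \sum_(i < K) c i = \sum_(i < maxn K l) (i < K)%N%:R * c i.
    rewrite (big_ord_widen (maxn K l) c (leq_maxl _ _)) big_mkcond.
    by apply: eq_bigr => i _; case: ifP; rewrite ?mul1r ?mul0r.
  have le : \sum_(i < l) (K <= i)%N%:R * c i <= \sum_(i < maxn K l) (K <= i)%N%:R * c i.
    rewrite (big_ord_widen (maxn K l) (fun i => (K <= i)%N%:R * c i) (leq_maxr _ _)) big_mkcond.
    by apply: ler_sum => i _; case: ifP => // _; rewrite mulr_ge0.
  apply: le_trans (lerD (le_trans (ltW Hl) le) (lexx _)) _.
  rewrite -big_split/=; apply: ler_sum => i _; rewrite -mulrDl.
  by case: leqP; rewrite ?add0r ?addr0 mul1r.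
have grow m : exists l, m%:R * eta <= \sum_(i < l) c i.
  elim: m => [|m [l Hl]]; first by exists 0%N; rewrite big_ord0 mul0r.
  have [l' Hl'] := step l; exists l'; apply: le_trans Hl'.
  by rewrite -natr1 mulrDl mul1r addrC lerD2l.
have [l Hl] := grow (Num.bound (`|B| / eta)).
have := le_trans Hl (cB l); rewrite leNgt => /negP; apply.
by rewrite (le_lt_trans (ler_norm _))// -ltr_pdivrMr// archi_boundP// divr_ge0// ltW.
Qed.

(** By Bessel the coefficients are square summable; [pol_ell2] makes every finite piece of the tail
    small in Y, and [nrm_le_pol] carries the bound over to the tail itself, before anything is known
    about convergence in Y. *)
Lemma nrm_polB_le y (eta : R) : 0 < eta ->
  exists K0, forall K, (K0 <= K)%N -> nrm (y - pol K (fun i => fcoef y (e i))) <= eta.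
Proof.
move=> eta0; have [L0 HL] := pol_ell2.
pose c i := normc (fcoef y (e i)) ^+ 2.
have c0 i : 0 <= c i by rewrite exprn_ge0// normc_ge0.
have cB l : \sum_(i < l) c i <= nrm y ^+ 2 by exact: (bessel_nrm n_gt0 y (@pol_inj l)).
have nR : (0 : R) < n%:R by rewrite ltr0n.
have e0 : 0 < eta ^+ 2 / n%:R by rewrite divr_gt0// exprn_gt0.
have [K1 HK1] := sum_tail c0 cB e0.
exists (maxn L0 K1) => K; rewrite geq_max => /andP[LK KK].
apply: nrm_le_pol => [|l]; first exact: ltW.
exists (maxn l K); first exact: leq_maxl.
have cE i : fcoef (y - pol K (fun i => fcoef y (e i))) (e i) = (K <= i)%N%:R * fcoef y (e i).
  rewrite fcoefD -scaleN1r fcoefZ mulN1r.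
  have [iK|Ki] := ltnP i K; first by rewrite fcoef_pol// subrr mul0r.
  rewrite mul1r fcoef_sum big1 ?subr0// => j _; rewrite fcoefZ fcoef_eLp (inj_eq einj).
  by case: eqP => [ji|]; rewrite ?mulr0//; have := ltn_ord j; rewrite ji ltnNge Ki.
rewrite (eq_pol (fun i _ => cE i)).
rewrite -(@ler_pXn2r _ 2)// ?nnegrE ?nrm_ge0 ?(ltW eta0)//.
apply: le_trans (HL _ _ _) _.
  by move=> i iL; rewrite leqNgt (leq_trans iL LK) mul0r.
rewrite mulrC -ler_pdivlMr//; apply: le_trans (HK1 (maxn l K)); apply: ler_sum => i _.
have [Ki|iK] := leqP K i; first by rewrite (leq_trans KK Ki) !mul1r.
by rewrite mul0r normc0 expr0n/= mulr_ge0.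
Qed.

Definition multiplier K t y : Y := pol K (fun i => t i * fcoef y (e i)).

Lemma multiplier_linear K t : linear (multiplier K t).
Proof.
move=> a x y; rewrite /multiplier -polZ -polD; apply: eq_pol => i _.
by rewrite fcoefD fcoefZ mulrDr mulrCA.
Qed.

HB.instance Definition _ K t :=
  GRing.isLinear.Build R[i] Y Y *:%R (multiplier K t) (multiplier_linear K t).

Lemma multiplier_bounded K t : bounded_op (multiplier K t).
Proof.
exists (\sum_(i < K) normc (t i) * nrm (eL i)) => y; rewrite !norm_nrm -rmorphM lecR.
rewrite (le_trans (nrm_sum _ _))// mulr_suml; apply: ler_sum => i _.
rewrite nrmZ normcM mulrAC; apply: ler_wpM2l; last exact: normc_fcoef.
by rewrite mulr_ge0 ?normc_ge0 ?nrm_ge0.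
Qed.

Lemma multiplier_finite_rank K t : finite_rank (multiplier K t).
Proof. by exists K, (fun i => eL i) => y; exists (fun i => t i * fcoef y (e i)). Qed.

Lemma sum_blocks (L : nat -> nat) N i : (forall j, (L j <= L j.+1)%N) ->
  \sum_(j < N) (L j <= i < L j.+1)%N%:R <= 1 :> R.
Proof.
move=> LS; have -> : \sum_(j < N) (L j <= i < L j.+1)%N%:R =
    (i < L N)%N%:R - (i < L 0%N)%N%:R :> R.
  elim: N => [|N ih]; first by rewrite big_ord0 subrr.
  rewrite big_ord_recr/= ih; have [iL|Li]/= := ltnP i (L N).
    by rewrite (leq_trans iL (LS N)) addr0.
  by rewrite addrC addrA addr0.
by case: (_ < _)%N; case: (_ < _)%N; rewrite ?subrr ?subr0 ?sub0r ?lexx ?ler01// lerNl lerN10.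
Qed.

(** Cauchy-Schwarz in the form 2 kappa F r <= r^2 + (kappa F)^2 with r = sqrt(n B_j), summed over j;
    the condition n <= N kappa^2 absorbs n. *)
Lemma mean_sqrt_le (N : nat) (B : 'I_N -> R) (F kappa : R) : 0 <= F -> 0 < kappa -> (0 < N)%N ->
  (forall j, 0 <= B j) -> \sum_j B j <= F ^+ 2 -> n%:R <= N%:R * kappa ^+ 2 ->
  \sum_j Num.sqrt (n%:R * B j) <= N%:R * (kappa * F).
Proof.
move=> F0 k0 N0 B0 BF Nk; have [F00|Fn0] := eqVneq F 0.
  rewrite big1 => [|j _]; first by rewrite F00 !mulr0.
  have B00 : B j = 0.
    apply/eqP; rewrite eq_le B0 andbT; apply: le_trans (_ : _ <= \sum_j B j) _.
      by rewrite (bigD1 j)//= lerDl sumr_ge0.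
    by rewrite (le_trans BF)// F00 expr0n.
  by rewrite B00 mulr0 sqrtr0.
have Fp : 0 < F by rewrite lt_neqAle eq_sym Fn0.
have kF : 0 < 2 * (kappa * F) by rewrite !mulr_gt0.
rewrite -(ler_pM2l kF) mulr_sumr.
apply: (@le_trans _ _ (\sum_j (n%:R * B j + (kappa * F) ^+ 2))).
  apply: ler_sum => j _.
  have nB : 0 <= n%:R * B j by rewrite mulr_ge0.
  rewrite -[in leRHS](sqr_sqrtr nB) -subr_ge0.
  have -> : Num.sqrt (n%:R * B j) ^+ 2 + (kappa * F) ^+ 2 - 2 * (kappa * F) * Num.sqrt (n%:R * B j) =
    (Num.sqrt (n%:R * B j) - kappa * F) ^+ 2 by ring.
  exact: sqr_ge0.
rewrite big_split/= -mulr_sumr sumr_const card_ord -[X in _ + X]mulr_natl.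
have h1 : n%:R * \sum_j B j <= N%:R * kappa ^+ 2 * F ^+ 2 by apply: ler_pM => //; rewrite sumr_ge0.
apply: le_trans (lerD h1 (lexx _)) _.
by rewrite [leRHS](_ : _ = N%:R * kappa ^+ 2 * F ^+ 2 + N%:R * (kappa * F) ^+ 2)//; ring.
Qed.

(** Truncation near L j is controlled by [pol_contract] only for functions without frequencies in
    the gap from L j to L (j + 1). A general y has mass in the gaps, but the N gaps are disjoint: on
    average over j the piece of y in the gap is small in 2-norm, hence in Y by [pol_ell2], and the
    mean of the N truncations inherits the averaged bound. *)
Theorem umap_of_resonance : complex_umap Y.
Proof.
move=> eps eps0; pose kappa := eps / 2; have k0 : 0 < kappa by rewrite divr_gt0.
(* This gives n <= N kappa^2, as [mean_sqrt_le] asks. And kappa = eps / 2 because each gap piece is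
   paid for twice: when it is removed from c, and when it is multiplied by S j. *)
pose N := (Num.bound (n%:R / kappa ^+ 2)).+1.
have k2 : 0 < kappa ^+ 2 by rewrite exprn_gt0.
have Nk : n%:R <= N%:R * kappa ^+ 2.
  rewrite -ler_pdivrMr// ltW// (lt_trans (archi_boundP _)) ?ltr_nat//.
  by rewrite divr_ge0// ltW.
have NR : (0 : R) < N%:R by rewrite ltr0n.
have NC : (N%:R : R[i]) != 0 by rewrite pnatr_eq0.
have [L0 HL0] := pol_ell2.
have /choice[thr Hthr] : forall l, exists L, (l <= L)%N /\ forall K a s c, normc c = 1 ->
    (forall i, (i < l)%N -> s i = c) -> (forall i, s i = 0 \/ normc (s i) = 1) ->
    (forall i, (l <= i < L)%N -> a i = 0) ->
    nrm (pol K (fun i => s i * a i)) <= nrm (pol K a).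
  by move=> l; have [L ? ?] := pol_contract l; exists L.
pose L j := iter j thr L0.
have LS j : (L j <= L j.+1)%N by exact: (proj1 (Hthr (L j))).
have Lmono j j' : (j <= j')%N -> (L j <= L j')%N.
  by elim: j' => [|j' ih]; [rewrite leqn0 => /eqP->|rewrite leq_eqVlt => /orP[/eqP->//|/ih/leq_trans]; apply].
(* T_1 is the mean of the truncations at L 0, ..., L (N - 1). With signs s the multiplier of
   the signed sum is the mean over j of S j, which is s 1 below L j. *)
pose b (j k i : nat) : bool := match k with 0%N => false | 1%N => (i < L j)%N | _ => (i < L N + k)%N end.
pose tau k i : R[i] := N%:R^-1 * \sum_(j < N) (b j k i)%:R.
pose T k : {linear Y -> Y} := multiplier (L N + k)%N (tau k).
have b_big j k i : (j <= N)%N -> (L N + k <= i)%N -> b j k i = false.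
  move=> jN ki; case: k ki => [//|[|k]] ki; apply/negbTE; rewrite -leqNgt //=.
  by rewrite (leq_trans (Lmono _ _ jN))// (leq_trans _ ki)// leq_addr.
have b_mono j k i : (j <= N)%N -> b j k i -> b j k.+1 i.
  move=> jN; case: k => [//|[|k]] /= h.
    by rewrite (leq_trans h)// (leq_trans (Lmono _ _ jN))// leq_addr.
  by rewrite (leq_trans h)// leq_add2l.
have tau_big k i : (L N + k <= i)%N -> tau k i = 0.
  by move=> ki; rewrite /tau big1 ?mulr0// => j _; rewrite b_big// ltnW.
exists T; split.
- by move=> y; apply: big1 => i _; rewrite /tau big1 ?mulr0 ?mul0r ?scale0r.
- by move=> k; split; [exact: multiplier_bounded|exact: multiplier_finite_rank].
- move=> y; apply/cvgrPdist_le => -[e1 e2]; rewrite ltcE/= => /andP[/eqP -> e10].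
  have [K0 HK0] := nrm_polB_le y e10; exists (maxn K0 2) => // k /=.
  rewrite geq_max => /andP[Kk k1]; rewrite norm_nrm lecR.
  have -> : T k y = pol (L N + k)%N (fun i => fcoef y (e i)).
    apply: eq_pol => i iK; rewrite /tau.
    under eq_bigr => j _.
      rewrite (_ : b j k i = true); last by case: k k1 iK {Kk} => [|[|k]].
      over.
    by rewrite sumr_const card_ord mulVf ?mul1r.
  by apply: HK0; rewrite (leq_trans Kk)// leq_addl.
move=> m s s1 y; rewrite !norm_nrm -rmorphM lecR.
case: m => [|m]; first by rewrite big_geq// nrm0 mulr_ge0 ?nrm_ge0// addr_ge0// ltW.
set M := m.+1.
have s1' k : normc (s k) = 1 by apply: complexI; rewrite -normC_normc s1.
pose S (j i : nat) : R[i] := \sum_(1 <= k < M.+1) s k * ((b j k i)%:R - (b j k.-1 i)%:R).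
pose c i := fcoef y (e i).
have sumE K : (L N + M <= K)%N -> \sum_(1 <= k < M.+1) s k *: (T k y - T k.-1 y) =
    N%:R^-1 *: \sum_(j < N) pol K (fun i => S j i * c i).
  move=> MK.
  have TE k : (k <= M)%N -> T k y = pol K (fun i => tau k i * c i).
    move=> kM; rewrite (@pol_widen (L N + k)%N)//.
      by rewrite (leq_trans _ MK)// leq_add2l.
    by move=> i ki; rewrite tau_big ?mul0r.
  transitivity (\sum_(1 <= k < M.+1) pol K (fun i => s k * (tau k i - tau k.-1 i) * c i)).
    rewrite big_nat_cond [RHS]big_nat_cond; apply: eq_bigr => k /andP[/andP[_ kM] _].
    rewrite TE// TE ?(leq_trans (leq_pred _))// -scaleN1r -polZ -polD -polZ.
    by apply: eq_pol => i _; ring.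
  rewrite !pol_sum -polZ; apply: eq_pol => i _.
  rewrite -!mulr_suml mulrA; congr (_ * _); rewrite exchange_big mulr_sumr/=.
  apply: eq_bigr => k _; rewrite /tau -mulrBr -sumrB mulrCA; congr (_ * _).
  by rewrite mulr_sumr.
(* On the right y is replaced by a partial sum long enough to contain the supports of all the
   multipliers; the loss is at most eta, which is arbitrary. *)
apply/ler_addgt0Pr => eta eta0; have eps1 : 0 < 1 + eps by rewrite addr_gt0.
have [K0 HK0] := nrm_polB_le y (divr_gt0 eta0 eps1).
pose K := maxn K0 (L N + M)%N.
rewrite (sumE K (leq_maxr _ _)) nrmZ normc_natV.
set F := nrm (pol K c).
have Fy : F <= nrm y + eta / (1 + eps).
  have e1 : pol K c = y - (y - pol K c) by rewrite opprB addrC subrK.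
  rewrite /F e1 (le_trans (nrmD _ _))// nrmN lerD2l.
  by apply: HK0; exact: leq_maxl.
pose B (j : 'I_N) := \sum_(i < K) (L j <= i < L j.+1)%N%:R * normc (c i) ^+ 2.
have B0 j : 0 <= B j by apply: sumr_ge0 => i _; rewrite mulr_ge0 ?exprn_ge0 ?normc_ge0.
have BF : \sum_j B j <= F ^+ 2.
  apply: le_trans (ell2_le_pol K c); rewrite exchange_big/=; apply: ler_sum => i _.
  by rewrite -mulr_suml ler_piMl ?exprn_ge0 ?normc_ge0// sum_blocks.
have Sj (j : 'I_N) : nrm (pol K (fun i => S j i * c i)) <= F + 2 * Num.sqrt (n%:R * B j).
  have jN : (j <= N)%N by exact: ltnW.
  have Sjump i := @sum_jumps R (fun k => b j k i) s M erefl (fun k => @b_mono j k i jN).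
  have S01 i : S j i = 0 \/ normc (S j i) = 1.
    have [_ [h|[k h]] _] := Sjump i; first by left.
    by right; rewrite (_ : S j i = s k).
  have Ss i : (i < L j)%N -> S j i = s 1%N.
    by move=> ij; have [_ _ h] := Sjump i; exact: h.
  have S1 i : normc (S j i) <= 1 by case: (S01 i) => ->; rewrite ?normc0.
  pose blk i := (L j <= i < L j.+1)%N.
  pose c1 i := (~~ blk i)%:R * c i; pose c2 i := (blk i)%:R * c i.
  have c12 i : c i = c1 i + c2 i by rewrite /c1 /c2; case: (blk i); rewrite /= mul0r mul1r ?add0r ?addr0.
  have blk_le (t : nat -> R[i]) : (forall i, normc (t i) <= 1) ->
      nrm (pol K (fun i => t i * c2 i)) <= Num.sqrt (n%:R * B j).
    move=> t1; rewrite -(@ler_pXn2r _ 2)// ?nnegrE ?nrm_ge0 ?sqrtr_ge0//.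
    rewrite sqr_sqrtr ?mulr_ge0//; apply: le_trans (HL0 _ _ _) _.
      move=> i iL; rewrite /c2 /blk leqNgt (leq_trans iL) ?mul0r ?mulr0//.
      exact: (Lmono 0%N).
    rewrite ler_wpM2l//; apply: ler_sum => i _; rewrite normcM /c2 /blk.
    case: (_ <= _ < _)%N; last by rewrite !mul0r normc0 mulr0 expr0n.
    by rewrite !mul1r exprMn ler_piMl ?exprn_ge0 ?normc_ge0// exprn_ile1 ?normc_ge0.
  have c2_le : nrm (pol K c2) <= Num.sqrt (n%:R * B j).
    have := blk_le (fun=> 1); rewrite normc1 lexx => /(_ (fun=> isT)).
    by rewrite (@eq_pol K _ c2)// => i _; rewrite mul1r.
  have e1 : pol K (fun i => S j i * c i) = pol K (fun i => S j i * c1 i) + pol K (fun i => S j i * c2 i).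
    by rewrite -polD; apply: eq_pol => i _; rewrite {1}c12 mulrDr.
  have e2 : pol K c1 = pol K c - pol K c2.
    rewrite -[- _]scaleN1r -polZ -polD; apply: eq_pol => i _.
    by rewrite {1}c12 mulN1r addrK.
  have h1 : nrm (pol K (fun i => S j i * c1 i)) <= nrm (pol K c1).
    apply: ((Hthr (L j)).2 K c1 (S j) (s 1%N)) => // i ij.
    by rewrite /c1 /blk ij mul0r.
  have h2 := nrmD (pol K c) (- pol K c2); rewrite nrmN -e2 -/F in h2.
  by rewrite e1 (le_trans (nrmD _ _))//; have := blk_le (S j) S1; move: h1 h2 c2_le; clear; lra.
have step : nrm (\sum_(j < N) pol K (fun i => S j i * c i)) <= N%:R * ((1 + eps) * F).
  rewrite (le_trans (nrm_sum _ _))// (le_trans (ler_sum _ (fun j _ => Sj j)))//.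
  rewrite big_split/= sumr_const card_ord -mulr_sumr -[F *+ N]mulr_natl.
  have F0 : 0 <= F by exact: nrm_ge0.
  have := mean_sqrt_le F0 k0 (isT : (0 < N)%N) B0 BF Nk; set X := \sum_j _ => hX.
  have -> : N%:R * ((1 + eps) * F) = N%:R * F + 2 * (N%:R * (kappa * F)) by rewrite /kappa; field.
  by rewrite lerD2l ler_wpM2l.
rewrite mulrC ler_pdivrMr// mulrC (le_trans step)// ler_wpM2l//.
rewrite (le_trans (ler_wpM2l (ltW eps1) Fy))// mulrDr lerD2l.
by rewrite mulrC divfK// gt_eqF.
Qed.


End unconditional.

Lemma injective_unbounded (kappa : nat -> nat) : injective kappa ->
  forall B, exists J, forall j, (J <= j)%N -> (B <= kappa j)%N.
Proof.
move=> kinj; elim=> [|B [J HJ]]; first by exists 0%N.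
have [[j0 kj0]|nB] := pselect (exists j0, kappa j0 = B).
  exists (maxn J j0.+1) => j; rewrite geq_max => /andP[Jj j0j].
  rewrite ltn_neqAle HJ// andbT; apply/eqP => Bj.
  by move: j0j; rewrite (kinj j0 j) ?ltnn// kj0.
exists J => j Jj; rewrite ltn_neqAle HJ// andbT; apply/eqP => Bj.
by apply: nB; exists j.
Qed.

Section enumeration.
Variables (R : realType) (sigma : R).
Hypothesis sigma_gt1 : 1 < sigma.
Local Notation fl k := (Num.floor (sigma ^+ k)).

(** Floors may repeat for small exponents, whereas partial sums need distinct characters. As E is
    countable and infinite, it is reindexed injectively. *)
Lemma floor_powers_enum : exists kappa : nat -> nat,
  [/\ forall j, (1 <= kappa j)%N, injective (fun j => fl (kappa j)) &
      forall q, floor_powers sigma q -> exists j, fl (kappa j) = q].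
Proof.
have Einf : infinite_set (floor_powers sigma).
  move=> /finite_fsetP[X EX].
  have [L HL] := floor_powers_unbounded sigma_gt1 (\max_(q <- X) absz q).+1%N.
  have : floor_powers sigma (fl L.+1) by exists L.+1.
  rewrite EX /= => hX; have := HL L.+1 (leqnSn _).
  by rewrite ltnNge (big_rem _ hX)/= leq_maxl.
have : (floor_powers sigma #= [set: nat])%card.
  by rewrite card_eq_le; apply/andP; split; [exact: countableP|apply/infiniteP].
move=> /card_set_bijP[f [_ finj fsurj]].
have /choice[kappa Hk] : forall j, exists k, (1 <= k)%N /\ f (fl k) = j.
  by move=> j; have [_ [k k1 <-] fj] := fsurj j I; exists k.
have Ek j : floor_powers sigma (fl (kappa j)) by exists (kappa j) => //; case: (Hk j).
exists kappa; split.
- by move=> j; case: (Hk j).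
- by move=> i j /= /(congr1 f); rewrite (Hk i).2 (Hk j).2.
- move=> q Eq; exists (f q); apply: finj; rewrite ?inE//.
  by rewrite (Hk (f q)).2.
Qed.

Lemma transcendental_umap (n : nat) (p1 : 1 <= (n + n)%:R :> R) : (0 < n)%N ->
  ~ algebraicOver (ratr : rat -> R) sigma ->
  complex_umap (LpE (floor_powers sigma) p1).
Proof.
move=> n0 tr; have [kappa [k1 einj esurj]] := floor_powers_enum.
have kinj : injective kappa by move=> i j kij; apply: einj; rewrite /= kij.
have Ee j : floor_powers sigma (fl (kappa j)) by exists (kappa j) => //; exact: k1.
apply: (umap_of_resonance n0 p1 Ee einj esurj) => l.
have [L' lL' HL'] := floor_resonance sigma_gt1 (transcendental_peval tr) n (\max_(j < l) kappa j).+1.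
have [J HJ] := injective_unbounded kinj L'.
exists (maxn l J); first exact: leq_maxl.
have split x : (x < l)%N || (maxn l J <= x)%N ->
    (kappa x < (\max_(j < l) kappa j).+1)%N || (L' <= kappa x)%N.
  case/orP => [xl|]; last by rewrite geq_max => /andP[_ /HJ ->]; rewrite orbT.
  by rewrite ltnS (leq_bigmax (Ordinal xl)).
move=> x y xl yl xy k; rewrite geq_max => /andP[_ /HJ Lk].
have := HL' (kappa \o x) (kappa \o y) (fun j => split _ (xl j)) (fun j => split _ (yl j)) xy _ Lk.
have e (z : 'I_n -> nat) : #|[pred j | kappa (z j) == kappa k]| = #|[pred j | z j == k]|.
  by apply: eq_card => j; rewrite !inE (inj_eq kinj).
by rewrite !e.
Qed.

End enumeration.

Lemma even_half (p : nat) : (2 <= p)%N -> ~~ odd p -> exists2 n, (0 < n)%N & p = (n + n)%N.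
Proof.
move=> p2 op; exists p./2; first by rewrite half_gt0.
by rewrite addnn -[LHS]odd_double_half (negbTE op).
Qed.

Lemma umbsS (R : realType) (S S' : set R[i]) N E : S' `<=` S -> umbs S N E -> umbs S' N E.
Proof.
move=> SS H eps eps0; have [F HF] := H eps eps0.
by exists F => G a s GE Gs; apply: HF => // q /Gs /SS.
Qed.

Theorem proposition13p1p3 (R : realType) (sigma : R) (sigma_gt1 : 1 < sigma) :
  let E : set int := floor_powers sigma in
  [<-> (* (i) *)
       ~ algebraicOver (ratr : rat -> R) sigma;
       (* (ii) *)
       forall (p : nat) (p1 : 1 <= p%:R :> R), (2 <= p)%N -> ~~ odd p ->
         complex_umap (LpE E p1);
       (* (iii), complex signs *)
       forall p : nat, (2 <= p)%N -> ~~ odd p -> complex_umbs (cLnorm R p%:R) E;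
       (* (iii), real signs *)
       forall p : nat, (2 <= p)%N -> ~~ odd p -> real_umbs (cLnorm R p%:R) E;
       (* (iv) *)
       pseudo_independent R E;
       (* (v) *)
       forall (eps : R) (m : nat), 0 < eps -> (1 <= m)%N ->
         exists l : nat, forall k : 'I_m -> nat, (forall i, (l <= k i)%N) ->
           (sidon_constant R (range (fun i => Num.floor (sigma ^+ k i)))
              < (1 + eps)%:E)%E ].
Proof.
move=> E; tfae.
- move=> tr p p1 p2 op; have [n n0 pn] := even_half p2 op; subst p.
  exact: transcendental_umap.
- move=> /(umap_transcendental sigma_gt1) tr p p2 op; have [n n0 ->] := even_half p2 op.
  exact: transcendental_complex_umbs.
- move=> H p p2 op; apply: umbsS (H p p2 op) => c [] -> /=; first by rewrite normr1.
  by rewrite normrN1.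
- move=> /(real_umbs_transcendental sigma_gt1) tr.
  by apply: independent_pseudo_independent; exact: floor_powers_independent.
- move=> H eps m eps0 m1; have [M HM] := pseudo_independent_sidon m H eps0.
  have [L HL] := floor_powers_unbounded sigma_gt1 M.
  exists (maxn L 1) => k kL; apply: HM.
  + by move=> q [i _ <-]; exists (k i) => //=; rewrite (leq_trans _ (kL i))// leq_maxr.
  + by move=> q [i _ <-]; apply: HL; rewrite (leq_trans _ (kL i))// leq_maxl.
  + by exists (fun i => Num.floor (sigma ^+ k i)).
- exact: sidon_transcendental.
Qed.
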